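(* Let $p>1$ and let $\mu$ be a nondegenerate probability distribution on $\mathbb{R}$ with zero mean and finite $p$-th absolute moment. Let $U=\widetilde{\varphi}_\mu(\mathbb{D})$ be the $\Delta^\infty$-convex $\mu$-domain constructed from $\mu$ as described in the context. If $\mu$ is atomless, then the boundary of $U$ has the equation $$y=\gamma(x)=H\{\varphi_\mu\}(\varphi_\mu^{-1}(x))=H\{F_\mu^{-1}\}(F_\mu(x)),$$ where $x$ ranges over the values taken by $\varphi_\mu$ on $(0,2\pi)$.
   Context: $Z_t$ is a standard planar Brownian motion started at $0$. For a plane domain $U$ containing $0$, $\tau_U$ denotes the first exit time of $Z_t$ from $U$. A probability distribution on $\mathbb{R}$ is nondegenerate if it is not the point mass at the origin. A $\mu$-domain is a simply connected domain $U\ni 0$ such that $\Re(Z_{\tau_U})\sim\mu$. A domain $U$ is $\Delta^\infty$-convex if, for every $z\in U$, the vertical ray $\{w:\Re(w)=\Re(z),\ \Im(w)\ge \Im(z)\}$ lies entirely in $U$. The plane is given coordinates $z=x+iy$. Construction: let $F_\mu$ be the c.d.f. of $\mu$ and $G_\mu(u)=F_\mu^{-1}(u)=\inf\{x: F_\mu(x)\ge u\}$, $u\in(0,1)$, its pseudo-inverse (quantile function). Let $\varphi_\mu(\theta)=G_\mu(\theta/2\pi)$ for $\theta\in(0,2\pi)$, extended $2\pi$-periodically, and let $a_n=\frac1\pi\int_0^{2\pi}\varphi_\mu(\theta)\cos(n\theta)\,d\theta$ and $b_n=\frac1\pi\int_0^{2\pi}\varphi_\mu(\theta)\sin(n\theta)\,d\theta$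 for $n\ge1$. Define $\widetilde{\varphi}_\mu(z)=\sum_{n=1}^\infty (a_n-ib_n)z^n$ on the open unit disc $\mathbb{D}$. The constructed domain is $U=\widetilde{\varphi}_\mu(\mathbb{D})$; it is the unique $\Delta^\infty$-convex $\mu$-domain with $\mathbf{E}(\tau_U^{q/2})<\infty$ for some $q>1$. The inverse of $\varphi_\mu$ is $\varphi_\mu^{-1}=2\pi F_\mu$. Hilbert transform: for a $2\pi$-periodic function $f$, $H\{f\}(x)=\lim_{\eta\to0^+}\frac{1}{2\pi}\int_{\eta\le|t|\le\pi}f(x-t)\cot(t/2)\,dt$. For a $1$-periodic function $f$ (in particular $F_\mu^{-1}$ extended $1$-periodically from $(0,1)$), $H\{f\}(x)=\lim_{\eta\to0^+}\int_{\eta\le|t|\le1/2}f(x-t)\cot(\pi t)\,dt$, so that $H$ commutes with positive dilations.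
   Formalization: The boundary need not equal the curve y=γ(x); proved instead: the boundary points accessible from inside U are exactly the curve and the full boundary is its closure, with γ valued in [-∞,+∞], finite μ-a.e., and no curve point over x where γ(x)=-∞. *)

(* Defs.v *)
From HB Require Import structures.
From mathcomp Require Import all_boot all_order all_algebra.
From mathcomp Require Import complex.
From mathcomp Require Import all_classical all_reals all_analysis.

Set Implicit Arguments.
Unset Strict Implicit.
Unset Printing Implicit Defensive.

Import Order.TTheory GRing.Theory Num.Theory.
Import numFieldNormedType.Exports.

Local Open Scope classical_set_scope.
Local Open Scope ring_scope.
Local Open Scope complex_scope.

(* Written with MathComp and MathComp-Analysis. *)

(* R[i] with the topology induced by the modulus. *)
Notation plane R := (R[i]^o)%type.

Section topology.
Context {T : topologicalType}.

Definition boundary (A : set T) : set T := closure A `\` interior A.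

(* Boundary points that are the endpoint of an arc which otherwise lies in A,
   i.e. the boundary as it is reached from inside A. *)
Definition accessible_boundary (R : realType) (A : set T) : set T :=
  [set w | boundary A w /\
    exists sigma : R -> T, [/\ {within `[0, 1], continuous sigma},
      forall t, 0 <= t < 1 -> A (sigma t) & sigma 1 = w]].

End topology.

Section distributions.
Context {R : realType}.
Implicit Types mu : probability (measurableTypeR R) R.

Definition atomless mu := forall x : R, mu [set x] = 0%E.

Definition not_dirac0 mu :=
  ~ (forall A, measurable A -> mu A = \d_(0 : R) A).

Definition zero_mean mu := (\int[mu]_x (x : R)%:E = 0)%E.

Definition finite_abs_moment mu (p : R) :=
  (\int[mu]_x (`|x : R| `^ p)%:E < +oo)%E.

Definition dist_fun mu (x : R) : R := fine (mu `]-oo, x]%classic).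

Definition quantile mu (u : R) : R := inf [set x | u <= dist_fun mu x].

(* 1-periodic extension of the quantile function from ]0, 1[; the (junk)
   values at the integers only enter through integrals. *)
Definition quantile_per mu (u : R) : R := quantile mu (u - (Num.floor u)%:~R).

Definition phi mu (theta : R) : R := quantile_per mu (theta / (2 * pi)).

Definition phi_inv mu (x : R) : R := 2 * pi * dist_fun mu x.

Definition phi_range mu : set R := phi mu @` `]0, 2 * pi[%classic.

Definition cosine_coef mu (n : nat) : R :=
  pi^-1 * \int[lebesgue_measure]_(theta in `[0, 2 * pi])
    (phi mu theta * cos (n%:R * theta)).

Definition sine_coef mu (n : nat) : R :=
  pi^-1 * \int[lebesgue_measure]_(theta in `[0, 2 * pi])
    (phi mu theta * sin (n%:R * theta)).

Definition phi_tilde mu (z : plane R) : plane R :=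
  limn (fun N : nat =>
    \sum_(1 <= n < N) (cosine_coef mu n -i* sine_coef mu n) * z ^+ n : plane R).

Definition mu_domain mu : set (plane R) := phi_tilde mu @` [set z | `|z| < 1].

End distributions.

Section hilbert_transform.
Context {R : realType}.
Implicit Types f : R -> R.

Definition cot (x : R) : R := cos x / sin x.

Definition hilbert2pi_trunc f (x eta : R) : R :=
  (2 * pi)^-1 * \int[lebesgue_measure]_(t in [set t | eta <= `|t| <= pi])
    (f (x - t) * cot (t / 2)).

Definition hilbert1_trunc f (x eta : R) : R :=
  \int[lebesgue_measure]_(t in [set t | eta <= `|t| <= 2^-1])
    (f (x - t) * cot (pi * t)).

(* The limits are taken in the extended reals: the principal value is -oo at
   an upward jump of f. *)
Definition hilbert2pi f (x : R) : \bar R :=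
  lim ((hilbert2pi_trunc f x eta)%:E @[eta --> 0^'+]).

Definition hilbert1 f (x : R) : \bar R :=
  lim ((hilbert1_trunc f x eta)%:E @[eta --> 0^'+]).

End hilbert_transform.

Section boundary_curve.
Context {R : realType}.
Implicit Types mu : probability (measurableTypeR R) R.

Definition gamma mu (x : R) : \bar R := hilbert2pi (phi mu) (phi_inv mu x).

(* There is no point of the curve above an x such that gamma mu x = -oo. *)
Definition gamma_curve mu : set (plane R) :=
  [set w | phi_range mu (complex.Re w) /\
           (complex.Im w)%:E = gamma mu (complex.Re w)].

End boundary_curve.

(* Main.v *)
Require Import Defs.
From HB Require Import structures.
From mathcomp Require Import all_boot all_order all_algebra.
From mathcomp Require Import complex.
From mathcomp Require Import all_classical all_reals all_analysis.
From mathcomp Require Import measurable_realfun.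
From mathcomp Require Import ring lra.

(* Proof idea.  Let F be the c.d.f., G the quantile function; read phi_tilde in the
   upper half-plane, where it is a Poisson integral u + i v of G.  As G is increasing, u is increasing along
   horizontals and v along verticals; hence v has a lower envelope W at the boundary, with
   values in [-oo, +oo).  An algebraic identity between the conjugate Poisson kernel and
   cot (pi (u - s)) gives, by monotone convergence, that the truncated Hilbert transforms of
   G at a point r converge to W at that point, and that v > W along each level curve
   {u = c}, which comes down to the boundary point of parameter F c.  As v is unbounded far
   away on these curves, the image is the epigraph of the function h := W o F over the open
   interval where 0 < F < 1.  By Tonelli, W is finite almost everywhere; it is -oo at every
   jump of G.

   An epigraph may have boundary points off the graph: h is upper semicontinuous but not
   continuous.  What excludes bad ones is that h has no one-sided drop: by the
   Cauchy-Riemann equations on small squares, h(c) is at most the limsup of h on each side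
   of c, and h is unbounded near finite endpoints.  With upper semicontinuity this yields an
   intermediate value property, from which both boundary statements follow. *)

Set Implicit Arguments.
Unset Strict Implicit.
Unset Printing Implicit Defensive.

Import Order.TTheory GRing.Theory Num.Theory.
Import numFieldNormedType.Exports.

Local Open Scope classical_set_scope.
Local Open Scope ring_scope.

(** * Integration over the unit interval *)

Section unit_interval_integral.
Context {R : realType}.
Local Notation leb := (@lebesgue_measure R).
Implicit Types (f g k : R -> R) (a b C : R).

(** The half-plane sends the parameters 0 and 1, where the periodic extension of G falls back, to
    infinity; G is then monotone along the whole boundary line. The kernels have total mass 1 and 0,
    so G can be recentred at any level c, and most inequalities come from a kernel and G - c
    changing sign at the same parameter. Nothing is differentiated under the integral sign and
    univalence is never invoked: the Cauchy-Riemann equations enter through difference quotients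
    whose error is uniform in the parameter, and the image is found by intermediate values along
    level curves. The envelope stays in the extended reals because the cotangent integral may
    diverge, though only downwards. All levels inside a jump of G lie over one boundary parameter,
    which is why levels c and parameters u are carried separately. *)

Definition unit_itv : set R := `]0, 1[%classic.

Definition L1 f := leb.-integrable unit_itv (EFin \o f).

Definition mfun k := measurable_fun unit_itv (k : R -> R).

Definition I01 f : R := \int[leb]_(s in unit_itv) f s.

Lemma unit_itvP (s : R) : unit_itv s <-> 0 < s < 1.
Proof. by rewrite /unit_itv /= in_itv. Qed.

Lemma measurable_unit_itv : measurable (unit_itv : set (measurableTypeR R)).
Proof. exact: measurable_itv. Qed.
#[local] Hint Resolve measurable_unit_itv : core.

(** The inverse is continuous only off 0; the point 0, with its default value, is split off as a
    singleton. *)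
Lemma measurable_invr : measurable_fun [set: R] (fun x : R => x^-1).
Proof.
have mN0 : measurable (~` [set 0 : R]) by apply: measurableC.
rewrite (_ : [set: R] = [set 0] `|` ~` [set 0]); last by rewrite setUv.
apply/measurable_funU => //; split.
  by apply: measurable_fun_set1.
apply: open_continuous_measurable_fun => [|x /set_mem /= x0].
  by rewrite openC; exact: closed_eq.
by apply: inv_continuous; apply/eqP.
Qed.

Lemma L1_mfun f : L1 f -> mfun f.
Proof. by move=> /(measurable_int _) /measurable_EFinP. Qed.

Lemma leb_unit_itv : leb unit_itv = 1%E.
Proof. by rewrite /unit_itv lebesgue_measure_itv/= lte_fin ltr01 oppr0 adde0. Qed.

Lemma L1_cst C : L1 (fun=> C).
Proof.
have lty : (leb unit_itv < +oo)%E by rewrite leb_unit_itv ltry.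
apply: measurable_bounded_integrable => //.
exists `|C|; split; first by rewrite num_real.
by move=> y Cy /= x _; exact: ltW.
Qed.

Lemma L1D f g : L1 f -> L1 g -> L1 (fun s => f s + g s).
Proof. by move=> hf hg; have := integrableD measurable_unit_itv hf hg; apply: eq_integrable. Qed.

Lemma L1Z C f : L1 f -> L1 (fun s => C * f s).
Proof. by move=> hf; have := @integrableZl _ _ _ leb _ measurable_unit_itv C _ hf; apply: eq_integrable. Qed.

Lemma L1B f g : L1 f -> L1 g -> L1 (fun s => f s - g s).
Proof. by move=> hf hg; have := integrableB measurable_unit_itv hf hg; apply: eq_integrable. Qed.

Lemma L1N f : L1 f -> L1 (fun s => - f s).
Proof. by move=> hf; have := integrableN hf; apply: eq_integrable. Qed.

Lemma L1_norm f : L1 f -> L1 (fun s => `|f s|).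
Proof. by move=> hf; have := integrable_abse hf; apply: eq_integrable. Qed.

Lemma L1_le f g : mfun f -> (forall s, unit_itv s -> `|f s| <= g s) -> L1 g -> L1 f.
Proof.
move=> mf fg hg; apply: le_integrable hg => //; first exact/measurable_EFinP.
move=> s us /=; rewrite lee_fin (le_trans (fg _ us)) //; exact: ler_norm.
Qed.

Lemma L1M k f C : mfun k -> (forall s, unit_itv s -> `|k s| <= C) -> L1 f ->
  L1 (fun s => k s * f s).
Proof.
move=> mk kC hf; apply: (@L1_le _ (fun s => C * `|f s|)).
- by apply: measurable_funM => //; exact: L1_mfun.
- by move=> s us; rewrite normrM ler_wpM2r// kC.
- exact/L1Z/L1_norm.
Qed.

Lemma L1_eq f g : (forall s, unit_itv s -> f s = g s) -> L1 f -> L1 g.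
Proof. by move=> fg; apply: eq_integrable => // s /set_mem us /=; rewrite fg. Qed.

Lemma I01_eq f g : (forall s, unit_itv s -> f s = g s) -> I01 f = I01 g.
Proof. by move=> fg; apply: eq_Rintegral => s /set_mem; exact: fg. Qed.

Lemma I01D f g : L1 f -> L1 g -> I01 (fun s => f s + g s) = I01 f + I01 g.
Proof. by move=> hf hg; exact: RintegralD. Qed.

Lemma I01B f g : L1 f -> L1 g -> I01 (fun s => f s - g s) = I01 f - I01 g.
Proof. by move=> hf hg; exact: RintegralB. Qed.

Lemma I01Z C f : L1 f -> I01 (fun s => C * f s) = C * I01 f.
Proof. by move=> hf; exact: RintegralZl. Qed.

Lemma I01N f : L1 f -> I01 (fun s => - f s) = - I01 f.
Proof.
by move=> hf; rewrite -mulN1r -I01Z//; apply: I01_eq => s _; rewrite mulN1r.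
Qed.

Lemma I01_cst C : I01 (fun=> C) = C.
Proof.
transitivity (C * fine (leb unit_itv)); first exact: Rintegral_cst.
by rewrite leb_unit_itv mulr1.
Qed.

Lemma I01_le f g : L1 f -> L1 g -> (forall s, unit_itv s -> f s <= g s) -> I01 f <= I01 g.
Proof. by move=> hf hg fg; exact: le_Rintegral. Qed.

Lemma I01_ge0 f : (forall s, unit_itv s -> 0 <= f s) -> 0 <= I01 f.
Proof. by move=> f0; apply: Rintegral_ge0. Qed.

Lemma I01_abs f g : L1 f -> L1 g -> (forall s, unit_itv s -> `|f s| <= g s) ->
  `|I01 f| <= I01 g.
Proof.
move=> hf hg fg; apply: (le_trans (le_normr_Rintegral _ hf)) => //.
by apply: I01_le => //; exact: L1_norm.
Qed.

Lemma EFin_I01 f : L1 f -> (I01 f)%:E = (\int[leb]_(s in unit_itv) (f s)%:E)%E.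
Proof. by move=> hf; rewrite /I01 /Rintegral fineK//; exact: integrable_fin_num. Qed.

Lemma L1_indic a b : L1 (\1_`[a, b]).
Proof.
apply: (@L1_le _ (fun=> 1)); last exact: L1_cst.
  by apply: measurable_funTS; exact: measurable_indic.
by move=> s _; rewrite indicE; case: (_ \in _); rewrite ?normr1 ?normr0.
Qed.

Lemma I01_indic a b : 0 < a -> a <= b -> b < 1 -> I01 (\1_`[a, b]) = b - a.
Proof.
move=> a0 ab b1; rewrite /I01 /Rintegral.
rewrite (@integral_indic _ _ R leb unit_itv measurable_unit_itv `[a, b]%classic); last exact: measurable_itv.
have lab : leb `[a, b]%classic = (b - a)%:E.
  rewrite lebesgue_measure_itv/= lte_fin.
  by case: ltrgtP ab => //= -> _; rewrite subrr.
rewrite setIidl; first by rewrite [X in fine X]lab.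
move=> s /=; rewrite /unit_itv /= !in_itv/= => /andP[sa sb].
by rewrite (lt_le_trans a0 sa) (le_lt_trans sb b1).
Qed.

Lemma I01_ge_itv f a b C : L1 f -> 0 < a -> a <= b -> b < 1 ->
  (forall s, unit_itv s -> 0 <= f s) -> (forall s, a <= s <= b -> C <= f s) ->
  C * (b - a) <= I01 f.
Proof.
move=> hf a0 ab b1 f0 fC; rewrite -(I01_indic a0 ab b1) -I01Z; last exact: L1_indic.
apply: I01_le => //; first exact/L1Z/L1_indic.
move=> s us; rewrite indicE; have [/set_mem/=|_] := boolP (s \in _).
  by rewrite in_itv/= => /fC; rewrite mulr1.
by rewrite mulr0 f0.
Qed.

Lemma I01_cvg0 (K : nat -> R -> R) f C : (forall n, mfun (K n)) ->
  (forall n s, unit_itv s -> `|K n s| <= C) ->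
  (forall s, unit_itv s -> K n s @[n --> \oo] --> 0) -> L1 f ->
  I01 (fun s => K n s * f s) @[n --> \oo] --> 0.
Proof.
move=> mK KC K0 hf.
have [|||||] := @dominated_convergence _ _ R leb _ measurable_unit_itv
  (fun n s => (K n s * f s)%:E) (cst 0%E) (fun s => (C * `|f s|)%:E).
- move=> n; apply/measurable_EFinP/measurable_funM; [exact: mK|exact: (L1_mfun hf)].
- exact: measurable_cst.
- apply: aeW => s us; apply: cvg_EFin; first by apply: nearW.
  rewrite /= /comp /=; rewrite -[X in _ --> X](mul0r (f s)).
  by apply: cvgM; [exact: K0|exact: cvg_cst].
- exact/L1Z/L1_norm.
- apply: aeW => s n us /=; rewrite lee_fin normrM ler_wpM2r//; exact: KC.
move=> _ _; rewrite integral_cst// mul0e => /fine_cvgP[_].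
by apply: cvg_trans; apply: near_eq_cvg; exact: nearW.
Qed.

End unit_interval_integral.
#[global] Hint Resolve measurable_unit_itv : core.

(** * Poisson and conjugate Poisson kernels *)

Section half_plane_kernel.
Context {R : realType}.
Implicit Types (x y s t c sg : R).

Definition cspi s : R := cos (pi * s).
Definition snpi s : R := sin (pi * s).

(** This is |zeta sin (pi s) + cos (pi s)|^2, that is, [snpi s ^+ 2] times the squared distance from
    zeta to [tpar s]. The polynomial form has no singularity at integers s, so bounds and
    measurability hold on the whole line. *)
Definition kden x y s : R := (x * snpi s + cspi s) ^+ 2 + (y * snpi s) ^+ 2.

(* In the half-plane coordinate zeta = x + i y of the disc (see [disc_pt]), kerP + i kerQ
   is (1 + z e^(-2 i pi s)) / (1 - z e^(-2 i pi s)): the Poisson and conjugate Poisson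
   kernels for the boundary point of parameter s. *)
Definition kerP x y s : R := y / kden x y s.

Definition kerQ x y s : R :=
  (x * (snpi s ^+ 2 - cspi s ^+ 2) + cspi s * snpi s * (1 - x ^+ 2 - y ^+ 2))
  / kden x y s.

(* The boundary point of parameter s sits at tpar s = - cot (pi s) on the real axis. *)
Definition tpar s : R := - (cspi s / snpi s).

(** [tpar s] equals tan (pi s - pi / 2), hence the arctangent. *)
Definition tinv t : R := 2^-1 + atan t / pi.

Lemma cs2sn2 s : cspi s ^+ 2 + snpi s ^+ 2 = 1.
Proof. exact: cos2Dsin2. Qed.

Lemma snpi_gt0 s : 0 < s < 1 -> 0 < snpi s.
Proof.
move=> /andP[s0 s1]; apply: sin_gt0_pi; rewrite mulr_gt0 ?pi_gt0//=.
by rewrite gtr_pMr ?pi_gt0.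
Qed.

Lemma snpi_sub u s : snpi (s - u) = snpi s * cspi u - cspi s * snpi u.
Proof. by rewrite /snpi mulrBr sinB. Qed.

Lemma tpar_sub u s : 0 < u < 1 -> 0 < s < 1 ->
  tpar s - tpar u = snpi (s - u) / (snpi s * snpi u).
Proof.
move=> /snpi_gt0 u0 /snpi_gt0 s0; rewrite snpi_sub /tpar.
by field; rewrite !gt_eqF.
Qed.

Lemma tpar_lt u s : 0 < u -> u < s -> s < 1 -> tpar u < tpar s.
Proof.
move=> u0 us s1.
have u01 : 0 < u < 1 by rewrite u0 (lt_trans us).
have s01 : 0 < s < 1 by rewrite s1 (lt_trans u0).
rewrite -subr_gt0 tpar_sub// divr_gt0//; last by rewrite mulr_gt0// snpi_gt0.
by rewrite snpi_gt0// subr_gt0 us/=; lra.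
Qed.

Lemma tpar_le u s : 0 < u -> u <= s -> s < 1 -> tpar u <= tpar s.
Proof.
move=> u0; rewrite le_eqVlt => /predU1P[->//|us] s1; exact/ltW/tpar_lt.
Qed.

Lemma tinv_itv t : 0 < tinv t < 1.
Proof.
have := atan_gtNpi2 t; have := atan_ltpi2 t => h1 h2.
have p0 := pi_gt0 R.
have a1 : atan t / pi < 2^-1 by rewrite ltr_pdivrMr// mulrC.
have a2 : - 2^-1 < atan t / pi by rewrite ltr_pdivlMr// mulNr mulrC.
by rewrite /tinv; lra.
Qed.

Lemma tinvK t : tpar (tinv t) = t.
Proof.
rewrite /tpar /cspi /snpi /tinv mulrDr mulrCA divff ?gt_eqF ?pi_gt0// mulr1.
by rewrite addrC cosDpihalf sinDpihalf mulNr opprK -[RHS]atanK.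
Qed.

Lemma tparK s : 0 < s < 1 -> tinv (tpar s) = s.
Proof.
move=> /andP[s0 s1]; have /andP[i0 i1] := tinv_itv (tpar s).
have [h|h|//] := ltgtP (tinv (tpar s)) s.
  by have := tpar_lt i0 h s1; rewrite tinvK ltxx.
by have := tpar_lt s0 h i1; rewrite tinvK ltxx.
Qed.

Lemma tinv_lt t t' : t < t' -> tinv t < tinv t'.
Proof.
move=> tt; have /andP[i0 i1] := tinv_itv t; have /andP[j0 j1] := tinv_itv t'.
rewrite ltNge; apply/negP => h.
by have := tpar_le j0 h i1; rewrite !tinvK leNgt tt.
Qed.

(** As a quadratic form in ([cspi s], [snpi s]), [kden x y] has determinant y^2 and trace 1 + x^2 +
    y^2, and on unit vectors a positive form is at least determinant over trace. The proof writes
    the difference as a sum of two squares. *)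
Lemma kden_lower x y s : y ^+ 2 <= kden x y s * (1 + x ^+ 2 + y ^+ 2).
Proof.
have h := cs2sn2 s.
rewrite /kden; set c := cspi s in h *; set d := snpi s in h *.
suff: 0 <= ((x * d + c) ^+ 2 + (y * d) ^+ 2) * (1 + x ^+ 2 + y ^+ 2) -
   y ^+ 2 * (c ^+ 2 + d ^+ 2) by rewrite h mulr1 subr_ge0.
have -> : ((x * d + c) ^+ 2 + (y * d) ^+ 2) * (1 + x ^+ 2 + y ^+ 2) -
   y ^+ 2 * (c ^+ 2 + d ^+ 2) =
   (x * d + c) ^+ 2 + (x * (x * d + c) + y ^+ 2 * d) ^+ 2 by ring.
by rewrite addr_ge0// sqr_ge0.
Qed.

Lemma one_sqr_gt0 x y : 0 < 1 + x ^+ 2 + y ^+ 2.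
Proof. by rewrite -addrA ltr_pwDl// addr_ge0 ?sqr_ge0. Qed.

Lemma kden_gt0 x y s : 0 < y -> 0 < kden x y s.
Proof.
move=> y0; have := kden_lower x y s.
have y2 : 0 < y ^+ 2 by rewrite exprn_gt0.
by move=> /(lt_le_trans y2); rewrite pmulr_lgt0// one_sqr_gt0.
Qed.

Lemma kden_inv_le x y s : 0 < y ->
  (kden x y s)^-1 <= (1 + x ^+ 2 + y ^+ 2) / y ^+ 2.
Proof.
move=> y0; have d0 := kden_gt0 x s y0.
by rewrite ler_pdivlMr ?exprn_gt0// ler_pdivrMl// kden_lower.
Qed.

Lemma kerP_gt0 x y s : 0 < y -> 0 < kerP x y s.
Proof. by move=> y0; rewrite divr_gt0// kden_gt0. Qed.

Lemma cs_le1 s : `|cspi s| <= 1. Proof. exact: cos_max. Qed.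
Lemma sn_le1 s : `|snpi s| <= 1. Proof. exact: sin_max. Qed.

Lemma kerP_bound x y s : 0 < y -> `|kerP x y s| <= (1 + x ^+ 2 + y ^+ 2) / y.
Proof.
move=> y0; rewrite gtr0_norm ?kerP_gt0// /kerP.
rewrite (le_trans (ler_wpM2l (ltW y0) (kden_inv_le x s y0)))//.
by rewrite le_eqVlt; apply/orP; left; apply/eqP; field; rewrite gt_eqF.
Qed.

Lemma kerQ_bound x y s : 0 < y ->
  `|kerQ x y s| <= (`|x| + `|1 - x ^+ 2 - y ^+ 2|) * ((1 + x ^+ 2 + y ^+ 2) / y ^+ 2).
Proof.
move=> y0; have d0 := kden_gt0 x s y0.
rewrite /kerQ normrM (gtr0_norm (x := (_)^-1)) ?invr_gt0//.
apply: ler_pM => //; [by rewrite invr_ge0 ltW| |exact: kden_inv_le].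
apply: (le_trans (ler_normD _ _)); apply: lerD; rewrite normrM.
  rewrite ler_piMr// ler_norml; have := cs2sn2 s.
  by have := sqr_ge0 (snpi s); have := sqr_ge0 (cspi s) => *; apply/andP; split; lra.
by rewrite ler_piMl// normrM mulr_ile1 ?cs_le1 ?sn_le1.
Qed.

Lemma cspi_cont : continuous cspi.
Proof.
move=> s; apply: continuous_comp; last exact: continuous_cos.
exact: mulrl_continuous.
Qed.

Lemma snpi_cont : continuous snpi.
Proof.
move=> s; apply: continuous_comp; last exact: continuous_sin.
exact: mulrl_continuous.
Qed.

Lemma mfun_cspi : measurable_fun [set: R] cspi.
Proof. by apply: continuous_measurable_fun; exact: cspi_cont. Qed.

Lemma mfun_snpi : measurable_fun [set: R] snpi.
Proof. by apply: continuous_measurable_fun; exact: snpi_cont. Qed.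

Lemma mfun_inv (k : R -> R) : measurable_fun [set: R] k ->
  measurable_fun [set: R] (fun s => (k s)^-1).
Proof. by move=> mk; exact: (measurableT_comp measurable_invr mk). Qed.

Lemma mfun_kden x y : measurable_fun [set: R] (kden x y).
Proof.
have mc := mfun_cspi; have ms := mfun_snpi.
apply: measurable_funD; apply: measurable_funX; last exact: measurable_funM.
by apply: measurable_funD => //; exact: measurable_funM.
Qed.

Lemma mfun_kerP x y : measurable_fun [set: R] (kerP x y).
Proof.
by apply: measurable_funM => //; apply: mfun_inv; exact: mfun_kden.
Qed.

Lemma mfun_kerQ x y : measurable_fun [set: R] (kerQ x y).
Proof.
apply: measurable_funM; last by apply: mfun_inv; exact: mfun_kden.
have mc := mfun_cspi; have ms := mfun_snpi.
apply: measurable_funD; apply: measurable_funM => //.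
  by apply: measurable_funB; exact: measurable_funX.
by apply: measurable_funM.
Qed.

Section on_interval.
Variables (x y s : R).
Hypotheses (y0 : 0 < y) (s01 : 0 < s < 1).
Let s0 := snpi_gt0 s01.

Lemma onetpar2 : 1 + tpar s ^+ 2 = (snpi s) ^- 2.
Proof.
rewrite /tpar sqrrN.
have -> : 1 + (cspi s / snpi s) ^+ 2 = (cspi s ^+ 2 + snpi s ^+ 2) / snpi s ^+ 2.
  by field; rewrite gt_eqF.
by rewrite cs2sn2 mul1r.
Qed.

Lemma kdenE : kden x y s = snpi s ^+ 2 * ((x - tpar s) ^+ 2 + y ^+ 2).
Proof. by rewrite /kden /tpar; field; rewrite gt_eqF. Qed.

Lemma dist_gt0 : 0 < (x - tpar s) ^+ 2 + y ^+ 2.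
Proof. by rewrite ltr_wpDl ?sqr_ge0// exprn_gt0. Qed.

Lemma kerPE : kerP x y s = (1 + tpar s ^+ 2) * (y / ((x - tpar s) ^+ 2 + y ^+ 2)).
Proof.
have d0 := dist_gt0.
by rewrite onetpar2 /kerP kdenE; field; rewrite !gt_eqF.
Qed.

Lemma kerQE : kerQ x y s =
  (1 + tpar s ^+ 2) * ((x - tpar s) / ((x - tpar s) ^+ 2 + y ^+ 2)) + tpar s.
Proof.
have d0 := dist_gt0.
rewrite /kerQ kdenE.
have d1 : snpi s ^+ 2 * ((x - tpar s) ^+ 2 + y ^+ 2) != 0.
  by rewrite gt_eqF// mulr_gt0// exprn_gt0.
have -> : cspi s = - (tpar s * snpi s) by rewrite /tpar; field; rewrite gt_eqF.
by field; rewrite !gt_eqF.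
Qed.

End on_interval.

Definition kerPsi t0 x y s : R :=
  (1 + tpar s ^+ 2) * (((x - t0) ^+ 2 + y ^+ 2) /
    ((tpar s - t0) * ((x - tpar s) ^+ 2 + y ^+ 2))).

(* Compares the conjugate kernel at zeta with the kernel of the Hilbert transform at u;
   the remainder kerPsi has the sign of tpar s - tpar u. *)
Lemma kernel_identity u x y s : 0 < y -> 0 < u < 1 -> 0 < s < 1 -> s != u ->
  kerQ x y s + (x - tpar u) / y * kerP x y s =
  cot (pi * (u - s)) + kerPsi (tpar u) x y s.
Proof.
move=> y0 u01 s01 su.
have tu : tpar s - tpar u != 0.
  rewrite subr_eq0; apply/negP => /eqP e; move: su.
  by rewrite -(tparK s01) -(tparK u01) e eqxx.
have d0 := dist_gt0 x s y0.
(* Subtraction formula for the cotangent; after it both sides are rational in [tpar s], [tpar u], x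
   and y. *)
have -> : cot (pi * (u - s)) = (1 + tpar s * tpar u) / (tpar u - tpar s).
  have sp := snpi_gt0 s01; have up := snpi_gt0 u01.
  rewrite /cot mulrBr cosB sinB -/(cspi u) -/(cspi s) -/(snpi u) -/(snpi s).
  have cE r : 0 < snpi r -> cspi r = - (tpar r * snpi r).
    by move=> r0; rewrite /tpar; field; rewrite gt_eqF.
  have -> := cE _ sp; have -> := cE _ up.
  have tu' : tpar u - tpar s != 0 by rewrite -oppr_eq0 opprB.
  have d : snpi u * - (tpar s * snpi s) - - (tpar u * snpi u) * snpi s != 0.
    rewrite (_ : _ - _ = snpi u * snpi s * (tpar u - tpar s)); last by ring.
    by rewrite !mulf_neq0// gt_eqF.
  by field; rewrite d tu'.
rewrite /kerPsi kerQE// kerPE//.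
have tu' : tpar u - tpar s != 0 by rewrite -oppr_eq0 opprB.
by field; rewrite tu tu' !gt_eqF.
Qed.

(** For fixed s the kernel is the Moebius map sending zeta to (zeta cos - sin) / (i (zeta sin +
    cos)), the angle being pi s. Its determinant is i, of modulus 1, and [kden] is the squared
    modulus of its denominator; this is the usual formula for the distance between two image
    points. *)
Lemma kernel_dist x y x' y' s : 0 < y -> 0 < y' ->
  (kerP x y s - kerP x' y' s) ^+ 2 + (kerQ x y s - kerQ x' y' s) ^+ 2 =
  ((x - x') ^+ 2 + (y - y') ^+ 2) / (kden x y s * kden x' y' s).
Proof.
move=> y0 y0'; have d := kden_gt0 x s y0; have d' := kden_gt0 x' s y0'.
have e : kerP x y s = y * (cspi s ^+ 2 + snpi s ^+ 2) / kden x y s.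
  by rewrite cs2sn2 mulr1.
have e' : kerP x' y' s = y' * (cspi s ^+ 2 + snpi s ^+ 2) / kden x' y' s.
  by rewrite cs2sn2 mulr1.
have -> : ((x - x') ^+ 2 + (y - y') ^+ 2) / (kden x y s * kden x' y' s) =
  ((x - x') ^+ 2 + (y - y') ^+ 2) * (cspi s ^+ 2 + snpi s ^+ 2) ^+ 2 / (kden x y s * kden x' y' s).
  by rewrite cs2sn2 expr1n mulr1.
move: d d'; rewrite e e' /kerQ /kden => d d'.
by field; rewrite !gt_eqF.
Qed.

End half_plane_kernel.

(** * The power series as a kernel integral *)

Section power_series.
Context {R : realType}.
Implicit Types (x y s : R) (g : R -> R) (a z w : R[i]).
Local Open Scope complex_scope.
Local Notation normc := (@ComplexField.Normc.normc R).

(* Cayley map zeta |-> (zeta - i) / (zeta + i) from the upper half-plane onto the disc. *)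
Definition disc_pt x y : R[i] := (x +i* (y - 1)) / (x +i* (y + 1)).

(** The character e^(-2 i pi s), kept as a square so that [cspi s] and [snpi s], rather than the
    doubled angle, appear in the kernel identities. *)
Definition char2 s : R[i] := (cspi s -i* snpi s) ^+ 2.

Lemma ReD a z : complex.Re (a + z) = complex.Re a + complex.Re z.
Proof. by case: a; case: z. Qed.

Lemma Re_le_normc a : `|complex.Re a| <= normc a.
Proof.
by have := normc_ge_Re a; rewrite -lecR; case: a => p q; rewrite normc_def.
Qed.

Lemma char2X n s : char2 s ^+ n = cos (n%:R * (2 * (pi * s))) -i* sin (n%:R * (2 * (pi * s))).
Proof.
have c2 : char2 s = cos (2 * (pi * s)) -i* sin (2 * (pi * s)).
  rewrite /char2 expr2 mulr_natl cos_mulr2n sin_mulr2n; apply/eqP; rewrite eq_complex /=.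
  have h := cs2sn2 s; apply/andP; split; apply/eqP.
    by rewrite -/(cspi s) mulrN mulNr opprK; lra.
  by rewrite -/(cspi s) -/(snpi s); lra.
move: (2 * (pi * s)) c2 => t c2.
elim: n => [|n IHn]; first by rewrite expr0 mul0r cos0 sin0 oppr0.
rewrite exprS IHn c2 -natr1 mulrDl mul1r cosD sinD; apply/eqP.
by rewrite eq_complex /=; apply/andP; split; apply/eqP; ring.
Qed.

Lemma normc_char2 s : normc (char2 s) = 1.
Proof. by rewrite /char2 expr2 ComplexField.Normc.normcM /= sqrrN cs2sn2 sqrtr1 mulr1. Qed.

Lemma disc_pt_lt1 x y : 0 < y -> normc (disc_pt x y) < 1.
Proof.
move=> y0; rewrite /disc_pt ComplexField.Normc.normcM ComplexField.Normc.normcV /=.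
have n0 : 0 < x ^+ 2 + (y + 1) ^+ 2.
  by rewrite ltr_wpDl ?sqr_ge0// exprn_gt0//; lra.
rewrite ltr_pdivrMr ?sqrtr_gt0// mul1r ltr_sqrt// ltrD2l.
by rewrite -subr_gt0 (_ : _ - _ = 4 * y)//; [lra|ring].
Qed.

(** Stated without division, so the nonvanishing of the last factor is left to the user. Multiplying
    by zeta + i and by e^(i pi s) turns both sides into expressions whose only denominator is
    [kden]. *)
Lemma cayley_kernel x y s : 0 < y ->
  1 + disc_pt x y * char2 s =
  (kerP x y s +i* kerQ x y s) * (1 - disc_pt x y * char2 s).
Proof.
move=> y0; have d0 := kden_gt0 x s y0; have h := cs2sn2 s.
have z0 : x +i* (y + 1) != 0 :> R[i].
  by rewrite eq_complex /= negb_and orbC gt_eqF//; lra.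
apply: (mulfI z0).
have E0 : cspi s +i* snpi s != 0 :> R[i].
  apply/negP; rewrite eq_complex /= => /andP[/eqP c0 /eqP n0].
  by move: h; rewrite c0 n0 expr0n/= addr0 => /eqP; rewrite eq_sym oner_eq0.
have EE : (cspi s +i* snpi s) * (cspi s -i* snpi s) = 1.
  by apply/eqP; rewrite eq_complex /=; apply/andP; split; apply/eqP; [rewrite -h|]; ring.
apply: (mulfI E0).
have Ee : (cspi s +i* snpi s) * char2 s = cspi s -i* snpi s.
  by rewrite /char2 expr2 mulrA EE mul1r.
have zz : (x +i* (y + 1)) * disc_pt x y = x +i* (y - 1).
  by rewrite /disc_pt mulrC divfK.
transitivity ((x +i* (y + 1)) * (cspi s +i* snpi s) + (x +i* (y - 1)) * (cspi s -i* snpi s)).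
  by rewrite -zz -Ee; ring.
transitivity ((kerP x y s +i* kerQ x y s) *
    ((x +i* (y + 1)) * (cspi s +i* snpi s) - (x +i* (y - 1)) * (cspi s -i* snpi s))); last first.
  by rewrite -zz -Ee; ring.
have -> : kerP x y s = y * (cspi s ^+ 2 + snpi s ^+ 2) / kden x y s.
  by rewrite h mulr1.
move: d0; rewrite /kerQ /kden => d0; apply/eqP; rewrite eq_complex /=.
by apply/andP; split; apply/eqP; field; rewrite gt_eqF.
Qed.

Section integral.
Variables (g : R -> R) (x y : R) (a : R[i]).
Hypotheses (gL1 : L1 g) (y0 : 0 < y).
Let z := disc_pt x y.
Let w s := z * char2 s.

Definition four_cos n : R := I01 (fun s => cos (n%:R * (2 * (pi * s))) * g s).
Definition four_sin n : R := I01 (fun s => sin (n%:R * (2 * (pi * s))) * g s).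

Let S N := \sum_(1 <= n < N) (2 * four_cos n -i* (2 * four_sin n)) * z ^+ n.

Let cosmeas n : mfun (fun s => cos (n%:R * (2 * (pi * s))) : R).
Proof.
apply: measurable_funTS; apply: continuous_measurable_fun => s.
apply: continuous_comp; last exact: continuous_cos.
apply: cvgM; first exact: cvg_cst.
by apply: cvgM; [exact: cvg_cst|apply: cvgM; [exact: cvg_cst|exact: cvg_id]].
Qed.

Let sinmeas n : mfun (fun s => sin (n%:R * (2 * (pi * s))) : R).
Proof.
apply: measurable_funTS; apply: continuous_measurable_fun => s.
apply: continuous_comp; last exact: continuous_sin.
apply: cvgM; first exact: cvg_cst.
by apply: cvgM; [exact: cvg_cst|apply: cvgM; [exact: cvg_cst|exact: cvg_id]].
Qed.

Let cosL1 n : L1 (fun s => cos (n%:R * (2 * (pi * s))) * g s).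
Proof. by apply: (@L1M _ _ _ 1) => // s _; exact: cos_max. Qed.

Let sinL1 n : L1 (fun s => sin (n%:R * (2 * (pi * s))) * g s).
Proof. by apply: (@L1M _ _ _ 1) => // s _; exact: sin_max. Qed.

Let partial_sum N :
  L1 (fun s => complex.Re (a * \sum_(1 <= n < N.+1) 2 * w s ^+ n) * g s) /\
  I01 (fun s => complex.Re (a * \sum_(1 <= n < N.+1) 2 * w s ^+ n) * g s) =
  complex.Re (a * S N.+1).
Proof.
elim: N => [|N [IH1 IH2]].
  rewrite /S big_geq// mulr0; split.
    by apply: (@L1_eq _ (fun=> 0)); [move=> s _; rewrite big_geq// mulr0 mul0r|exact: L1_cst].
  rewrite (@I01_eq _ _ (fun=> 0)) ?I01_cst// => s _.
  by rewrite big_geq// mulr0 mul0r.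
set p := 2 * complex.Re (a * z ^+ N.+1); set q := 2 * complex.Im (a * z ^+ N.+1).
have e s : complex.Re (a * \sum_(1 <= n < N.+2) 2 * w s ^+ n) * g s =
    complex.Re (a * \sum_(1 <= n < N.+1) 2 * w s ^+ n) * g s +
    (p * (cos (N.+1%:R * (2 * (pi * s))) * g s) +
     q * (sin (N.+1%:R * (2 * (pi * s))) * g s)).
  rewrite big_nat_recr//= mulrDr ReD mulrDl; congr (_ + _).
  rewrite exprMn char2X /p /q; case: (z ^+ N.+1) => z1 z2; case: a => a1 a2 /=.
  by ring.
have l : L1 (fun s => p * (cos (N.+1%:R * (2 * (pi * s))) * g s) +
     q * (sin (N.+1%:R * (2 * (pi * s))) * g s)).
  by apply: L1D; apply: L1Z.
split; first by apply: (@L1_eq _ _ _ (fun s _ => esym (e s))); exact: L1D.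
rewrite (I01_eq (fun s _ => e s)) I01D// IH2 I01D ?I01Z//; try exact: L1Z.
rewrite /S [in RHS]big_nat_recr// mulrDr ReD; congr (_ + _).
rewrite -/(four_cos _) -/(four_sin _) /p /q.
by case: (z ^+ N.+1) => z1 z2; case: a => a1 a2 /=; ring.
Qed.

Let geom N s : \sum_(1 <= n < N.+1) 2 * w s ^+ n =
  (kerP x y s +i* kerQ x y s) - 1 - 2 * w s ^+ N.+1 / (1 - w s).
Proof.
have w1 : 1 - w s != 0.
  rewrite subr_eq0; apply/eqP => e; have := disc_pt_lt1 x y0.
  have : normc (w s) = 1 by rewrite -e /= expr1n expr0n/= addr0 sqrtr1.
  by rewrite /w ComplexField.Normc.normcM normc_char2 mulr1 => ->; rewrite ltxx.
have K : kerP x y s +i* kerQ x y s = (1 + w s) / (1 - w s).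
  by rewrite /w /z cayley_kernel// mulfK.
rewrite K; elim: N => [|N IHN]; first by rewrite big_geq// expr1; field.
rewrite big_nat_recr//= IHN [w s ^+ N.+2]exprS.
by field.
Qed.

Let r := normc z.
Let r1 : r < 1. Proof. exact: disc_pt_lt1. Qed.
Let r0 : 0 <= r. Proof. by rewrite /r /z; case: (disc_pt _ _) => p q /=; exact: sqrtr_ge0. Qed.

Let normcX (b : R[i]) n : normc (b ^+ n) = normc b ^+ n.
Proof.
elim: n => [|n IHn]; first by rewrite /= expr1n expr0n/= addr0 sqrtr1.
by rewrite !exprS ComplexField.Normc.normcM IHn.
Qed.

Let normw s : normc (w s) = r.
Proof. by rewrite /w ComplexField.Normc.normcM normc_char2 mulr1. Qed.

(** The factor [a] avoids complex-valued integrals: a = 1 yields the real part of the power series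
    and a = -i its imaginary part. The geometric sum of 2 w^n converges to the kernel minus 1, which
    explains the subtracted mean of g. *)
Lemma powser_cvg :
  complex.Re (a * S N) @[N --> \oo] -->
  I01 (fun s => complex.Re (a * (kerP x y s +i* kerQ x y s)) * g s) -
  complex.Re a * I01 g.
Proof.
rewrite -(cvg_shiftS (fun N => complex.Re (a * S N))) /=.
have KL1 : L1 (fun s => complex.Re (a * (kerP x y s +i* kerQ x y s)) * g s).
  have e s : unit_itv s -> complex.Re a * (kerP x y s * g s) - complex.Im a * (kerQ x y s * g s) =
      complex.Re (a * (kerP x y s +i* kerQ x y s)) * g s.
    by move=> _; case: a => a1 a2 /=; ring.
  apply: (L1_eq e); apply: L1B; apply: L1Z.
    apply: L1M gL1 => [|s _]; last exact: kerP_bound.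
    by apply: measurable_funTS; exact: mfun_kerP.
  apply: L1M gL1 => [|s _]; last exact: kerQ_bound.
  by apply: measurable_funTS; exact: mfun_kerQ.
(* Uniform bound on the remainder 2 w^(N+1) / (1 - w): w s has modulus r for every s, so |1 - w s|
   is at least 1 - r. *)
pose C := normc a * 2 / (1 - r) * I01 (fun s => `|g s|).
apply/cvgrPdist_le => e e0.
have rC : C * r ^+ N.+1 @[N --> \oo] --> 0.
  rewrite -[X in _ --> X](mulr0 C); apply: cvgM; first exact: cvg_cst.
  by rewrite (cvg_shiftS (fun N => r ^+ N)); apply: cvg_expr; rewrite ger0_norm.
move/cvgrPdist_le : rC => /(_ _ e0); apply: filterS => N.
rewrite sub0r normrN => he; apply: le_trans he.
have [p1 p2] := partial_sum N; rewrite -p2 -I01Z// -I01B//; last exact: L1Z.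
rewrite -I01B//; last exact: L1B KL1 (L1Z _ gL1).
apply: (le_trans (@I01_abs _ _ (fun s => normc a * 2 / (1 - r) * r ^+ N.+1 * `|g s|) _ _ _)).
- by apply: L1B => //; apply: L1B => //; exact: L1Z.
- by apply/L1Z/L1_norm.
- move=> s us; rewrite geom.
  have -> : complex.Re (a * (kerP x y s +i* kerQ x y s)) * g s - complex.Re a * g s -
    complex.Re (a * ((kerP x y s +i* kerQ x y s) - 1 - 2 * w s ^+ N.+1 / (1 - w s))) * g s =
    complex.Re (a * (2 * w s ^+ N.+1 / (1 - w s))) * g s.
    case: (2 * w s ^+ N.+1 / (1 - w s)) => p q; case: a => a1 a2 /=; ring.
  rewrite normrM ler_wpM2r// (le_trans (Re_le_normc _))//.
  rewrite !ComplexField.Normc.normcM ComplexField.Normc.normcV normcX normw.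
  have -> : normc 2 = 2.
    rewrite (_ : 2 = 2 +i* 0)/=; last by apply/eqP; rewrite eq_complex/= addr0 !eqxx.
    by rewrite expr0n/= addr0 sqrtr_sqr ger0_norm.
  have lb : 1 - r <= normc (1 - w s).
    have := le_normcD (1 - w s) (w s).
    have -> : (1 - w s : Rcomplex R) + w s = 1 by exact: (@subrK R[i]).
    by rewrite normw lerBlDr /= expr1n expr0n/= addr0 sqrtr1.
  rewrite -!mulrA; apply: ler_wpM2l; first by case: a => a1 a2 /=; exact: sqrtr_ge0.
  apply: ler_wpM2l => //; rewrite mulrC; apply: ler_wpM2r; first exact: exprn_ge0.
  by rewrite lef_pV2// posrE ?subr_gt0//; apply: lt_le_trans lb; rewrite subr_gt0.
- rewrite I01Z; last exact: L1_norm.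
  have -> : normc a * 2 / (1 - r) * r ^+ N.+1 * I01 (fun s => `|g s|) = C * r ^+ N.+1.
    by rewrite /C; ring.
  exact: ler_norm.
Qed.

End integral.

End power_series.

(** * Affine changes of variable *)

Section affine_change_of_variable.
Context {R : realType}.
Local Notation leb := (@lebesgue_measure R).
Variables (a b : R).
Hypothesis a0 : a != 0.

Let h : measurableTypeR R -> measurableTypeR R := fun x => a * x + b.

Let mh : measurable_fun [set: measurableTypeR R] h.
Proof.
apply: (@continuous_measurable_fun R) => x.
by apply: cvgD; [apply: cvgM; [exact: cvg_cst|exact: cvg_id]|exact: cvg_cst].
Qed.

Let k : {nonneg R} := NngNum (normr_ge0 a).

Let push : {measure set (measurableTypeR R) -> \bar R}.
Proof.
refine (pushforward leb h : {measure set (measurableTypeR R) -> \bar R}).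
exact: mh.
Defined.

(** Lebesgue measure is determined by half-open intervals. The sign of [a] decides which end of the
    preimage is closed, hence the two cases. *)
Lemma lebesgue_affine (A : set (measurableTypeR R)) : measurable A ->
  leb A = mscale k push A.
Proof.
apply: (@lebesgue_measure_unique R (mscale k push)).
move=> _ [[p q] _ <-].
change (leb `]p, q]%classic = `|a|%:E * leb (h @^-1` `]p, q]%classic))%E.
have [pq|qp] := ltP p q; last first.
  by rewrite set_itv_ge ?bnd_simp -?leNgt// preimage_set0 !measure0 mule0.
rewrite lebesgue_measure_itv/= lte_fin pq.
have [ap|an|ae] := ltrgtP a 0; last by move: a0; rewrite ae eqxx.
- have -> : h @^-1` `]p, q]%classic = `[(q - b) / a, (p - b) / a[%classic.
    apply/seteqP; split => x /=; rewrite !in_itv/= /h ler_ndivrMr// ltr_ndivlMr//;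
    by rewrite !(mulrC x) => /andP[? ?]; apply/andP; split; lra.
  rewrite lebesgue_measure_itv/= lte_fin ltr_nM2r ?invr_lt0//.
  rewrite ltrD2r pq -EFinD/= -EFinM ltr0_norm//; congr (_%:E).
  by field; rewrite lt_eqF.
- have -> : h @^-1` `]p, q]%classic = `](p - b) / a, (q - b) / a]%classic.
    apply/seteqP; split => x /=; rewrite !in_itv/= /h ler_pdivlMr// ltr_pdivrMr//;
    by rewrite !(mulrC x) => /andP[? ?]; apply/andP; split; lra.
  rewrite lebesgue_measure_itv/= lte_fin ltr_pM2r ?invr_gt0//.
  rewrite ltrD2r pq -EFinD/= -EFinM gtr0_norm//; congr (_%:E).
  by field; rewrite gt_eqF.
Qed.

Lemma integral_affine_ge0 (D : set (measurableTypeR R)) (f : R -> \bar R) :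
  measurable D -> measurable_fun D f -> (forall x, D x -> (0 <= f x)%E) ->
  (\int[leb]_(x in D) f x = `|a|%:E * \int[leb]_(x in h @^-1` D) f (a * x + b)%R)%E.
Proof.
move=> mD mf f0.
rewrite (@eq_measure_integral _ _ _ _ (mscale k push)); last first.
  by move=> A mA _; exact: lebesgue_affine.
rewrite ge0_integral_mscale//= ge0_integral_pushforward//.
by move=> y /set_mem; exact: f0.
Qed.

Lemma integrable_affine (D : set (measurableTypeR R)) (f : R -> R) :
  measurable D -> leb.-integrable D (EFin \o f) ->
  leb.-integrable (h @^-1` D) (EFin \o (fun x => f (a * x + b))).
Proof.
move=> mD /integrableP[mf hf].
have mhD : measurable (h @^-1` D) by rewrite -[h @^-1` _]setTI; exact: mh.
apply/integrableP; split.
  apply: (measurable_comp mD _ mf); last exact: measurable_funS mh.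
  by move=> _ [x /= hx <-].
move: hf; rewrite integral_affine_ge0//; last exact: measurableT_comp.
move=> hf; apply: contraPP hf => /negP; rewrite -leNgt leye_eq => /eqP ->.
by rewrite gt0_muley ?lte_fin ?normr_gt0// ltxx.
Qed.

Lemma Rintegral_affine (D : set (measurableTypeR R)) (f : R -> R) :
  measurable D -> leb.-integrable D (EFin \o f) ->
  \int[leb]_(x in D) f x = `|a| * \int[leb]_(x in h @^-1` D) f (a * x + b).
Proof.
move=> mD hf; have hf' := integrable_affine mD hf.
have mhD : measurable (h @^-1` D) by rewrite -[h @^-1` _]setTI; exact: mh.
rewrite /Rintegral.
have e : (\int[leb]_(x in D) (f x)%:E =
   `|a|%:E * \int[leb]_(x in h @^-1` D) (f (a * x + b)%R)%:E)%E.
  have mf := measurable_int _ hf.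
  have ep := integral_affine_ge0 mD (measurable_funepos mf) (fun x _ => funepos_ge0 _ x).
  have en := integral_affine_ge0 mD (measurable_funeneg mf) (fun x _ => funeneg_ge0 _ x).
  transitivity (\int[leb]_(x in D) ((EFin \o f)^\+ x) - \int[leb]_(x in D) ((EFin \o f)^\- x))%E.
    exact: integralE.
  rewrite ep en -muleBr//; last first.
    apply: fin_num_adde_defl; rewrite fin_numN.
    have := integrable_neg_fin_num mhD hf'.
    rewrite (@eq_integral _ _ _ leb _ (fun x => ((EFin \o f)^\- (a * x + b)%R)%E))//.
    by move=> x _; rewrite !funenegE.
  congr (_ * _)%E; rewrite [RHS]integralE; congr (_ - _)%E; apply: eq_integral => x _.
    by rewrite !funeposE.
  by rewrite !funenegE.
by rewrite e fineM//; exact: integrable_fin_num.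
Qed.

End affine_change_of_variable.

(** * Reflection, strict positivity, and the total masses of the kernels *)

Section unit_interval_more.
Context {R : realType}.
Local Notation leb := (@lebesgue_measure R).
Implicit Types (f g : R -> R) (a b : R).

Lemma onem_unit_itv (s : R) : 0 < s < 1 -> 0 < 1 - s < 1.
Proof. by move=> /andP[? ?]; apply/andP; split; lra. Qed.

Lemma preimage_onem : (fun s : R => -1 * s + 1) @^-1` unit_itv = unit_itv.
Proof.
apply/seteqP; split => s /=; rewrite /unit_itv /= !in_itv/= => /andP[? ?];
by apply/andP; split; lra.
Qed.

Lemma L1_onem f : L1 f -> L1 (fun s => f (1 - s)).
Proof.
move=> hf; have N0 : -1 != 0 :> R by rewrite lt_eqF//; lra.
have := integrable_affine 1 N0 measurable_unit_itv hf.
rewrite [X in _.-integrable X]preimage_onem; apply: L1_eq => s _.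
by rewrite mulN1r addrC.
Qed.

Lemma I01_onem f : L1 f -> I01 (fun s => f (1 - s)) = I01 f.
Proof.
move=> hf; have N0 : -1 != 0 :> R by rewrite lt_eqF//; lra.
rewrite [RHS](Rintegral_affine 1 N0)// [X in \int[_]_(x in X) _]preimage_onem.
by rewrite normrN1 mul1r; apply: I01_eq => s _; rewrite mulN1r addrC.
Qed.

(** A nonnegative integrand with zero integral vanishes almost everywhere, which the interval of
    positive length on which f > 0 forbids. *)
Lemma I01_pos f a b : L1 f -> 0 < a -> a < b -> b < 1 ->
  (forall s, unit_itv s -> 0 <= f s) -> (forall s, a < s < b -> 0 < f s) ->
  0 < I01 f.
Proof.
move=> hf a0 ab b1 f0 fp; rewrite lt_neqAle I01_ge0// andbT.
apply/negP => /eqP e.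
have mf := measurable_int _ hf.
have : (\int[leb]_(s in unit_itv) `|(EFin \o f) s| = 0)%E.
  rewrite -[RHS]/(0%:E) e EFin_I01//; apply: eq_integral => s /set_mem us.
  by rewrite gee0_abs// lee_fin f0.
move/(ae_eq_integral_abs leb measurable_unit_itv mf) => [N [mN N0 sN]].
have : (leb `]a, b[%classic <= leb N)%E.
  apply: le_measure; rewrite ?inE//; apply: subset_trans sN => s /=.
  rewrite in_itv/= => sab; apply/not_implyP; split.
    by case/andP: sab => ? ?; rewrite /unit_itv/= in_itv/=; apply/andP; split; lra.
  by case=> /eqP; rewrite gt_eqF// fp.
rewrite [leb N]N0 lebesgue_measure_itv/= lte_fin ab -EFinD lee_fin leNgt.
by rewrite subr_gt0 ab.
Qed.

Lemma FTC2_itv f (F : R -> R) a b : a < b ->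
  (forall x, a <= x <= b -> is_derive x 1 F (f x)) ->
  (forall x, a <= x <= b -> {for x, continuous f}) ->
  \int[leb]_(x in `[a, b]) f x = F b - F a.
Proof.
move=> ab dF cf; rewrite /Rintegral (@continuous_FTC2 _ f F)//.
- apply: continuous_in_subspaceT => x /set_mem /=; rewrite in_itv/=; exact: cf.
- have cF x : a <= x <= b -> F x @[x --> x] --> F x.
    move=> /dF [d _]; apply: differentiable_continuous; exact/derivable1_diffP.
  split; [|apply: cvg_at_right_filter|apply: cvg_at_left_filter].
  + by move=> x; rewrite in_itv/= => /andP[? ?]; have [] : is_derive x 1 F (f x)
      by apply: dF; rewrite !ltW.
  + by apply: cF; rewrite lexx ltW.
  + by apply: cF; rewrite lexx ltW.
- move=> x; rewrite in_itv/= => /andP[? ?]; rewrite derive1E.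
  by have [_ ->] : is_derive x 1 F (f x) by apply: dF; rewrite !ltW.
Qed.

Lemma I01_itvcc f : L1 f -> I01 f = \int[leb]_(x in `[0, 1]) f x.
Proof.
move=> hf; rewrite /I01 /Rintegral /unit_itv; congr fine.
have mf := measurable_int _ hf.
by rewrite [RHS]integral_itv_bndoo.
Qed.

Lemma four_cos1 n : four_cos (fun=> 1 : R) n.+1 = 0.
Proof.
set m : R := n.+1%:R * 2 * pi.
have m0 : m != 0 by rewrite !mulf_neq0// gt_eqF ?pi_gt0.
have cm : continuous (fun s : R => cos (m * s)).
  move=> s; apply: continuous_comp; last exact: continuous_cos.
  exact: mulrl_continuous.
have e s : cos (n.+1%:R * (2 * (pi * s))) * 1 = cos (m * s) :> R.
  by rewrite mulr1 /m !mulrA.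
rewrite /four_cos (I01_eq (fun s _ => e s)) I01_itvcc; last first.
  apply: (L1_eq (f := fun s => cos (m * s) * 1)); first by move=> s _; rewrite mulr1.
  apply: (@L1M _ _ _ 1); [|by move=> s _; exact: cos_max|exact: L1_cst].
  by apply: measurable_funTS; exact: continuous_measurable_fun.
apply: (etrans (@FTC2_itv _ (fun s => m^-1 * sin (m * s)) 0 1 ltr01 _ _)).
- move=> x _.
  have := @is_deriveZ _ _ _ (fun s => sin (m * s)) m^-1 x 1 (cos (m * x) * m) _.
  have -> : m^-1 *: (cos (m * x) * m) = cos (m * x) by rewrite /GRing.scale/=; field.
  apply.
  apply: (@is_derive1_comp _ sin (fun s => m * s)).
  have := @is_deriveZ _ _ _ (fun s : R => s) m x 1 1 _.
  by rewrite /GRing.scale/= mulr1; apply.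
- by move=> x _; exact: cm.
- have -> : sin (m * 1) = 0.
    have -> : m * 1 = 0 + (pi *+ 2) *+ n.+1 by rewrite add0r mulr1 /m -[RHS]mulr_natl -[pi *+ 2]mulr_natl mulrA.
    by rewrite (periodicn (@sinD2pi R)) sin0.
  by rewrite !mulr0 sin0 mulr0 subrr.
Qed.

(** The substitution of 1 - s for s changes the sign of the integrand, up to n full periods. *)
Lemma four_sin1 n : four_sin (fun=> 1 : R) n = 0.
Proof.
rewrite /four_sin.
set f : R -> R := fun s => _.
have fL1 : L1 f.
  apply: (@L1M _ _ _ 1); [|by move=> s _; exact: sin_max|exact: L1_cst].
  apply: measurable_funTS; apply: continuous_measurable_fun => s.
  apply: continuous_comp; last exact: continuous_sin.
  by do !(apply: cvgM; [exact: cvg_cst|]); exact: cvg_id.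
have : I01 f = - I01 f; last lra.
rewrite -[in LHS](I01_onem fL1) -I01N//; apply: I01_eq => s _.
rewrite /f !mulr1 -sinN -(periodicn (@sinD2pi R) n (- _)); congr sin.
have -> : (pi *+ 2) *+ n = n%:R * (2 * pi) :> R by rewrite -[LHS]mulr_natl -[pi *+ 2]mulr_natl.
by generalize (n%:R : R) (pi : R) => N p; ring.
Qed.

(** This is [powser_cvg] for the constant 1: its Fourier coefficients of positive index vanish, so
    the limit formula itself gives the mass. The factor a = -i gives the mass of [kerQ] in the same
    way. *)
Lemma I01_kerP x y : 0 < y -> I01 (kerP x y : R -> R) = 1.
Proof.
move=> y0; have := @powser_cvg R (fun=> 1) x y 1 (L1_cst 1) y0.
rewrite I01_cst mulr1/= => h.
have h0 : (fun N => complex.Re (1 * (\sum_(1 <= n < N) (2 * four_cos (fun=> 1) n -i* (2 * four_sin (fun=> 1) n)) * disc_pt x y ^+ n)))%C = cst 0 :> (nat -> R).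
  apply/funext => N; rewrite big_nat_cond big1 ?mulr0// => -[//|i] _.
  by rewrite four_cos1 four_sin1 !mulr0 oppr0 mul0r.
move: h; rewrite h0 => /(cvg_lim (@Rhausdorff R)); rewrite lim_cst// => /esym/eqP.
rewrite subr_eq0 => /eqP <-; apply: I01_eq => s _.
by rewrite mul1r mul0r subr0 mulr1.
Qed.

Lemma I01_kerQ x y : 0 < y -> I01 (kerQ x y : R -> R) = 0.
Proof.
move=> y0; have := @powser_cvg R (fun=> 1) x y (0 -i* 1)%C (L1_cst 1) y0.
rewrite I01_cst mulr1/= => h.
have h0 : (fun N => complex.Re ((0 -i* 1) * (\sum_(1 <= n < N) (2 * four_cos (fun=> 1) n -i* (2 * four_sin (fun=> 1) n)) * disc_pt x y ^+ n)))%C = cst 0 :> (nat -> R).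
  apply/funext => N; rewrite big_nat_cond big1 ?mulr0// => -[//|i] _.
  by rewrite four_cos1 four_sin1 !mulr0 oppr0 mul0r.
move: h; rewrite h0 => /(cvg_lim (@Rhausdorff R)); rewrite lim_cst// subr0 => e; rewrite [RHS]e.
by apply: I01_eq => s _; rewrite mul0r sub0r mulN1r opprK mulr1.
Qed.

End unit_interval_more.

(** * Monotonicity of the real and imaginary parts *)

Section profile.
Context {R : realType}.
Implicit Types (G : R -> R) (x y s u c : R).

(* For G the quantile function of mu, which has mean zero, hu + i hv is phi_tilde mu
   read in the half-plane. *)
Definition hu G x y : R := I01 (fun s => kerP x y s * G s).

Definition hv G x y : R := I01 (fun s => kerQ x y s * G s).

(** For increasing G: c lies between the one-sided limits of G at u. Both [G u] and every x with
    [dist_fun mu x = u] are such levels, and they differ when x falls inside a jump of G. *)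
Definition cut G u c := forall s, 0 < s < 1 ->
  (s < u -> G s <= c) /\ (u < s -> c <= G s).

Definition increasing01 G := forall s s', 0 < s -> s < s' -> s' < 1 -> G s < G s'.

Section kernel_integrals.
Variables (G : R -> R) (x y : R).
Hypotheses (GL1 : L1 G) (y0 : 0 < y).

Lemma L1_kerP : L1 (fun s => kerP x y s * G s).
Proof.
apply: L1M GL1 => [|s _]; last exact: kerP_bound.
by apply: measurable_funTS; exact: mfun_kerP.
Qed.

Lemma L1_kerQ : L1 (fun s => kerQ x y s * G s).
Proof.
apply: L1M GL1 => [|s _]; last exact: kerQ_bound.
by apply: measurable_funTS; exact: mfun_kerQ.
Qed.

End kernel_integrals.

Lemma L1_subc G c : L1 G -> L1 (fun s => G s - c).
Proof. by move=> h; apply: L1B => //; exact: L1_cst. Qed.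

(** The mass 1 of [kerP] and the mass 0 of [kerQ] allow recentring G at an arbitrary level, which is
    what makes the integrands below have a sign. *)
Lemma hu_subc G c x y : L1 G -> 0 < y -> hu G x y - c = I01 (fun s => kerP x y s * (G s - c)).
Proof.
move=> GL1 y0.
rewrite (@I01_eq _ _ (fun s => kerP x y s * G s - c * (kerP x y s * 1))); last by move=> s _; ring.
have l1 := L1_kerP x (L1_cst (1:R)) y0.
rewrite I01B ?I01Z//; [|exact: L1_kerP|exact: L1Z].
rewrite (@I01_eq _ (fun s => _ * 1) (kerP x y)) ?I01_kerP ?mulr1// => s _.
by rewrite mulr1.
Qed.

Lemma hv_subc G c x y : L1 G -> 0 < y -> hv G x y = I01 (fun s => kerQ x y s * (G s - c)).
Proof.
move=> GL1 y0.
rewrite (@I01_eq _ (fun s => kerQ x y s * (_ - c)) (fun s => kerQ x y s * G s - c * (kerQ x y s * 1))); last by move=> s _; ring.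
have l1 := L1_kerQ x (L1_cst (1:R)) y0.
rewrite I01B ?I01Z//; [|exact: L1_kerQ|exact: L1Z].
rewrite (@I01_eq _ (fun s => _ * 1) (kerQ x y)) ?I01_kerQ ?mulr0 ?subr0// => s _.
by rewrite mulr1.
Qed.

(** For x1 < x2 the second factor is positive, so the difference changes sign exactly at the
    parameter of the midpoint. Likewise [kerQ_diff] isolates a sign change at the parameter of x. *)
Lemma kerP_diff x1 x2 y s : 0 < y -> 0 < s < 1 ->
  kerP x2 y s - kerP x1 y s = (tpar s - (x1 + x2) / 2) *
   ((1 + tpar s ^+ 2) * y * 2 * (x2 - x1) /
     (((x1 - tpar s) ^+ 2 + y ^+ 2) * ((x2 - tpar s) ^+ 2 + y ^+ 2))).
Proof.
move=> y0 s01; have d1 := dist_gt0 x1 s y0; have d2 := dist_gt0 x2 s y0.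
by rewrite !kerPE//; field; rewrite !gt_eqF.
Qed.

Lemma kerQ_diff x y1 y2 s : 0 < y1 -> 0 < y2 -> 0 < s < 1 ->
  kerQ x y2 s - kerQ x y1 s = (tpar s - x) *
   ((1 + tpar s ^+ 2) * (y2 ^+ 2 - y1 ^+ 2) /
     (((x - tpar s) ^+ 2 + y1 ^+ 2) * ((x - tpar s) ^+ 2 + y2 ^+ 2))).
Proof.
move=> y10 y20 s01; have d1 := dist_gt0 x s y10; have d2 := dist_gt0 x s y20.
by rewrite !kerQE//; field; rewrite !gt_eqF.
Qed.

Lemma onesqr_gt0 (t : R) : 0 < 1 + t ^+ 2.
Proof. by rewrite ltr_pwDl// sqr_ge0. Qed.

Lemma cut_sign G u c s : 0 < u < 1 -> 0 < s < 1 -> cut G u c ->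
  0 <= (tpar s - tpar u) * (G s - c).
Proof.
move=> /andP[u0 u1] s01 /(_ s s01) [h1 h2]; have /andP[s0 s1] := s01.
have [su|us|->] := ltgtP s u; last by rewrite subrr mul0r.
  by rewrite mulr_le0// subr_le0 ?h1// ltW// tpar_lt.
by rewrite mulr_ge0// subr_ge0 ?h2// ltW// tpar_lt.
Qed.

Lemma cut_lt G u c s : increasing01 G -> 0 < u < 1 -> 0 < s -> s < u -> cut G u c -> G s < c.
Proof.
move=> Gi /andP[u0 u1] s0 su h.
have m01 : 0 < (s + u) / 2 < 1 by apply/andP; split; lra.
have [h1 _] := h _ m01.
by apply: lt_le_trans (h1 _); [apply: Gi; lra|lra].
Qed.

Lemma cut_gt G u c s : increasing01 G -> 0 < u < 1 -> u < s -> s < 1 -> cut G u c -> c < G s.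
Proof.
move=> Gi /andP[u0 u1] us s1 h.
have m01 : 0 < (s + u) / 2 < 1 by apply/andP; split; lra.
have [_ h1] := h _ m01.
by apply: le_lt_trans (h1 _) _; [lra|apply: Gi; lra].
Qed.

Lemma cut_sign_gt0 G u c s : increasing01 G -> 0 < u < 1 -> 0 < s < 1 -> cut G u c ->
  s != u -> 0 < (tpar s - tpar u) * (G s - c).
Proof.
move=> Gi u01 s01 h; have /andP[u0 u1] := u01; have /andP[s0 s1] := s01.
have [su _|us _|//] := ltgtP s u.
  by rewrite nmulr_rgt0 ?subr_lt0 ?(cut_lt Gi u01)// tpar_lt.
by rewrite mulr_gt0 ?subr_gt0 ?(cut_gt Gi u01)// tpar_lt.
Qed.

Lemma cut_self G u : increasing01 G -> 0 < u < 1 -> cut G u (G u).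
Proof.
move=> Gi /andP[u0 u1] s /andP[s0 s1]; split => h; apply/ltW; exact: Gi.
Qed.

(* G - c changes sign at u exactly as tpar - tpar u does. *)
Lemma I01_cut_gt0 G u c (K k : R -> R) : increasing01 G -> 0 < u < 1 -> cut G u c ->
  L1 (fun s => K s * (G s - c)) ->
  (forall s, 0 < s < 1 -> s != u -> K s = (tpar s - tpar u) * k s) ->
  (forall s, 0 < s < 1 -> s = u -> 0 <= K s * (G s - c)) ->
  (forall s, 0 < s < 1 -> 0 < k s) ->
  0 < I01 (fun s => K s * (G s - c)).
Proof.
move=> Gi u01 h l Ke Ku k0; have /andP[u0 u1] := u01.
apply: (@I01_pos _ _ (u / 2) u) => //; [lra|lra| |].
  move=> s /unit_itvP s01; have [su|su] := eqVneq s u; first exact: Ku.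
  rewrite Ke// mulrAC mulr_ge0 ?(cut_sign u01)//; exact/ltW/k0.
move=> s /andP[su1 su2]; have s01 : 0 < s < 1 by apply/andP; split; lra.
have su : s != u by rewrite lt_eqF.
by rewrite Ke// mulrAC mulr_gt0 ?(cut_sign_gt0 Gi u01)// k0.
Qed.

Section increasing_profile.
Variable G : R -> R.
Hypotheses (Gi : increasing01 G) (GL1 : L1 G).
Let Gc c : L1 (fun s => G s - c) := L1_subc c GL1.

(** G is recentred at its value at the parameter u of the midpoint, so that the kernel difference
    and [G - G u] change sign together. [hv_incr] uses the parameter of x instead. *)
Lemma hu_incr y x1 x2 : 0 < y -> x1 < x2 -> hu G x1 y < hu G x2 y.
Proof.
move=> y0 x12; set u := tinv ((x1 + x2) / 2).
have u01 : 0 < u < 1 by exact: tinv_itv.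
rewrite -subr_gt0 (_ : _ - _ = (hu G x2 y - G u) - (hu G x1 y - G u)); last by ring.
rewrite (hu_subc (G u) x1 GL1 y0) (hu_subc (G u) x2 GL1 y0) -I01B; try exact: L1_kerP.
rewrite (@I01_eq _ _ (fun s => (kerP x2 y s - kerP x1 y s) * (G s - G u))); last first.
  by move=> s _; rewrite mulrBl.
apply: (I01_cut_gt0 (u := u) (k := fun s => (1 + tpar s ^+ 2) * y * 2 * (x2 - x1) /
     (((x1 - tpar s) ^+ 2 + y ^+ 2) * ((x2 - tpar s) ^+ 2 + y ^+ 2)))) => //.
- exact: cut_self.
- apply: (@L1_eq _ (fun s => kerP x2 y s * (G s - G u) - kerP x1 y s * (G s - G u))).
    by move=> s _; rewrite mulrBl.
  by apply: L1B; exact: L1_kerP.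
- by move=> s s01 _; rewrite kerP_diff// tinvK.
- by move=> s _ ->; rewrite subrr mulr0.
- move=> s s01; rewrite divr_gt0 ?mulr_gt0 ?onesqr_gt0 ?subr_gt0//; exact: dist_gt0.
Qed.

Lemma hu_mono y x1 x2 : 0 < y -> x1 <= x2 -> hu G x1 y <= hu G x2 y.
Proof. by move=> y0; rewrite le_eqVlt => /predU1P[->//|h]; exact/ltW/hu_incr. Qed.

Lemma hv_incr x y1 y2 : 0 < y1 -> y1 < y2 -> hv G x y1 < hv G x y2.
Proof.
move=> y10 y12; have y20 := lt_trans y10 y12; set u := tinv x.
have u01 : 0 < u < 1 by exact: tinv_itv.
rewrite -subr_gt0 (hv_subc (G u) x GL1 y10) (hv_subc (G u) x GL1 y20) -I01B; try exact: L1_kerQ.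
rewrite (@I01_eq _ _ (fun s => (kerQ x y2 s - kerQ x y1 s) * (G s - G u))); last first.
  by move=> s _; rewrite mulrBl.
apply: (I01_cut_gt0 (u := u) (k := fun s => (1 + tpar s ^+ 2) * (y2 ^+ 2 - y1 ^+ 2) /
     (((x - tpar s) ^+ 2 + y1 ^+ 2) * ((x - tpar s) ^+ 2 + y2 ^+ 2)))) => //.
- exact: cut_self.
- apply: (@L1_eq _ (fun s => kerQ x y2 s * (G s - G u) - kerQ x y1 s * (G s - G u))).
    by move=> s _; rewrite mulrBl.
  by apply: L1B; exact: L1_kerQ.
- by move=> s s01 _; rewrite kerQ_diff// tinvK.
- by move=> s _ ->; rewrite subrr mulr0.
- move=> s s01; rewrite divr_gt0 ?mulr_gt0 ?onesqr_gt0 ?subr_gt0//; try exact: dist_gt0.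
  by rewrite ltrXn2r// ltW.
Qed.

Lemma hv_mono x y1 y2 : 0 < y1 -> y1 <= y2 -> hv G x y1 <= hv G x y2.
Proof. by move=> y0; rewrite le_eqVlt => /predU1P[->//|h]; exact/ltW/hv_incr. Qed.

(** [hu] is a mean of G for the positive density [kerP]; were it at most G everywhere, strict
    monotonicity would make the integral of [kerP] times G minus that mean positive, while it is
    0. *)
Lemma hu_gt_some x y : 0 < y -> exists2 s, 0 < s < 1 & G s < hu G x y.
Proof.
move=> y0; apply: contrapT => h.
have hle s : 0 < s < 1 -> hu G x y <= G s.
  by move=> s01; rewrite leNgt; apply/negP => hs; apply: h; exists s.
have : 0 < I01 (fun s => kerP x y s * (G s - hu G x y)).
  apply: (@I01_pos _ _ 3^-1 2^-1); [exact: L1_kerP|lra|lra|lra| |].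
    move=> s /unit_itvP s01; rewrite mulr_ge0 ?subr_ge0 ?hle//; exact/ltW/kerP_gt0.
  move=> s /andP[s1 s2]; have s01 : 0 < s < 1 by apply/andP; split; lra.
  rewrite mulr_gt0 ?kerP_gt0// subr_gt0.
  have m01 : 0 < s / 2 < 1 by apply/andP; split; lra.
  by apply: le_lt_trans (hle _ m01) _; apply: Gi; lra.
by rewrite -hu_subc// subrr ltxx.
Qed.

(** Only parameters with [G s < G s1] can pull the mean below [G s1]. Their boundary points are at
    distance at least d from x, where [kerP] is at most C y, uniformly for |x| <= X. *)
Lemma hu_ge s1 d X : 0 < s1 < 1 -> 0 < d -> exists C, forall x y,
  tpar s1 + d <= x -> `|x| <= X -> 0 < y -> G s1 - C * y <= hu G x y.
Proof.
move=> s101 d0; have /andP[s10 s11] := s101.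
pose h s := Num.min (G s - G s1) 0.
have hL1 : L1 h.
  apply: (@L1_le _ _ (fun s => `|G s - G s1|)).
  - by apply: measurable_minr; [exact: (L1_mfun (Gc _))|exact: measurable_cst].
  - by move=> s _; rewrite /h; case: (leP (G s - G s1) 0) => _; rewrite ?normr0 ?normr_ge0.
  - exact: L1_norm.
(* From 1 + t^2 <= 1 + 2 x^2 + 2 (x - t)^2, with |x| <= X and (x - t)^2 >= d^2. *)
pose C := (1 + 2 * X ^+ 2) / d ^+ 2 + 2.
exists (C * I01 (fun s => `|h s|)) => x y tx xX y0.
have C0 : 0 <= C.
  by rewrite addr_ge0// divr_ge0 ?sqr_ge0// addr_ge0// mulr_ge0// sqr_ge0.
have hl : L1 (fun s => (C * y) * `|h s|) by exact: L1Z (L1_norm hL1).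
suff : I01 (fun s => - ((C * y) * `|h s|)) <= hu G x y - G s1.
  by rewrite (I01N hl) (I01Z _ (L1_norm hL1)); lra.
rewrite (hu_subc (G s1) x GL1 y0).
apply: I01_le; [exact: L1N|exact: L1_kerP|].
move=> s /unit_itvP s01; have /andP[s0 s1'] := s01; rewrite /h.
case: (leP (G s - G s1) 0) => g0; last first.
  by rewrite normr0 mulr0 oppr0 mulr_ge0 ?ltW// kerP_gt0.
rewrite ler0_norm// mulrN opprK ler_wnM2r//.
have ss1 : s <= s1.
  by rewrite leNgt; apply/negP => ss1; have := Gi s10 ss1 s1'; lra.
have tt := tpar_le s0 ss1 s11.
set t := tpar s in tt *; have dt : d <= x - t by lra.
have dt2 : d ^+ 2 <= (x - t) ^+ 2 by rewrite lerXn2r// nnegrE; lra.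
have d2 : 0 < d ^+ 2 by rewrite exprn_gt0.
have xt0 : 0 < (x - t) ^+ 2 by exact: lt_le_trans dt2.
have X2 : x ^+ 2 <= X ^+ 2.
  by rewrite -real_normK ?num_real// lerXn2r// nnegrE// (le_trans (normr_ge0 x)).
rewrite kerPE// -/t mulrA ler_pdivrMr; last exact: dist_gt0.
have -> : C * y * ((x - t) ^+ 2 + y ^+ 2) = y * (C * ((x - t) ^+ 2 + y ^+ 2)) by ring.
rewrite [leLHS]mulrC; apply: ler_wpM2l; first exact: ltW.
apply: (@le_trans _ _ (C * (x - t) ^+ 2)); last first.
  by apply: ler_wpM2l => //; rewrite lerDl sqr_ge0.
rewrite /C mulrDl.
have a1 : 1 + 2 * X ^+ 2 <= (1 + 2 * X ^+ 2) / d ^+ 2 * (x - t) ^+ 2.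
  rewrite mulrAC ler_pdivlMr// ler_wpM2l//.
  by rewrite addr_ge0// mulr_ge0// sqr_ge0.
have : t ^+ 2 <= 2 * x ^+ 2 + 2 * (x - t) ^+ 2.
  rewrite -subr_ge0 (_ : _ - _ = (2 * x - t) ^+ 2); last by ring.
  exact: sqr_ge0.
lra.
Qed.

(** As x grows, the kernel on the parameters up to s2 tends to 0 boundedly, so by dominated
    convergence the part of G below [G s2] stops contributing. *)
Lemma hu_large s2 x0 y : 0 < s2 < 1 -> x0 < G s2 -> 0 < y -> exists x, x0 < hu G x y.
Proof.
move=> s201 xG y0; have /andP[s20 s21] := s201; set t2 := tpar s2.
pose h s := Num.min (G s - G s2) 0.
have hL1 : L1 h.
  apply: (@L1_le _ _ (fun s => `|G s - G s2|)).
  - by apply: measurable_minr; [exact: (L1_mfun (Gc _))|exact: measurable_cst].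
  - by move=> s _; rewrite /h; case: (leP (G s - G s2) 0) => _; rewrite ?normr0 ?normr_ge0.
  - exact: L1_norm.
(* The offset 2 |t2| gives |tpar s| <= |xn n - tpar s| for s <= s2, hence a bound y + 1 / y on the
   kernel that depends neither on n nor on s. *)
pose xn n : R := 2 * `|t2| + n.+1%:R.
pose K n s := kerP (xn n) y s * (\1_(`]-oo, s2]) s : R).
have K0 s : unit_itv s -> K n s @[n --> \oo] --> 0.
  move=> /unit_itvP s01; rewrite /K indicE.
  have [/set_mem/=|_] := boolP (s \in _); last first.
    by under eq_fun do rewrite mulr0; exact: cvg_cst.
  rewrite in_itv/= => ss2; have /andP[s0 s1] := s01.
  have tt := tpar_le s0 ss2 s21.
  under eq_fun do rewrite mulr1.
  apply: (@squeeze_cvgr _ _ _ _ (fun=> 0) (fun n => (1 + tpar s ^+ 2) * y * n.+1%:R^-1)).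
  - apply: nearW => n; rewrite ltW ?kerP_gt0//= kerPE// -mulrA.
    apply: ler_wpM2l; first by rewrite ltW// onesqr_gt0.
    apply: ler_wpM2l; first exact: ltW.
    rewrite lef_pV2 ?posrE ?dist_gt0//.
    have n1 : 1 <= n.+1%:R :> R by rewrite ler1n.
    have : n.+1%:R <= xn n - tpar s.
      by rewrite /xn; have := ler_norm t2; have := normr_ge0 t2; rewrite -/t2 in tt *; lra.
    move: n1 (sqr_ge0 y); set N := n.+1%:R; set D := _ - _ => N1 y2 ND.
    by apply: (@le_trans _ _ (D ^+ 2)); [nra|lra].
  - exact: cvg_cst.
  - rewrite -[X in _ --> X](mulr0 ((1 + tpar s ^+ 2) * y)); apply: cvgM; first exact: cvg_cst.
    exact: cvg_harmonic.
have KC n s : unit_itv s -> `|K n s| <= y + y^-1.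
  have yy : 0 <= y + y^-1 by rewrite addr_ge0 ?invr_ge0 ?ltW.
  move=> /unit_itvP s01; rewrite /K indicE.
  have [/set_mem/=|_] := boolP (s \in _); last by rewrite mulr0 normr0.
  rewrite in_itv/= => ss2; have /andP[s0 s1] := s01.
  have tt := tpar_le s0 ss2 s21.
  rewrite mulr1 gtr0_norm ?kerP_gt0// kerPE//.
  have : `|tpar s| <= `|xn n - tpar s|.
    have n1 : 1 <= n.+1%:R :> R by rewrite ler1n.
    rewrite /xn; have := ler_norm t2; have := normr_ge0 t2; rewrite -/t2 in tt * => a1 a2.
    rewrite [leRHS]ger0_norm; last lra.
    by rewrite ler_norml; apply/andP; split; lra.
  move=> h1; have h2 : tpar s ^+ 2 <= (xn n - tpar s) ^+ 2.
    by rewrite -[leLHS]real_normK ?num_real// -[leRHS]real_normK ?num_real// lerXn2r ?nnegrE.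
  rewrite mulrA ler_pdivrMr ?dist_gt0//.
  have -> : y + y^-1 = (1 + tpar s ^+ 2) * y / (tpar s ^+ 2 + y ^+ 2) +
      (y + y^-1 - (1 + tpar s ^+ 2) * y / (tpar s ^+ 2 + y ^+ 2)) by ring.
  have Y2 : 0 < y ^+ 2 by rewrite exprn_gt0.
  have D0 : 0 < tpar s ^+ 2 + y ^+ 2 by have := sqr_ge0 (tpar s); lra.
  apply: (@le_trans _ _ ((y + y^-1) * (tpar s ^+ 2 + y ^+ 2))).
    rewrite -subr_ge0 (_ : _ - _ = y ^+ 3 + tpar s ^+ 2 / y); last by field; rewrite gt_eqF.
    by rewrite addr_ge0 ?exprn_ge0 ?divr_ge0 ?sqr_ge0 ?ltW.
  rewrite (_ : (1 + tpar s ^+ 2) * y / (tpar s ^+ 2 + y ^+ 2) +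
      (y + y^-1 - (1 + tpar s ^+ 2) * y / (tpar s ^+ 2 + y ^+ 2)) = y + y^-1); last by ring.
  by rewrite ler_wpM2l// lerD2r.
have mK n : mfun (K n).
  apply: measurable_funTS; apply: measurable_funM; first exact: mfun_kerP.
  exact: measurable_indic.
have /cvgrPdist_lt/(_ (G s2 - x0)) := I01_cvg0 mK KC K0 hL1.
rewrite subr_gt0 => /(_ xG) [n _ /(_ n (leqnn n))] /=.
rewrite sub0r normrN => hn; exists (xn n).
have : I01 (fun s => K n s * h s) <= hu G (xn n) y - G s2.
  rewrite hu_subc//; apply: I01_le; [exact: (L1M (mK n) (KC n) hL1)|exact: L1_kerP|].
  move=> s /unit_itvP s01; rewrite /K /h indicE.
  have kp := kerP_gt0 (xn n) s y0; have /andP[s0 s1] := s01.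
  have [/set_mem/=|] := boolP (s \in _); rewrite ?in_itv/=.
    by move=> _; rewrite mulr1; apply: ler_wpM2l; [exact: ltW|rewrite ge_min lexx].
  move=> /negP hs; rewrite mulr0 mul0r; apply: mulr_ge0; first exact: ltW.
  rewrite subr_ge0; apply/ltW/Gi => //.
  by rewrite ltNge; apply/negP => ss; apply: hs; rewrite inE/= in_itv/=.
by move: hn; rewrite ltr_norml => /andP[+ _]; lra.
Qed.

End increasing_profile.

(** Reflection of the half-plane in the imaginary axis combined with a change of sign of G, which
    keeps G increasing. It turns each right-sided statement into its left-sided twin. *)
Definition mirror G : R -> R := fun s => - G (1 - s).

Lemma mirror_incr G : increasing01 G -> increasing01 (mirror G).
Proof. by move=> Gi s s' s0 ss s1; rewrite /mirror ltrN2 Gi//; lra. Qed.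

Lemma mirror_L1 G : L1 G -> L1 (mirror G).
Proof. by move=> h; apply: L1N; exact: L1_onem. Qed.

Lemma cspi_onem s : cspi (1 - s) = - cspi s.
Proof. by rewrite /cspi mulrBr mulr1 cosB cospi sinpi mul0r addr0 mulN1r. Qed.

Lemma snpi_onem s : snpi (1 - s) = snpi s.
Proof. by rewrite /snpi mulrBr mulr1 sinB cospi sinpi mul0r mulN1r sub0r opprK. Qed.

Lemma kden_mirror x y s : kden x y (1 - s) = kden (- x) y s.
Proof. by rewrite /kden cspi_onem snpi_onem; ring. Qed.

Lemma kerP_mirror x y s : kerP x y (1 - s) = kerP (- x) y s.
Proof. by rewrite /kerP kden_mirror. Qed.

Lemma kerQ_mirror x y s : kerQ x y (1 - s) = - kerQ (- x) y s.
Proof. by rewrite /kerQ kden_mirror cspi_onem snpi_onem; move: (_^-1) => k; ring. Qed.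

Lemma tpar_mirror s : tpar (1 - s) = - tpar s.
Proof. by rewrite /tpar cspi_onem snpi_onem mulNr. Qed.

Lemma hu_mirror G x y : L1 G -> 0 < y -> hu (mirror G) x y = - hu G (- x) y.
Proof.
move=> GL1 y0; rewrite /hu -I01N; last exact: L1_kerP.
rewrite -[RHS]I01_onem; last exact/L1N/L1_kerP.
by apply: I01_eq => s _; rewrite kerP_mirror opprK mulrN.
Qed.

Lemma hv_mirror G x y : L1 G -> 0 < y -> hv (mirror G) x y = hv G (- x) y.
Proof.
move=> GL1 y0; rewrite /hv -[RHS]I01_onem; last exact: L1_kerQ.
by apply: I01_eq => s _; rewrite kerQ_mirror opprK mulrN mulNr.
Qed.

Section increasing_profile_mirrored.
Variable G : R -> R.
Hypotheses (Gi : increasing01 G) (GL1 : L1 G).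
Let Gmi := mirror_incr Gi.
Let GmL1 := mirror_L1 GL1.

Lemma hu_lt_some x y : 0 < y -> exists2 s, 0 < s < 1 & hu G x y < G s.
Proof.
move=> y0; have [s s01] := hu_gt_some Gmi GmL1 (- x) y0.
rewrite hu_mirror// opprK /mirror ltrN2 => h; exists (1 - s) => //.
exact: onem_unit_itv.
Qed.

Lemma hu_le s1 d X : 0 < s1 < 1 -> 0 < d -> exists C, forall x y,
  x <= tpar s1 - d -> `|x| <= X -> 0 < y -> hu G x y <= G s1 + C * y.
Proof.
move=> s101 d0; have [C hC] := hu_ge Gmi GmL1 X (onem_unit_itv s101) d0.
exists C => x y xt xX y0; have := hC (- x) y; rewrite tpar_mirror normrN hu_mirror// (opprK x).
rewrite {1}/mirror (_ : 1 - (1 - s1) = s1); last by ring.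
have tx : - tpar s1 + d <= - x by lra.
by move=> /(_ tx xX y0); lra.
Qed.

Lemma hu_small s2 x0 y : 0 < s2 < 1 -> G s2 < x0 -> 0 < y -> exists x, hu G x y < x0.
Proof.
move=> s201 Gx y0.
have [|x hx] := @hu_large _ Gmi GmL1 (1 - s2) (- x0) y (onem_unit_itv s201) _ y0.
  by rewrite /mirror (_ : 1 - (1 - s2) = s2); [rewrite ltrN2|ring].
by exists (- x); move: hx; rewrite hu_mirror// ltrN2.
Qed.

End increasing_profile_mirrored.

End profile.

(** * The boundary envelope of the imaginary part *)

Section lower_envelope.
Context {R : realType}.
Local Notation leb := (@lebesgue_measure R).
Implicit Types (G : R -> R) (x y s u c : R).

(** The kernel identities break down at the single parameter s = u, where an inverse takes its
    default value. *)
Lemma I01_eq1 (f g : R -> R) u : 0 < u < 1 -> L1 f ->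
  (forall s, 0 < s < 1 -> s != u -> f s = g s) -> L1 g /\ I01 g = I01 f.
Proof.
move=> /andP[u0 u1] fL fg.
have e s : unit_itv s -> f s + (g u - f u) * \1_`[u, u] s = g s.
  move=> /unit_itvP s01; rewrite indicE.
  have [->|su] := eqVneq s u; first by rewrite mem_set/= ?in_itv/= ?lexx//; ring.
  rewrite memNset ?mulr0 ?addr0 ?fg//= in_itv/= => /andP[h1 h2].
  by move: su; rewrite eq_le h1 h2.
have l := L1D fL (L1Z (g u - f u) (L1_indic u u)).
split; first exact: (L1_eq e).
rewrite -(I01_eq e) I01D//; last exact: (L1Z _ (L1_indic _ _)).
by rewrite (I01Z _ (L1_indic _ _)) I01_indic// subrr mulr0 addr0.
Qed.

(** By [kernel_dist] both differences are at most |zeta - zeta'| divided by the square root of a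
    product of two [kden], and each inverse of [kden] is at most M on the strip. Uniformity in s
    lets the bound be integrated against G. *)
Lemma kernel_lip X Y y0 : 0 < y0 -> exists2 M, 0 <= M & forall x x' y y' s,
  `|x| <= X -> `|x'| <= X -> y0 <= y <= Y -> y0 <= y' <= Y ->
  `|kerP x y s - kerP x' y' s| <= M * (`|x - x'| + `|y - y'|) /\
  `|kerQ x y s - kerQ x' y' s| <= M * (`|x - x'| + `|y - y'|).
Proof.
move=> y00; exists ((1 + X ^+ 2 + Y ^+ 2) / y0 ^+ 2).
  by rewrite divr_ge0 ?sqr_ge0// ltW// one_sqr_gt0.
set M := _ / _; move=> x x' y y' s xX xX' /andP[yl yu] /andP[yl' yu'].
have y1 : 0 < y by exact: lt_le_trans yl.
have y1' : 0 < y' by exact: lt_le_trans yl'.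
have bnd a b : `|a| <= X -> y0 <= b -> b <= Y -> (kden a b s)^-1 <= M.
  move=> aX bl bu; have b0 : 0 < b by exact: lt_le_trans bl.
  apply: (le_trans (kden_inv_le a s b0)).
  have a2 : a ^+ 2 <= X ^+ 2.
    by rewrite -real_normK ?num_real// lerXn2r// nnegrE (le_trans (normr_ge0 a)).
  have b2 : b ^+ 2 <= Y ^+ 2 by rewrite lerXn2r// nnegrE; lra.
  have b3 : y0 ^+ 2 <= b ^+ 2 by rewrite lerXn2r// nnegrE; lra.
  apply: ler_pM.
  - by rewrite ltW// one_sqr_gt0.
  - by rewrite invr_ge0 sqr_ge0.
  - lra.
  - by rewrite lef_pV2// posrE exprn_gt0.
have k := kernel_dist x x' s y1 y1'.
set D := `|x - x'| + `|y - y'|.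
have D0 : 0 <= D by rewrite addr_ge0.
have M0 : 0 <= M by rewrite divr_ge0 ?sqr_ge0// ltW// one_sqr_gt0.
have kk : ((x - x') ^+ 2 + (y - y') ^+ 2) / (kden x y s * kden x' y' s) <= (M * D) ^+ 2.
  rewrite exprMn mulrC; apply: ler_pM.
  - by rewrite invr_ge0 mulr_ge0// ltW// kden_gt0.
  - by rewrite addr_ge0 ?sqr_ge0.
  - have i0 a b : 0 < b -> 0 <= (kden a b s)^-1 by move=> b0; rewrite invr_ge0 ltW// kden_gt0.
    by rewrite invfM expr2; apply: ler_pM; [exact: i0|exact: i0|exact: bnd|exact: bnd].
  - rewrite -[(x - x') ^+ 2]real_normK ?num_real// -[(y - y') ^+ 2]real_normK ?num_real//.
    rewrite /D; have := normr_ge0 (x - x'); have := normr_ge0 (y - y').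
    by move: `|x - x'| `|y - y'| => p q p0 q0; nra.
have sq (a : R) : a ^+ 2 <= (M * D) ^+ 2 -> `|a| <= M * D.
  by rewrite -[a ^+ 2]real_normK ?num_real// ler_pXn2r// nnegrE// mulr_ge0.
by split; apply: sq; apply: le_trans kk; rewrite -k ?lerDl ?lerDr ?sqr_ge0.
Qed.

Lemma huv_cont G x y e : L1 G -> 0 < y -> 0 < e -> exists2 d, 0 < d &
  forall x' y', `|x - x'| < d -> `|y - y'| < d -> 0 < y' ->
  `|hu G x y - hu G x' y'| < e /\ `|hv G x y - hv G x' y'| < e.
Proof.
move=> GL y0 e0; have y2 : 0 < y / 2 by rewrite divr_gt0.
have [M M0 hM] := kernel_lip (`|x| + 1) (y + 1) y2.
set A := I01 (fun s => `|G s|).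
have A0 : 0 <= A by apply: I01_ge0.
(* The bound y / 2 keeps y' away from the boundary; as D < 2 d, the last term makes M D A smaller
   than e, the 1 guarding against a zero divisor. *)
pose d := Num.min (Num.min 1 (y / 2)) (e / (2 * M * A + 1)).
have q0 : 0 < 2 * M * A + 1 by rewrite ltr_wpDl// !mulr_ge0.
exists d; first by rewrite !lt_min ltr01 y2 divr_gt0.
move=> x' y'; rewrite !lt_min => /andP[/andP[xx1 _] xx2] /andP[/andP[yy1 yy2] yy3] y'0.
have b1 : `|x'| <= `|x| + 1.
  by have := ler_normB x (x - x'); rewrite opprB addrC subrK; lra.
have b2 : y / 2 <= y' <= y + 1.
  by move: yy1 yy2; rewrite !ltr_norml => /andP[? ?] /andP[? ?]; apply/andP; split; lra.
have bx : `|x| <= `|x| + 1 by lra.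
have by_ : y / 2 <= y <= y + 1 by apply/andP; split; lra.
set D := `|x - x'| + `|y - y'|.
have main (K K' : R -> R) : L1 (fun s => K s * G s) -> L1 (fun s => K' s * G s) ->
    (forall s, `|K s - K' s| <= M * D) ->
    `|I01 (fun s => K s * G s) - I01 (fun s => K' s * G s)| < e.
  move=> l l' hK; rewrite -I01B//.
  apply: (@le_lt_trans _ _ (M * D * A)).
    rewrite /A -I01Z; last exact: L1_norm.
    apply: I01_abs; [exact: L1B|exact: (L1Z _ (L1_norm GL))|].
    by move=> s _; rewrite -mulrBl normrM ler_wpM2r.
  have DD : D < 2 * (e / (2 * M * A + 1)) by rewrite /D; lra.
  have D0 : 0 <= D by rewrite addr_ge0.
  apply: (@le_lt_trans _ _ (2 * M * A * (e / (2 * M * A + 1)))).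
    have -> : M * D * A = M * A * D by ring.
    by have -> : 2 * M * A * (e / (2 * M * A + 1)) = M * A * (2 * (e / (2 * M * A + 1)));
      [ring|apply: ler_wpM2l; [exact: mulr_ge0|exact: ltW]].
  by rewrite mulrCA gtr_pMr// ltr_pdivrMr// mul1r ltrDl.
by split; apply: main; (try exact: L1_kerP); (try exact: L1_kerQ) => s;
  have [] := hM x x' y y' s bx b1 by_ b2.
Qed.

Lemma hu_contx G y : L1 G -> 0 < y -> continuous (fun x => hu G x y).
Proof.
move=> GL y0 x; apply/cvgrPdist_lt => e e0.
have [d d0 hd] := huv_cont x GL y0 e0; near=> x'.
have [|||//] := hd x' y; [|by rewrite subrr normr0|by []].
by near: x'; exact: cvgr_dist_lt.
Unshelve. all: by end_near. Qed.

Definition inrange G c := (exists2 s, 0 < s < 1 & G s < c) /\ (exists2 s, 0 < s < 1 & c < G s).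

Lemma hu_level G c y : increasing01 G -> L1 G -> inrange G c -> 0 < y ->
  exists x, hu G x y = c.
Proof.
move=> Gi GL [[s1 s101 g1] [s2 s201 g2]] y0.
have [b hb] := hu_large Gi GL s201 g2 y0.
have [a ha] := hu_small Gi GL s101 g1 y0.
have ab : a <= b.
  by rewrite leNgt; apply/negP => ba; have := hu_incr Gi GL y0 ba; lra.
have [|z _ hz] := @IVT _ (fun x => hu G x y) a b c ab (continuous_subspaceT (hu_contx GL y0)).
  have hab : hu G a y <= hu G b y by lra.
  by rewrite /= (min_l hab) (max_r hab) !ltW.
by exists z.
Qed.

(* hv G t is increasing in y, so this is also its limit at the boundary point t. *)
Definition hW G t : \bar R := ereal_inf [set (hv G t y)%:E | y in [set y | 0 < y]].

Lemma hW_le G t y : 0 < y -> (hW G t <= (hv G t y)%:E)%E.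
Proof. by move=> y0; apply: ereal_inf_lbound; exists y. Qed.

Lemma hW_lt G t v : (hW G t < v%:E)%E -> exists2 y, 0 < y & hv G t y < v.
Proof. by move=> /ereal_inf_lt[_ [y y0 <-]]; rewrite lte_fin; exists y. Qed.

Lemma hW_mirror G t : L1 G -> hW (mirror G) t = hW G (- t).
Proof.
move=> GL; rewrite /hW; congr ereal_inf; apply/seteqP; split => _ [y y0 <-];
by exists y => //; rewrite hv_mirror.
Qed.

Definition psik t0 x y s : R :=
  (1 + tpar s ^+ 2) * ((x - t0) ^+ 2 + y ^+ 2) /
    ((tpar s - t0) ^+ 2 * ((x - tpar s) ^+ 2 + y ^+ 2)).

Lemma tpar_neq u s : 0 < u < 1 -> 0 < s < 1 -> s != u -> tpar s - tpar u != 0.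
Proof.
move=> u01 s01 su; rewrite subr_eq0; apply/negP => /eqP e; move: su.
by rewrite -(tparK s01) -(tparK u01) e eqxx.
Qed.

Lemma kerPsiE u x y s : 0 < y -> 0 < u < 1 -> 0 < s < 1 ->
  kerPsi (tpar u) x y s = (tpar s - tpar u) * psik (tpar u) x y s.
Proof.
move=> y0 u01 s01; rewrite /kerPsi /psik; have d := dist_gt0 x s y0.
have [->|su] := eqVneq s u; first by rewrite subrr !mul0r invr0 !mulr0.
by have t0 := tpar_neq u01 s01 su; field; rewrite t0 gt_eqF.
Qed.

Lemma psik_gt0 u x y s : 0 < y -> 0 < u < 1 -> 0 < s < 1 -> s != u ->
  0 < psik (tpar u) x y s.
Proof.
move=> y0 u01 s01 su; have d := dist_gt0 x s y0.
rewrite /psik divr_gt0// mulr_gt0 ?onesqr_gt0//.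
  by rewrite ltr_wpDl ?sqr_ge0// exprn_gt0.
by rewrite exprn_even_gt0//=; exact: tpar_neq.
Qed.

Lemma kerPsi_cut_ge0 G u c x y s : 0 < y -> 0 < u < 1 -> 0 < s < 1 -> cut G u c ->
  0 <= kerPsi (tpar u) x y s * (G s - c).
Proof.
move=> y0 u01 s01 h; rewrite kerPsiE//.
have [->|su] := eqVneq s u; first by rewrite subrr !mul0r.
rewrite mulrAC mulr_ge0 ?(cut_sign u01)//; exact/ltW/psik_gt0.
Qed.

Lemma mfun_tpar : measurable_fun [set: R] (tpar : R -> R).
Proof.
apply: measurable_funN; apply: measurable_funM; first exact: mfun_cspi.
by apply: mfun_inv; exact: mfun_snpi.
Qed.

Lemma mfun_kerPsi t0 x y : measurable_fun [set: R] (kerPsi t0 x y : R -> R).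
Proof.
have mt := mfun_tpar.
apply: measurable_funM.
  by apply: measurable_funD => //; exact: measurable_funX.
apply: measurable_funM => //; apply: mfun_inv; apply: measurable_funM.
  by apply: measurable_funB.
by apply: measurable_funD => //; apply: measurable_funX; exact: measurable_funB.
Qed.

Section finite_envelope.
Variables (G : R -> R) (u c : R).
Hypotheses (Gi : increasing01 G) (GL1 : L1 G) (u01 : 0 < u < 1) (uc : cut G u c).
Let t0 := tpar u.
Let Gc : L1 (fun s => G s - c) := L1_subc c GL1.

(** The total drop of [hv] on the vertical over t0, from height 1 to the boundary. The integrand is
    nonnegative, so the integral makes sense in the extended reals; it is +oo exactly when the
    envelope is -oo. *)
Definition psiJ : \bar R :=
  (\int[leb]_(s in unit_itv) (kerPsi t0 t0 1 s * (G s - c))%:E)%E.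

Let yn n : R := n.+1%:R^-1.
Let yn_gt0 n : 0 < yn n. Proof. by rewrite invr_gt0. Qed.
Let yn_le1 n : yn n <= 1. Proof. by rewrite invf_le1 ?ler1n. Qed.

Let kerQ_gap y1 y2 s : 0 < y1 -> y1 <= y2 -> 0 < s < 1 ->
  0 <= (kerQ t0 y2 s - kerQ t0 y1 s) * (G s - c).
Proof.
move=> y10 y12 s01; have y20 : 0 < y2 by exact: lt_le_trans y12.
rewrite kerQ_diff// mulrAC mulr_ge0 ?(cut_sign u01)//.
rewrite divr_ge0 ?mulr_ge0//; try exact/ltW/onesqr_gt0; try exact/ltW/dist_gt0.
by rewrite subr_ge0 lerXn2r// nnegrE ltW.
Qed.

(** Over t0 the factor (x - t0) / y of [kernel_identity] vanishes and the cotangents cancel in the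
    difference of two heights. After multiplication by [G s - c] the differences increase as the
    lower height decreases: monotone convergence. *)
Lemma hv_cvg_psiJ : (hv G t0 1 - hv G t0 (yn n))%:E @[n --> \oo] --> psiJ.
Proof.
pose g n s := ((kerQ t0 1 s - kerQ t0 (yn n) s) * (G s - c))%:E.
have gL n : L1 (fun s => (kerQ t0 1 s - kerQ t0 (yn n) s) * (G s - c)).
  apply: (@L1_eq _ (fun s => kerQ t0 1 s * (G s - c) - kerQ t0 (yn n) s * (G s - c))).
    by move=> s _; rewrite mulrBl.
  by apply: L1B; exact: L1_kerQ.
have gI n : (hv G t0 1 - hv G t0 (yn n))%:E = (\int[leb]_(s in unit_itv) g n s)%E.
  rewrite -EFin_I01// (hv_subc c t0 GL1 ltr01) (hv_subc c t0 GL1 (yn_gt0 n)).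
  rewrite -I01B; try exact: L1_kerQ.
  by congr (_%:E); apply: I01_eq => s _; rewrite mulrBl.
under eq_fun do rewrite gI.
have lim s : unit_itv s -> g n s @[n --> \oo] --> (kerPsi t0 t0 1 s * (G s - c))%:E.
  move=> /unit_itvP s01; apply: cvg_EFin; first exact: nearW.
  rewrite /g /comp /=; apply: cvgM; last exact: cvg_cst.
  have [e|su] := eqVneq s u.
    rewrite e /kerPsi subrr mul0r invr0 !mulr0.
    under eq_fun do rewrite kerQ_diff// subrr mul0r.
    exact: cvg_cst.
  have st := tpar_neq u01 s01 su; set k := _ - _ in st.
  have k2 : 0 < k ^+ 2 by rewrite exprn_even_gt0.
  have e n : kerQ t0 1 s - kerQ t0 (yn n) s = (k * ((1 + tpar s ^+ 2) / (k ^+ 2 + 1))) *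
      ((1 - yn n ^+ 2) / (k ^+ 2 + yn n ^+ 2)).
    have y2 : 0 < yn n ^+ 2 by rewrite exprn_gt0.
    have -> : kerQ t0 1 s - kerQ t0 (yn n) s = k * ((1 + tpar s ^+ 2) * (1 ^+ 2 - yn n ^+ 2) /
        ((k ^+ 2 + yn n ^+ 2) * (k ^+ 2 + 1))).
      by rewrite kerQ_diff// -[t0 - tpar s]opprB (sqrrN (tpar s - t0)) expr1n.
    by field; rewrite !gt_eqF// addr_gt0.
  under eq_fun do rewrite e.
  have -> : kerPsi t0 t0 1 s = (k * ((1 + tpar s ^+ 2) / (k ^+ 2 + 1))) *
      ((1 - 0 * 0) / (k ^+ 2 + 0 * 0)).
    rewrite /kerPsi -[t0 - tpar s]opprB -/k subrr (sqrrN k); field.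
    by rewrite st gt_eqF// addr_gt0.
  have ync : yn n @[n --> \oo] --> 0 by exact: cvg_harmonic.
  have ync2 : (fun n => yn n ^+ 2) @ \oo --> (0 * 0 : R).
    by under eq_fun do rewrite expr2; exact: cvgM.
  apply: cvgM; first exact: cvg_cst.
  apply: cvgM; first by apply: cvgB => //; exact: cvg_cst.
  apply: cvgV; first by rewrite mul0r addr0 gt_eqF.
  by apply: cvgD => //; exact: cvg_cst.
have -> : psiJ = (\int[leb]_(s in unit_itv) limn (g ^~ s))%E.
  by apply: eq_integral => s /set_mem us; apply/esym/cvg_lim => //; exact: lim.
apply: cvg_monotone_convergence => //.
- by move=> n; exact: measurable_int (gL n).
- by move=> n s /unit_itvP s01; rewrite lee_fin kerQ_gap.
- move=> s /unit_itvP s01 m n mn; rewrite lee_fin -subr_ge0.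
  rewrite -mulrBl (_ : _ - _ - _ = kerQ t0 (yn m) s - kerQ t0 (yn n) s); last by ring.
  by rewrite kerQ_gap// lef_pV2 ?posrE// ler_nat.
Qed.

Lemma psiJ_ge0 : (0 <= psiJ)%E.
Proof.
by apply: integral_ge0 => s /unit_itvP s01; rewrite lee_fin kerPsi_cut_ge0.
Qed.

Lemma hW_psiJ : hW G t0 = ((hv G t0 1)%:E - psiJ)%E.
Proof.
have c1 : (hv G t0 (yn n))%:E @[n --> \oo] --> ((hv G t0 1)%:E - psiJ)%E.
  have -> : (fun n => (hv G t0 (yn n))%:E) =
      (fun n => (hv G t0 1)%:E - (hv G t0 1 - hv G t0 (yn n))%:E)%E.
    by apply/funext => n; rewrite -EFinB; congr (_%:E); ring.
  apply: cvgeB; [|exact: cvg_cst|exact: hv_cvg_psiJ].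
  by rewrite fin_num_adde_defr.
have c2 : (hv G t0 (yn n))%:E @[n --> \oo] --> ereal_inf (range (fun n => (hv G t0 (yn n))%:E)).
  apply: ereal_nonincreasing_cvgn => m n mn; rewrite lee_fin hv_mono//.
  by rewrite lef_pV2 ?posrE// ler_nat.
have e := cvg_unique (@ereal_hausdorff R) c1 c2.
rewrite e; apply/eqP; rewrite eq_le; apply/andP; split.
  by apply: le_ereal_inf_tmp => _ [n _ <-]; exact: hW_le.
apply: le_ereal_inf_tmp => _ [y y0 <-].
have [n hn] := ltr_add_invr y0.
apply: (@le_trans _ _ (hv G t0 (yn n))%:E); first by apply: ereal_inf_lbound; exists n.
by rewrite lee_fin hv_mono//; move: hn; rewrite add0r => /ltW.
Qed.

(** The cotangent in [kernel_identity] is not integrable on its own. Comparing the identity at (x,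
    y) with the one at (t0, 1) cancels it, and the remainder at (t0, 1) is integrable because [psiJ]
    is finite. *)
Lemma hW_fin w x y : hW G t0 = w%:E -> 0 < y ->
  L1 (fun s => kerPsi t0 x y s * (G s - c)) /\
  hv G x y + (x - t0) / y * (hu G x y - c) = w + I01 (fun s => kerPsi t0 x y s * (G s - c)).
Proof.
rewrite hW_psiJ => hw y0.
have mP : mfun (fun s => kerPsi t0 t0 1 s * (G s - c)).
  apply: measurable_funM; last exact: (L1_mfun Gc).
  by apply: measurable_funTS; exact: mfun_kerPsi.
have PL : L1 (fun s => kerPsi t0 t0 1 s * (G s - c)).
  apply/integrableP; split; first exact/measurable_EFinP.
  rewrite [X in (X < _)%E](_ : _ = psiJ); last first.
    apply: eq_integral => s /set_mem/unit_itvP s01.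
    by rewrite gee0_abs// lee_fin kerPsi_cut_ge0.
  move: hw; case: psiJ psiJ_ge0 => [r| |]//= _ _; exact: ltry.
have hw' : w = hv G t0 1 - I01 (fun s => kerPsi t0 t0 1 s * (G s - c)).
  by move: hw; rewrite /psiJ -EFin_I01// => -[].
pose f s := kerPsi t0 t0 1 s * (G s - c) + (kerQ x y s * (G s - c)
   + (x - t0) / y * (kerP x y s * (G s - c)) - kerQ t0 1 s * (G s - c)).
have l1 := L1_kerQ x Gc y0; have l2 := L1_kerP x Gc y0; have l3 := L1_kerQ t0 Gc ltr01.
have l4 := L1Z ((x - t0) / y) l2.
have fL : L1 f by apply: L1D => //; apply: L1B => //; exact: L1D.
have [l e] := @I01_eq1 f (fun s => kerPsi t0 x y s * (G s - c)) u u01 fL (fun s s01 su =>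
  ltac:(by have := kernel_identity x y0 u01 s01 su; have := kernel_identity t0 ltr01 u01 s01 su;
    rewrite /f -/t0 subrr mul0r mul0r addr0 => e1 e2;
    have -> : kerPsi t0 x y s = kerPsi t0 t0 1 s + (kerQ x y s + (x - t0) / y * kerP x y s - kerQ t0 1 s);
      [lra|ring])).
split => //; rewrite e I01D//; last by apply: L1B => //; exact: L1D.
rewrite I01B//; last exact: L1D.
rewrite I01D// I01Z// -(hv_subc c x GL1 y0) -(hv_subc c t0 GL1 ltr01) -(hu_subc c x GL1 y0).
by rewrite hw'; ring.
Qed.

(** On the level curve [hu G x y = c] the correction vanishes and the point of the image lies
    strictly above the envelope. Off the curve the inequality still bounds [hv] from below when [hu]
    is close to c. *)
Lemma hW_lt_hv x y : 0 < y ->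
  (hW G t0 < (hv G x y + (x - t0) / y * (hu G x y - c))%:E)%E.
Proof.
move=> y0; have := psiJ_ge0; have := hW_psiJ.
case: psiJ => [r hw _|->|//]; last by rewrite ltNyr.
have {}hw : hW G t0 = (hv G t0 1 - r)%:E by rewrite hw.
have [l ->] := hW_fin x hw y0; rewrite hw lte_fin ltrDl.
(* [psik] is 0 at s = u by the convention on inverses; the value 1 there makes the second factor
   positive everywhere. *)
apply: (I01_cut_gt0 (u := u) (k := fun s => if s == u then 1 else psik t0 x y s)) => //.
- by move=> s s01 su; rewrite (negbTE su) kerPsiE.
- by move=> s s01 su; exact: kerPsi_cut_ge0.
- by move=> s s01; case: ifPn => // su; exact: psik_gt0.
Qed.

End finite_envelope.

Lemma abs_sin_le (x : R) : `|sin x| <= `|x|.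
Proof.
wlog x0 : x / 0 < x => [hw|].
  have [x0|x0|->] := ltgtP x 0; [|exact: hw|by rewrite sin0].
  by have := hw (- x); rewrite oppr_gt0 sinN !normrN; exact.
have [z _] := @MVT_segment R sin cos 0 x (ltW x0) (fun z _ => is_derive_sin z)
  (continuous_subspaceT (@continuous_sin R)).
rewrite sin0 !subr0 => ->; rewrite normrM ler_piMl//; exact: cos_max.
Qed.

Lemma tpar_lip u : 0 < u < 1 -> exists2 d, 0 < d & exists2 C, 0 < C &
  forall s, `|s - u| <= d -> 0 < s < 1 /\ `|tpar s - tpar u| <= C * `|s - u|.
Proof.
move=> u01; have /andP[u0 u1] := u01; have su := snpi_gt0 u01.
have [d d0 hd] : exists2 d, 0 < d & forall s, `|s - u| <= d -> snpi u / 2 < snpi s.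
  have /cvgrPdist_lt/(_ (snpi u / 2)) := @snpi_cont R u.
  rewrite divr_gt0// => /(_ isT) [d /= d0 hd]; exists (d / 2); first exact: divr_gt0.
  move=> s hs; have := hd s; rewrite /= distrC.
  move=> /(_ (le_lt_trans hs _)); rewrite ltr_norml => h.
  have dd : d / 2 < d by lra.
  by have /andP[_ h2] := h dd; lra.
exists (Num.min d (Num.min (u / 2) ((1 - u) / 2))).
  by rewrite !lt_min d0 !divr_gt0// subr_gt0.
exists (pi / (snpi u * (snpi u / 2))); first by rewrite divr_gt0 ?mulr_gt0 ?divr_gt0 ?pi_gt0.
move=> s; rewrite !le_min => /and3P[h1 h2 h3].
have s01 : 0 < s < 1.
  by move: h2 h3; rewrite !ler_norml => /andP[? ?] /andP[? ?]; apply/andP; split; lra.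
split=> //; have ss := snpi_gt0 s01; have ss' := hd _ h1.
rewrite tpar_sub// normrM [X in _ * X]gtr0_norm ?invr_gt0 ?mulr_gt0//.
rewrite mulrAC; apply: ler_pM => //; first by rewrite invr_ge0 mulr_ge0 ?ltW.
  by apply: le_trans (abs_sin_le _) _; rewrite normrM gtr0_norm ?pi_gt0.
rewrite lef_pV2 ?posrE ?mulr_gt0 ?divr_gt0// mulrC.
by rewrite ler_pM2r// ltW.
Qed.

End lower_envelope.

(** * The image contains every point above the envelope *)

Section growth_kernel.
Context {R : realType}.
Implicit Types (x y t A r : R).

(** With t = [tpar s] and r^2 = x^2 + y^2, the quotient of [num] by [dst] equals
    [kerQ x y s + x / y * kerP x y s]. Once r >= 4 + 2 A it has the sign of t for |t| >= A, is at
    least t / 16 for A <= t <= r, and is bounded in terms of A for |t| <= A. *)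
Let num x t r := 2 * x + t * (r ^+ 2 - 1).
Let dst x y t := (x - t) ^+ 2 + y ^+ 2.

Let dst_gt0 x y t : 0 < y -> 0 < dst x y t.
Proof. by move=> y0; rewrite ltr_wpDl ?sqr_ge0// exprn_gt0. Qed.

Let dstE x y t r : r ^+ 2 = x ^+ 2 + y ^+ 2 -> dst x y t = r ^+ 2 - 2 * x * t + t ^+ 2.
Proof. by move=> ->; rewrite /dst; ring. Qed.

Let absx x y r : 0 <= r -> r ^+ 2 = x ^+ 2 + y ^+ 2 -> - r <= x <= r.
Proof.
move=> r0 r2; rewrite -ler_norml -(@ler_pXn2r _ 2)// ?nnegrE//.
by rewrite r2 real_normK ?num_real// lerDl sqr_ge0.
Qed.

Let large x y t A r : 1 <= A -> 4 + 2 * A <= r -> r ^+ 2 = x ^+ 2 + y ^+ 2 -> A <= t ->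
  t * (r ^+ 2 / 4) <= num x t r.
Proof.
move=> A1 rA r2 tA; have r0 : 0 <= r by lra.
have /andP[xl xu] := absx r0 r2.
have r4 : 4 * r <= r ^+ 2 by rewrite expr2; apply: ler_wpM2r; lra.
apply: (@le_trans _ _ (t * (r ^+ 2 - 1 - 2 * r))); first by apply: ler_wpM2l; lra.
rewrite (_ : t * (r ^+ 2 - 1 - 2 * r) = t * (r ^+ 2 - 1) - 2 * (t * r)); last by ring.
have : 1 * r <= t * r by apply: ler_wpM2r; lra.
by rewrite /num; lra.
Qed.

Lemma growth_kernel_ge0 x y t A r : 1 <= A -> 0 < y -> 4 + 2 * A <= r ->
  r ^+ 2 = x ^+ 2 + y ^+ 2 -> A <= t ->
  0 <= (2 * x + t * (r ^+ 2 - 1)) / ((x - t) ^+ 2 + y ^+ 2).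
Proof.
move=> A1 y0 rA r2 tA; apply: divr_ge0; last exact/ltW/dst_gt0.
by apply: le_trans (large A1 rA r2 tA); rewrite mulr_ge0 ?divr_ge0 ?sqr_ge0//; lra.
Qed.

Lemma growth_kernel_ge x y t A r : 1 <= A -> 0 < y -> 4 + 2 * A <= r ->
  r ^+ 2 = x ^+ 2 + y ^+ 2 -> A <= t -> t <= r ->
  t / 16 <= (2 * x + t * (r ^+ 2 - 1)) / ((x - t) ^+ 2 + y ^+ 2).
Proof.
move=> A1 y0 rA r2 tA tr; have r0 : 0 <= r by lra.
have /andP[xl xu] := absx r0 r2.
rewrite ler_pdivlMr ?dst_gt0// mulrC; apply: le_trans (large A1 rA r2 tA).
rewrite (_ : t * (r ^+ 2 / 4) = 4 * r ^+ 2 * (t / 16)); last by field.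
apply: ler_wpM2r; first lra.
have t1 : t ^+ 2 <= r ^+ 2 by rewrite lerXn2r// nnegrE; lra.
have : - (2 * x * t) <= 2 * (r * r).
  have -> : - (2 * x * t) = 2 * (- x * t) by ring.
  rewrite ler_wpM2l//; apply: (@le_trans _ _ (r * t)).
    by apply: ler_wpM2r; lra.
  by apply: ler_wpM2l; lra.
by rewrite -/(dst x y t) (dstE t r2) -expr2; lra.
Qed.

Lemma growth_kernel_le0 x y t A r : 1 <= A -> 0 < y -> 4 + 2 * A <= r ->
  r ^+ 2 = x ^+ 2 + y ^+ 2 -> t <= - A ->
  (2 * x + t * (r ^+ 2 - 1)) / ((x - t) ^+ 2 + y ^+ 2) <= 0.
Proof.
move=> A1 y0 rA r2 tA; have r0 : 0 <= r by lra.
have /andP[xl xu] := absx r0 r2.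
have r4 : 4 * r <= r ^+ 2 by rewrite expr2; apply: ler_wpM2r; lra.
rewrite pmulr_lle0 ?invr_gt0 ?dst_gt0//.
have : t * (r ^+ 2 - 1) <= -1 * (r ^+ 2 - 1) by apply: ler_wpM2r; lra.
lra.
Qed.

Lemma growth_kernel_abs x y t A r : 1 <= A -> 0 < y -> 4 + 2 * A <= r ->
  r ^+ 2 = x ^+ 2 + y ^+ 2 -> `|t| <= A ->
  `|(2 * x + t * (r ^+ 2 - 1)) / ((x - t) ^+ 2 + y ^+ 2)| <= 4 * (A + 1).
Proof.
move=> A1 y0 rA r2 tA; have r0 : 0 <= r by lra.
have /andP[xl xu] := absx r0 r2.
have r4 : 4 * r <= r ^+ 2 by rewrite expr2; apply: ler_wpM2r; lra.
have D0 := dst_gt0 x t y0; rewrite normrM (gtr0_norm (x := _^-1)) ?invr_gt0// ler_pdivrMr//.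
have Dl : r ^+ 2 / 4 <= (x - t) ^+ 2 + y ^+ 2.
  rewrite -/(dst x y t) (dstE t r2); have : 2 * x * t <= 2 * (r * `|t|).
    rewrite -mulrA ler_wpM2l//; apply: (le_trans (ler_norm _)).
    by rewrite normrM ler_wpM2r// ler_norml xl.
  have : (r / 2) ^+ 2 <= (r - `|t|) ^+ 2 by rewrite lerXn2r ?nnegrE//; lra.
  by rewrite -(real_normK (x := t)) ?num_real// !expr2; lra.
apply: (@le_trans _ _ ((A + 1) * r ^+ 2)).
  apply: (le_trans (ler_normD _ _)); rewrite !normrM (ger0_norm (x := 2))//.
  rewrite (ger0_norm (x := r ^+ 2 - 1)); last lra.
  have : `|t| * (r ^+ 2 - 1) <= A * (r ^+ 2 - 1) by apply: ler_wpM2r; lra.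
  have : `|x| <= r by rewrite ler_norml xl.
  lra.
rewrite (_ : 4 * (A + 1) * _ = (A + 1) * (4 * ((x - t) ^+ 2 + y ^+ 2))); last by ring.
by apply: ler_wpM2l; lra.
Qed.

End growth_kernel.

Section image_of_half_plane.
Context {R : realType}.
Local Notation leb := (@lebesgue_measure R).
Implicit Types (x y s u c t : R).
Variable G : R -> R.
Hypotheses (Gi : increasing01 G) (GL1 : L1 G).

Lemma hW_lty t : (hW G t < +oo)%E.
Proof. exact: le_lt_trans (hW_le G t ltr01) (ltry _). Qed.

(** If the envelope had a finite value w, [hW_fin] with the upper level c' would write [hv] at
    height e over [tpar u] as w plus an integral. On the parameters from u - 2 e to u - e, where
    [G s - c'] is at most c - c' < 0, the integrand is of order 1 / e, so the integral does not tend
    to 0 with e. *)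
Lemma hW_gap u c c' : 0 < u < 1 -> cut G u c -> cut G u c' -> c < c' ->
  hW G (tpar u) = -oo%E.
Proof.
move=> u01 uc uc' cc'; have := hW_lty (tpar u).
case hw : (hW G (tpar u)) => [w| |]// _; exfalso.
have [d d0 [C C0 hC]] := tpar_lip u01.
(* With k <= 2 C e, the denominator k (k^2 + e^2) / e^2 of the integrand is at most q e. *)
set q := 2 * C * (4 * C ^+ 2 + 1); have q0 : 0 < q.
  by rewrite !mulr_gt0// addr_gt0// mulr_gt0// exprn_gt0.
have k0 : 0 < (c' - c) / q by rewrite divr_gt0// subr_gt0.
have : (hW G (tpar u) < (w + (c' - c) / q)%:E)%E by rewrite hw lte_fin ltrDl.
move=> /hW_lt[y1 y10 hy1].
pose e := Num.min y1 (d / 2).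
have e0 : 0 < e by rewrite lt_min y10 divr_gt0.
have ed : 2 * e <= d by have : e <= d / 2 by [rewrite ge_min lexx orbT|]; lra.
have he : hv G (tpar u) e < w + (c' - c) / q.
  by apply: le_lt_trans hy1; rewrite hv_mono// ge_min lexx.
have [l] := hW_fin Gi GL1 u01 uc' (tpar u) hw e0.
rewrite subrr !mul0r addr0 => hh; move: he; rewrite hh ltrD2l ltNge => /negP; apply.
have n1 : `|u - 2 * e - u| <= d by rewrite addrC addKr normrN gtr0_norm; lra.
have [/andP[a0 a1] _] := hC _ n1.
have -> : (c' - c) / q = (c' - c) / (q * e) * ((u - e) - (u - 2 * e)).
  by field; rewrite !gt_eqF.
apply: I01_ge_itv => //; [lra|by case/andP: u01 => *; lra| |].
  by move=> s /unit_itvP s01; exact: kerPsi_cut_ge0.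
move=> s /andP[s1 s2].
have su : `|s - u| <= 2 * e by rewrite ler0_norm; lra.
have [s01 ts] := hC s (le_trans su ed).
have slu : s < u by lra.
have Gs : G s <= c by have [h _] := uc s s01; exact: h.
have t0 : tpar s - tpar u < 0.
  by rewrite subr_lt0; case/andP: s01 => *; case/andP: u01 => *; exact: tpar_lt.
move: ts; rewrite ltr0_norm//; set k := - (_ - _) => kC.
have kpos : 0 < k by rewrite oppr_gt0.
have kC' : k <= C * (2 * e) by apply: le_trans kC _; rewrite ler_wpM2l// ltW.
have -> : kerPsi (tpar u) (tpar u) e s * (G s - c') =
    (1 + tpar s ^+ 2) * ((c' - G s) * (e ^+ 2 / (k * (k ^+ 2 + e ^+ 2)))).
  have e1 : tpar s - tpar u = - k by rewrite /k; ring.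
  have e2 : tpar u - tpar s = k by rewrite /k; ring.
  have k2e : 0 < k ^+ 2 + e ^+ 2 by rewrite addr_gt0// exprn_gt0.
  rewrite /kerPsi subrr expr0n/= add0r e1 e2; clearbody k.
  by field; rewrite !gt_eqF.
have D0 : 0 < k * (k ^+ 2 + e ^+ 2).
  by rewrite mulr_gt0// ltr_wpDl ?sqr_ge0// exprn_gt0.
apply: (@le_trans _ _ ((c' - G s) * (e ^+ 2 / (k * (k ^+ 2 + e ^+ 2))))); last first.
  rewrite ler_peMl//; last by rewrite lerDl sqr_ge0.
  by apply: mulr_ge0; [lra|rewrite ltW// divr_gt0 ?exprn_gt0].
apply: ler_pM; [lra|by rewrite invr_ge0 mulr_ge0 ?ltW|lra|].
rewrite ler_pdivlMr// mulrC ler_pdivrMr; last by rewrite mulr_gt0.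
have k2 : k ^+ 2 <= (C * (2 * e)) ^+ 2 by rewrite lerXn2r// nnegrE; [exact: ltW|rewrite !mulr_ge0// ltW].
have -> : e ^+ 2 * (q * e) = (C * (2 * e)) * ((C * (2 * e)) ^+ 2 + e ^+ 2) by rewrite /q; ring.
by apply: ler_pM => //; [exact: ltW|rewrite addr_ge0 ?sqr_ge0|rewrite lerD2r].
Qed.

(** As b tends to 1 this diverges logarithmically, which is the source of the unboundedness in
    [growth]. *)
Lemma tpar_integral a b : 0 < a -> a < b -> b < 1 ->
  \int[leb]_(s in `[a, b]) tpar s = pi^-1 * (ln (snpi a) - ln (snpi b)).
Proof.
move=> a0 ab b1.
have p0 := pi_gt0 R.
have s01 s : a <= s <= b -> 0 < s < 1 by move=> /andP[? ?]; apply/andP; split; lra.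
apply: (etrans (@FTC2_itv _ _ (fun s => - pi^-1 * ln (snpi s)) a b ab _ _)); last by ring.
- move=> s /s01/snpi_gt0 s0.
  have -> : tpar s = - pi^-1 *: ((snpi s)^-1 * (cspi s * pi)).
    rewrite /tpar /GRing.scale/=; move: p0; generalize (pi : R) => p p0.
    by field; rewrite !gt_eqF.
  apply: (@is_deriveZ _ _ _ (fun s => ln (snpi s))).
  apply: (@is_derive1_comp _ (@ln R) snpi); first exact: is_derive1_ln.
  apply: (@is_derive1_comp _ (@sin R) (fun s => pi * s)).
  have := @is_deriveZ _ _ _ (fun s : R => s) pi s 1 1 _.
  by rewrite /GRing.scale/= mulr1; apply.
- move=> s /s01/snpi_gt0 s0.
  apply: cvgN; apply: cvgM; first exact: cspi_cont.
  by apply: cvgV; [rewrite gt_eqF|exact: snpi_cont].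
Qed.

(** For the combined kernel K, the parameters from sA to sB contribute at least a multiple of the
    integral of [tpar], arbitrarily large as sB nears 1. Those with |tpar s| <= A cost at most C1,
    and all others contribute nonnegatively since K and G - c have equal signs there. *)
Lemma growth u c B : 0 < u < 1 -> cut G u c -> exists2 r0, 0 < r0 & forall x y,
  0 < y -> r0 ^+ 2 <= x ^+ 2 + y ^+ 2 -> B <= hv G x y + x / y * (hu G x y - c).
Proof.
move=> u01 uc; set A := `|tpar u| + 1.
have A1 : 1 <= A by rewrite lerDr.
have uA : tpar u < A by rewrite /A; have := ler_norm (tpar u); lra.
have Au : - A < tpar u by rewrite /A; have := ler_normr (- tpar u) (tpar u) ; have := ler_norm (- tpar u); rewrite normrN; lra.
have /andP[sA0 sA1] := tinv_itv A; have /andP[sm0 sm1] := tinv_itv (- A).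
set sA := tinv A in sA0 sA1 *; set sm := tinv (- A) in sm0 sm1 *.
have usA : u < sA by rewrite -(tparK u01); exact: tinv_lt.
have smu : sm < u by rewrite -(tparK u01); exact: tinv_lt.
have /andP[u0 u1] := u01.
set k := G sA - c; have k0 : 0 < k by rewrite subr_gt0 (cut_gt Gi u01).
have GcL : L1 (fun s => G s - c) by exact: L1_subc.
pose C0 := 4 * (A + 1); pose C1 := C0 * I01 (fun s => `|G s - c|).
have p0 := pi_gt0 R.
pose M := (B + C1) * 16 / k * pi - ln (snpi sA).
(* The second term gives sin (pi h) <= pi h <= e^(-M), so that ln ([snpi sB]) is at most -M. *)
pose h := Num.min ((1 - sA) / 2) (expR (- M) / pi).
have h0 : 0 < h by rewrite lt_min !divr_gt0 ?subr_gt0 ?expR_gt0.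
have h1 : h <= (1 - sA) / 2 by rewrite ge_min lexx.
set sB := 1 - h; have sAB : sA < sB by rewrite /sB; lra.
have sB1 : sB < 1 by rewrite /sB; lra.
have sB01 : 0 < sB < 1 by rewrite sB1 andbT; lra.
have lnB : ln (snpi sB) <= - M.
  rewrite /sB snpi_onem -[leRHS]expRK ler_ln ?posrE ?expR_gt0//; last first.
    by apply: snpi_gt0; apply/andP; split; lra.
  apply: (le_trans (ler_norm _)); apply: (le_trans (abs_sin_le _)).
  rewrite normrM !gtr0_norm// mulrC -ler_pdivlMr// /h ge_min lexx orbT //.
have intB : (B + C1) * 16 / k <= \int[leb]_(s in `[sA, sB]) tpar s.
  rewrite tpar_integral// -ler_pdivrMl ?invr_gt0// invrK mulrC; move: lnB; rewrite /M; lra.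
set tB := tpar sB.
(* The first two terms are the threshold of the kernel estimates; |tB| ensures t <= r for all
   parameters up to sB. *)
exists (4 + 2 * A + `|tB|); first by have := normr_ge0 tB; lra.
move=> x y y0 hq; set q := x ^+ 2 + y ^+ 2 in hq *.
have q0 : 0 <= q by rewrite addr_ge0 ?sqr_ge0.
set r := Num.sqrt q; have r2 : r ^+ 2 = q by exact: sqr_sqrtr.
have r0 : 0 <= r by exact: sqrtr_ge0.
have tB0 := normr_ge0 tB; have tBn := ler_norm tB.
have rl : 4 + 2 * A + `|tB| <= r.
  rewrite -(@ler_pXn2r _ 2)// ?nnegrE ?r2//; lra.
pose K s := kerQ x y s + x / y * kerP x y s.
have l1 := L1_kerQ x GcL y0; have l2 := L1Z (x / y) (L1_kerP x GcL y0).
have KL : L1 (fun s => K s * (G s - c)).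
  by apply: (L1_eq _ (L1D l1 l2)) => s _; rewrite /K; ring.
have -> : hv G x y + x / y * (hu G x y - c) = I01 (fun s => K s * (G s - c)).
  rewrite (hv_subc c x GL1 y0) (hu_subc c x GL1 y0) -I01Z; last exact: L1_kerP.
  by rewrite -I01D//; apply: I01_eq => s _; rewrite /K; ring.
pose L s := k / 16 * (tpar s * \1_`[sA, sB] s).
have tL : L1 (fun s => tpar s * (\1_`[sA, sB] s : R)).
  apply: (@L1_le _ _ (fun=> `|A| + `|tB|)); last exact: L1_cst.
    apply: measurable_funM; first by apply: measurable_funTS; exact: mfun_tpar.
    by apply: measurable_funTS; exact: measurable_indic.
  move=> s /unit_itvP s01; rewrite indicE; have [/set_mem/=|_] := boolP (s \in _); last first.
    by rewrite mulr0 normr0 addr_ge0.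
  rewrite in_itv/= mulr1 => /andP[sAs ssB].
  have /andP[s0' s1'] := s01.
  have h2 := tpar_le sA0 sAs s1'; have h3 := tpar_le s0' ssB sB1.
  rewrite tinvK in h2; rewrite ger0_norm; last lra.
  by rewrite -/tB in h3; have := normr_ge0 A; lra.
have tI : I01 (fun s => tpar s * (\1_`[sA, sB] s : R)) = \int[leb]_(s in `[sA, sB]) tpar s.
  rewrite [X in \int[_]_(s in X) _](_ : _ = unit_itv `&` `[sA, sB]%classic); last first.
    rewrite setIidr// => s /=; rewrite in_itv/= => /andP[? ?]; apply/unit_itvP.
    by apply/andP; split; lra.
  rewrite Rintegral_mkcondr; apply: eq_Rintegral => s _.
  by rewrite patchE indicE; case: (s \in _); rewrite ?mulr1 ?mulr0.
apply: (@le_trans _ _ (I01 (fun s => L s - C0 * `|G s - c|))).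
  have lC : L1 (fun s => C0 * `|G s - c|) by exact: L1Z (L1_norm GcL).
  rewrite (I01B (L1Z _ tL) lC) (I01Z _ tL) (I01Z _ (L1_norm GcL)) -/C1 tI.
  have : k / 16 * ((B + C1) * 16 / k) <= k / 16 * \int[leb]_(s in `[sA, sB]) tpar s.
    by rewrite ler_wpM2l// divr_ge0// ltW.
  have -> : k / 16 * ((B + C1) * 16 / k) = B + C1 by field; rewrite gt_eqF.
  lra.
apply: I01_le => //.
  by apply: L1B; [exact: L1Z|exact: L1Z (L1_norm GcL)].
move=> s /unit_itvP s01; have /andP[s0 s1] := s01.
set t := tpar s.
have KE : K s = (2 * x + t * (r ^+ 2 - 1)) / ((x - t) ^+ 2 + y ^+ 2).
  have D0 := dist_gt0 x s y0; rewrite -/t in D0.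
  by rewrite r2 /K kerQE// kerPE// -/t /q; field; rewrite !gt_eqF.
have n0 : 0 <= C0 * `|G s - c|.
  by apply: mulr_ge0 => //; apply: mulr_ge0 => //; apply: addr_ge0 => //; exact: le_trans A1.
have rA : 4 + 2 * A <= r by apply: le_trans rl; rewrite lerDl.
have [sAs|ssA] := leP sA s.
  have tA : A <= t by rewrite -(tinvK A); exact: tpar_le.
  have Gk : k <= G s - c.
    rewrite /k lerD2r; move: sAs; rewrite le_eqVlt => /predU1P[->//|sAs].
    exact/ltW/Gi.
  have K0 : 0 <= K s by rewrite KE; exact: (growth_kernel_ge0 A1 y0 rA r2 tA).
  rewrite lerBlDr; apply: (@le_trans _ _ (K s * (G s - c))); last by rewrite lerDl.
  rewrite /L indicE; have [/set_mem/=|_] := boolP (s \in _); last first.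
    by rewrite !mulr0; apply: mulr_ge0 => //; apply: le_trans Gk; exact: ltW.
  rewrite in_itv/= mulr1 => /andP[_ ssB].
  have tBs : t <= tB by exact: tpar_le.
  rewrite -/t (_ : k / 16 * t = t / 16 * k); last by ring.
  apply: ler_pM => //; [|exact: ltW|].
    by apply: divr_ge0 => //; apply: le_trans tA; exact: le_trans A1.
  rewrite KE; apply: (growth_kernel_ge A1 y0 rA r2 tA); apply: (le_trans tBs); apply: (le_trans tBn).
  apply: le_trans rl; rewrite lerDr; apply: addr_ge0 => //; apply: mulr_ge0 => //.
  exact: le_trans A1.
have L0 : L s = 0.
  rewrite /L indicE memNset ?mulr0//= in_itv/= => /andP[h2 _].
  by move: ssA; rewrite ltNge h2.
rewrite L0 sub0r.
have [ssm|sms] := leP s sm.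
  have tA : t <= - A by rewrite -(tinvK (- A)); exact: tpar_le.
  have Gk : G s - c <= 0.
    by rewrite subr_le0; have [h2 _] := uc s s01; apply: h2; exact: le_lt_trans smu.
  apply: (@le_trans _ _ 0); first by rewrite oppr_le0.
  by rewrite mulr_le0// KE; exact: growth_kernel_le0 tA.
have tA : `|t| <= A.
  rewrite ler_norml; apply/andP; split.
    by rewrite -[leLHS]tinvK; apply: tpar_le => //; exact: ltW.
  by rewrite -[leRHS]tinvK; apply: tpar_le => //; exact: ltW.
suff KC : `|K s| <= C0.
  apply: (@le_trans _ _ (- (`|K s| * `|G s - c|))).
    by rewrite lerN2 ler_wpM2r.
  by rewrite -normrM lerNl -normrN ler_norm.
by rewrite KE; exact: (growth_kernel_abs A1 y0 rA r2 tA).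
Qed.

(* Intermediate values along the level curve hu = c: hv is close to hW near the boundary
   point tpar u and tends to infinity along the curve by [growth]. *)
Lemma upper_region u c v : 0 < u < 1 -> cut G u c -> inrange G c ->
  (hW G (tpar u) < v%:E)%E -> exists x y, [/\ 0 < y, hu G x y = c & hv G x y = v].
Proof.
move=> u01 uc cr Wv; set t0 := tpar u in Wv.
have /choice[X hX] : forall y, exists x, 0 < y -> hu G x y = c.
  move=> y; have [y0|y0] := ltP 0 y; last by exists 0.
  by have [x hx] := hu_level Gi GL1 cr y0; exists x.
have Xlt y x : 0 < y -> c < hu G x y -> X y < x.
  by move=> y0 h; rewrite ltNge; apply/negP => h2; have := hu_mono Gi GL1 y0 h2; rewrite hX//; lra.
have Xgt y x : 0 < y -> hu G x y < c -> x < X y.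
  by move=> y0 h; rewrite ltNge; apply/negP => h2; have := hu_mono Gi GL1 y0 h2; rewrite hX//; lra.
(* [hu] is strictly below c at X y - e / 2 and strictly above at X y + e / 2; both inequalities
   persist at nearby heights and trap [X y']. *)
have Xcont y e : 0 < y -> 0 < e -> exists2 d, 0 < d & forall y', `|y - y'| < d -> 0 < y' ->
    `|X y - X y'| < e.
  move=> y0 e0.
  have e2 : 0 < e / 2 by rewrite divr_gt0.
  have [x1 x2] : X y - e / 2 < X y /\ X y < X y + e / 2 by split; lra.
  have l := hu_incr Gi GL1 y0 x1; have r := hu_incr Gi GL1 y0 x2.
  rewrite hX// in l r.
  have l' : 0 < c - hu G (X y - e / 2) y by rewrite subr_gt0.
  have r' : 0 < hu G (X y + e / 2) y - c by rewrite subr_gt0.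
  have [d1 d10 hd1] := huv_cont (X y - e / 2) GL1 y0 l'.
  have [d2 d20 hd2] := huv_cont (X y + e / 2) GL1 y0 r'.
  exists (Num.min d1 d2); first by rewrite lt_min d10.
  move=> y'; rewrite lt_min => /andP[yd1 yd2] y'0.
  have [+ _] := hd1 (X y - e / 2) y' ltac:(by rewrite subrr normr0) yd1 y'0.
  have [+ _] := hd2 (X y + e / 2) y' ltac:(by rewrite subrr normr0) yd2 y'0.
  rewrite !ltr_norml => /andP[h1 h2] /andP[h3 h4].
  have := Xlt y' (X y + e / 2) y'0 ltac:(lra); have := Xgt y' (X y - e / 2) y'0 ltac:(lra).
  by move=> *; apply/andP; split; lra.
pose g y := hv G (X y) y.
have gcont y : 0 < y -> {for y, continuous g}.
  move=> y0; apply/cvgrPdist_lt => e e0.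
  have [d d0 hd] := huv_cont (X y) GL1 y0 e0.
  have [d' d'0 hd'] := Xcont y d y0 d0.
  near=> y'.
  have y'0 : 0 < y' by near: y'; exact: lt_nbhsr.
  have n1 : `|y - y'| < d by near: y'; exact: cvgr_dist_lt.
  have n2 : `|y - y'| < d' by near: y'; exact: cvgr_dist_lt.
  by have [] := hd (X y') y' (hd' y' n2 y'0) n1 y'0.
(* [hv] is below v at some height y1 over t0, hence also over nearby abscissas. For small y the
   curve is over such an abscissa, and monotonicity in the height brings the bound from y1 down to
   y. *)
have [ya ya0 hya] : exists2 y, 0 < y & g y < v.
  have [y1 y10 hy1] := hW_lt Wv.
  have hy1' : 0 < v - hv G t0 y1 by rewrite subr_gt0.
  have [d d0 hd] := huv_cont t0 GL1 y10 hy1'.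
  have d4 : 0 < d / 4 by rewrite divr_gt0.
  set s1 := tinv (t0 + d / 4); have s101 : 0 < s1 < 1 by exact: tinv_itv.
  set s2 := tinv (t0 - d / 4); have s201 : 0 < s2 < 1 by exact: tinv_itv.
  have us1 : u < s1 by rewrite -(tparK u01); apply: tinv_lt; rewrite -/t0; lra.
  have us2 : s2 < u by rewrite -(tparK u01); apply: tinv_lt; rewrite -/t0; lra.
  have Gs1 : c < G s1 by case/andP: s101 => *; exact: (cut_gt Gi u01).
  have Gs2 : G s2 < c by case/andP: s201 => *; exact: (cut_lt Gi u01).
  have [C1 hC1] := hu_ge Gi GL1 (`|t0| + d) s101 d4.
  have [C2 hC2] := hu_le Gi GL1 (`|t0| + d) s201 d4.
  rewrite !tinvK in hC1 hC2.
  pose e1 := (G s1 - c) / (`|C1| + 1); pose e2 := (c - G s2) / (`|C2| + 1).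
  have e10 : 0 < e1 by rewrite divr_gt0 ?subr_gt0// ltr_wpDl.
  have e20 : 0 < e2 by rewrite divr_gt0 ?subr_gt0// ltr_wpDl.
  pose y := Num.min y1 (Num.min e1 e2).
  have y0 : 0 < y by rewrite !lt_min y10 e10 e20.
  have [yy1 ye1 ye2] : [/\ y <= y1, y <= e1 & y <= e2] by split; rewrite /y !ge_min lexx ?orbT.
  have cb C e m : 0 < m -> e = m / (`|C| + 1) -> 0 < y -> y <= e -> C * y < m.
    move=> m0 -> _ ye; apply: (@le_lt_trans _ _ (`|C| * y)).
      by rewrite ler_wpM2r ?ler_norm// ltW.
    apply: (@le_lt_trans _ _ (`|C| * (m / (`|C| + 1)))); first by rewrite ler_wpM2l.
    by rewrite mulrCA gtr_pMr// ltr_pdivrMr ?mul1r ?ltrDl// ltr_wpDl.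
  have n1 : `|t0 + d / 2| <= `|t0| + d.
    by apply: (le_trans (ler_normD _ _)); rewrite (gtr0_norm (x := d / 2)); lra.
  have n2 : `|t0 - d / 2| <= `|t0| + d.
    by apply: (le_trans (ler_normB _ _)); rewrite (gtr0_norm (x := d / 2)); lra.
  have a1 := hC1 (t0 + d / 2) y ltac:(lra) n1 y0.
  have a2 := hC2 (t0 - d / 2) y ltac:(lra) n2 y0.
  have b1 := cb C1 e1 (G s1 - c) ltac:(lra) erefl y0 ye1.
  have b2 := cb C2 e2 (c - G s2) ltac:(lra) erefl y0 ye2.
  have x1 := Xlt y (t0 + d / 2) y0 ltac:(lra).
  have x2 := Xgt y (t0 - d / 2) y0 ltac:(lra).
  exists y => //; rewrite /g.
  have tX : `|t0 - X y| < d by rewrite ltr_norml; apply/andP; split; lra.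
  have [_] := hd (X y) y1 tX ltac:(by rewrite subrr normr0) y10.
  rewrite ltr_norml => /andP[h1 _].
  by have := hv_mono Gi GL1 (X y) y0 yy1; lra.
(* The correction term of [growth] vanishes on the level curve, and height r already puts the point
   outside the disc. *)
have [yb yb0 hyb] : exists2 y, 0 < y & v < g y.
  have [r r0 hr] := growth (v + 1) u01 uc.
  exists r => //; have := hr (X r) r r0; rewrite hX// subrr mulr0 addr0 lerDr sqr_ge0.
  by move=> /(_ isT); rewrite /g; lra.
have gc a b : 0 < a -> {within `[a, b], continuous g}.
  move=> a0; apply: continuous_in_subspaceT => z /set_mem/=; rewrite in_itv/= => /andP[az _].
  exact/gcont/(lt_le_trans a0).
(* Both orders must be treated: ya and yb come from unrelated arguments. *)
have [ab|ba] := leP ya yb.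
  have gab : g ya <= g yb by lra.
  have [|z] := @IVT _ g ya yb v ab (gc _ _ ya0).
    by rewrite (min_l gab) (max_r gab) !ltW.
  rewrite in_itv/= => /andP[az _] hz; have z0 : 0 < z by exact: lt_le_trans az.
  by exists (X z), z; rewrite hX.
have gab : g ya <= g yb by lra.
have [|z] := @IVT _ g yb ya v (ltW ba) (gc _ _ yb0).
  by rewrite (min_r gab) (max_l gab) !ltW.
rewrite in_itv/= => /andP[az _] hz; have z0 : 0 < z by exact: lt_le_trans az.
by exists (X z), z; rewrite hX.
Unshelve. all: by end_near. Qed.

End image_of_half_plane.

(** * A rectangle argument from the Cauchy-Riemann equations *)

Section discrete_cauchy_riemann.
Context {R : realType}.
Implicit Types (G : R -> R) (x y s t X Y q B a b : R).

(** Discrete form of the equality of the x-derivative of [kerP] and the y-derivative of [kerQ]. The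
    constant does not depend on s, so the error can be integrated against G. *)
Lemma cell_kernel X Y y0 : 0 < y0 -> exists2 C, 0 <= C & forall x y h1 h2 s,
  0 < s < 1 -> `|x| <= X -> `|x + h1| <= X -> y0 <= y -> y + h2 <= Y -> 0 < h1 <= 1 -> 0 < h2 <= 1 ->
  `|(kerQ x (y + h2) s - kerQ x y s) / h2 - (kerP (x + h1) y s - kerP x y s) / h1| <= C * (h1 + h2).
Proof.
move=> y00; pose M := (1 + X ^+ 2 + Y ^+ 2) / y0 ^+ 2.
pose c1 := 4 * Y / y0 ^+ 2 + 2 / y0 ^+ 2 + y0^-1.
pose c2 := `|Y| * (6 / y0 ^+ 2 + (y0 ^+ 2)^-1 ^+ 2).
have y02 : 0 < y0 ^+ 2 by rewrite exprn_gt0.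
have M0 : 0 <= M by rewrite divr_ge0 ?ltW// one_sqr_gt0.
exists (M * (`|c1| + c2)).
  apply: mulr_ge0 => //; apply: addr_ge0 => //; apply: mulr_ge0 => //.
  by apply: addr_ge0; [apply: divr_ge0 => //; exact: ltW|exact: sqr_ge0].
move=> x y h1 h2 s s01 xX xX1 yl yu /andP[h10 h11] /andP[h20 h21].
have yp : 0 < y by exact: lt_le_trans yl.
have yp2 : 0 < y + h2 by rewrite addr_gt0.
set t := tpar s; pose Z := x - t; pose D := Z ^+ 2 + y ^+ 2.
pose D1 := (x + h1 - t) ^+ 2 + y ^+ 2; pose D2 := Z ^+ 2 + (y + h2) ^+ 2.
have D0 : 0 < D by exact: dist_gt0.
have D10 : 0 < D1 by exact: dist_gt0.
have D20 : 0 < D2 by exact: dist_gt0.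
have m0 : 0 < 1 + t ^+ 2 by exact: onesqr_gt0.
have bnd a b : `|a| <= X -> y0 <= b -> b <= Y ->
    (1 + t ^+ 2) / ((a - t) ^+ 2 + b ^+ 2) <= M.
  move=> aX bl bu; have b0 : 0 < b by exact: lt_le_trans bl.
  have -> : (1 + t ^+ 2) / ((a - t) ^+ 2 + b ^+ 2) = (kden a b s)^-1.
    by rewrite kdenE// invfM /t onetpar2.
  apply: (le_trans (kden_inv_le a s b0)).
  have a2 : a ^+ 2 <= X ^+ 2.
    by rewrite -real_normK ?num_real// lerXn2r// nnegrE (le_trans (normr_ge0 a)).
  have b2 : b ^+ 2 <= Y ^+ 2 by rewrite lerXn2r// nnegrE; lra.
  have b3 : y0 ^+ 2 <= b ^+ 2 by rewrite lerXn2r// nnegrE; lra.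
  apply: ler_pM.
  - by rewrite ltW// one_sqr_gt0.
  - by rewrite invr_ge0 sqr_ge0.
  - lra.
  - by rewrite lef_pV2// posrE exprn_gt0.
have yY : y <= Y by lra.
have M1 : (1 + t ^+ 2) / D1 <= M by exact: bnd.
have M2 : (1 + t ^+ 2) / D2 <= M by apply: bnd => //; lra.
have Dl : y0 ^+ 2 <= D.
  have : y0 ^+ 2 <= y ^+ 2 by rewrite lerXn2r// nnegrE; lra.
  by have := sqr_ge0 Z; rewrite /D; lra.
have Di : D^-1 <= (y0 ^+ 2)^-1 by rewrite lef_pV2.
(* The common derivative cancels exactly; each remaining term is a step size times a factor at most
   M times a rational expression bounded on the rectangle. *)
have -> : (kerQ x (y + h2) s - kerQ x y s) / h2 - (kerP (x + h1) y s - kerP x y s) / h1 =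
   (1 + t ^+ 2) / D2 * (Z * (4 * y ^+ 2 + 2 * y * h2 - D) / D ^+ 2) * h2 -
   (1 + t ^+ 2) / D1 * (y * (4 * Z ^+ 2 + 2 * Z * h1 - D) / D ^+ 2) * h1.
  rewrite !kerQE// !kerPE// -/t.
  move: D0 D10 D20; rewrite /D /D1 /D2 /Z => D0 D10 D20.
  by field; rewrite !gt_eqF.
have D2p : 0 < D ^+ 2 by rewrite exprn_gt0.
have ZyD : `|Z| * y <= D.
  have := sqr_ge0 (`|Z| - y); rewrite sqrrB real_normK ?num_real// => h.
  rewrite -subr_ge0; have := sqr_ge0 (`|Z|); have : 0 <= `|Z| * y by apply: mulr_ge0 => //; exact: ltW.
  by rewrite /D; lra.
have b1 : `|Z * (4 * y ^+ 2 + 2 * y * h2 - D) / D ^+ 2| <= `|c1|.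
  apply: le_trans (ler_norm _).
  rewrite !normrM (gtr0_norm (x := _^-1)) ?invr_gt0//.
  apply: (@le_trans _ _ (`|Z| * y * (4 * y + 2 * h2) / D ^+ 2 + `|Z| * D / D ^+ 2)).
    rewrite -mulrDl ler_pM2r ?invr_gt0//.
    rewrite (_ : `|Z| * y * (4 * y + 2 * h2) + `|Z| * D = `|Z| * (y * (4 * y + 2 * h2) + D)); last by ring.
    apply: ler_wpM2l => //.
    apply: (le_trans (ler_normB _ _)); rewrite (gtr0_norm D0) lerD2r.
    rewrite (_ : 4 * y ^+ 2 + 2 * y * h2 = y * (4 * y + 2 * h2)); last by ring.
    by rewrite ger0_norm//; apply: mulr_ge0; [exact: ltW|lra].
  have e1 : `|Z| * y * (4 * y + 2 * h2) / D ^+ 2 <= (4 * Y + 2) / y0 ^+ 2.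
    have -> : `|Z| * y * (4 * y + 2 * h2) / D ^+ 2 = (`|Z| * y / D) * ((4 * y + 2 * h2) / D).
      by field; rewrite gt_eqF.
    apply: (@le_trans _ _ (1 * ((4 * y + 2 * h2) / D))).
      apply: ler_wpM2r; first by rewrite divr_ge0 ?ltW//; lra.
      by rewrite ler_pdivrMr// mul1r.
    rewrite mul1r; apply: ler_pM => //; rewrite ?invr_ge0 ?(ltW D0)//; lra.
  have e2 : `|Z| * D / D ^+ 2 <= y0^-1.
    have -> : `|Z| * D / D ^+ 2 = `|Z| / D by field; rewrite gt_eqF.
    rewrite ler_pdivrMr// ler_pdivlMl//; apply: le_trans ZyD.
    by rewrite mulrC ler_wpM2l.
  have <- : (4 * Y + 2) / y0 ^+ 2 + y0^-1 = c1 by rewrite /c1; ring.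
  exact: lerD e1 e2.
have b2 : `|y * (4 * Z ^+ 2 + 2 * Z * h1 - D) / D ^+ 2| <= c2.
  rewrite !normrM (gtr0_norm (x := _^-1)) ?invr_gt0// /c2 -mulrA.
  apply: ler_pM => //; first by apply: mulr_ge0 => //; rewrite invr_ge0 ltW.
    by rewrite !ger0_norm; lra.
  apply: (@le_trans _ _ ((6 * D + 1) / D ^+ 2)).
    rewrite ler_pM2r ?invr_gt0//.
    have z2 : Z ^+ 2 <= D by rewrite /D lerDl sqr_ge0.
    have zh : `|2 * Z * h1| <= Z ^+ 2 + 1.
      have := sqr_ge0 (Z - h1); have := sqr_ge0 (Z + h1); rewrite sqrrB sqrrD.
      have : h1 ^+ 2 <= 1 by rewrite expr_le1// ltW.
      by move=> ? ? ?; rewrite ler_norml; apply/andP; split; lra.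
    apply: (le_trans (ler_normB _ _)); rewrite (gtr0_norm D0).
    have z4 : `|4 * Z ^+ 2| = 4 * Z ^+ 2 by rewrite ger0_norm// mulr_ge0// sqr_ge0.
    have := ler_normD (4 * Z ^+ 2) (2 * Z * h1); rewrite z4.
    by move: zh z2; clear; clearbody D; lra.
  have -> : (6 * D + 1) / D ^+ 2 = 6 / D + D^-1 ^+ 2 by field; rewrite gt_eqF.
  apply: lerD; first by rewrite ler_wpM2l.
  by rewrite lerXn2r// nnegrE invr_ge0 ltW.
have c20 : 0 <= c2 by exact: le_trans (normr_ge0 _) b2.
apply: (le_trans (ler_normB _ _)).
have f (m c h r : R) : 0 <= m -> m <= M -> 0 < h -> `|r| <= c -> `|m * r * h| <= M * c * h.
  move=> m0' mM h0 rc; rewrite !normrM (ger0_norm m0') (gtr0_norm h0) ler_pM2r//.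
  by apply: ler_pM.
have g1 := f ((1 + t ^+ 2) / D2) _ h2 _ ltac:(by apply: divr_ge0; exact: ltW) M2 h20 b1.
have g2 := f ((1 + t ^+ 2) / D1) _ h1 _ ltac:(by apply: divr_ge0; exact: ltW) M1 h10 b2.
apply: (le_trans (lerD g1 g2)).
have : 0 <= M * `|c1| * h1 by apply: mulr_ge0; [exact: mulr_ge0|exact: ltW].
have : 0 <= M * c2 * h2 by apply: mulr_ge0; [exact: mulr_ge0|exact: ltW].
by rewrite !mulrDr !mulrDl; lra.
Qed.

Lemma cell G X Y y0 : L1 G -> 0 < y0 -> exists2 C, 0 <= C & forall x y h1 h2,
  `|x| <= X -> `|x + h1| <= X -> y0 <= y -> y + h2 <= Y -> 0 < h1 <= 1 -> 0 < h2 <= 1 ->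
  (hv G x (y + h2) - hv G x y) / h2 - (hu G (x + h1) y - hu G x y) / h1 <= C * (h1 + h2).
Proof.
move=> GL1 y00; have [C C0 hC] := cell_kernel X Y y00.
exists (C * I01 (fun s => `|G s|)); first by rewrite mulr_ge0// I01_ge0.
move=> x y h1 h2 xX xX1 yl yu h1p h2p.
have [h10 h20] : 0 < h1 /\ 0 < h2 by case/andP: h1p; case/andP: h2p.
have yp : 0 < y by exact: lt_le_trans yl.
have yp2 : 0 < y + h2 by rewrite addr_gt0.
have l1 := L1_kerQ x GL1 yp2; have l2 := L1_kerQ x GL1 yp.
have l3 := L1_kerP (x + h1) GL1 yp; have l4 := L1_kerP x GL1 yp.
have l12 := L1Z h2^-1 (L1B l1 l2); have l34 := L1Z h1^-1 (L1B l3 l4).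
have -> : (hv G x (y + h2) - hv G x y) / h2 - (hu G (x + h1) y - hu G x y) / h1 =
  I01 (fun s => h2^-1 * (kerQ x (y + h2) s * G s - kerQ x y s * G s) -
     h1^-1 * (kerP (x + h1) y s * G s - kerP x y s * G s)).
  rewrite I01B// (I01Z _ (L1B l1 l2)) (I01Z _ (L1B l3 l4)) !I01B//.
  by rewrite /hv /hu; ring.
rewrite mulrAC -I01Z; last exact: L1_norm.
apply: I01_le; [exact: L1B|exact: L1Z (L1_norm GL1)|].
move=> s /unit_itvP s01; apply: le_trans (ler_norm _) _.
have -> : h2^-1 * (kerQ x (y + h2) s * G s - kerQ x y s * G s) -
     h1^-1 * (kerP (x + h1) y s * G s - kerP x y s * G s) =
  ((kerQ x (y + h2) s - kerQ x y s) / h2 - (kerP (x + h1) y s - kerP x y s) / h1) * G s by ring.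
by rewrite normrM ler_wpM2r// hC.
Qed.

(* Discrete form of the vanishing of the contour integral of u + i v over a
   rectangle. *)
Lemma rectangle G a w y0 H q B : L1 G -> 0 < y0 -> 0 < w -> 0 < H ->
  (forall x, a <= x <= a + w -> q <= hv G x (y0 + H) - hv G x y0) ->
  (forall y, y0 <= y <= y0 + H -> hu G (a + w) y - hu G a y <= B) ->
  q / H <= B / w.
Proof.
move=> GL1 y00 w0 H0 hq hB.
have [C C0 hC] := cell (`|a| + w) (y0 + H) GL1 y00.
(* The rectangle is cut into N^2 cells, N = n + 1. The differences of [hv] telescope upwards and
   those of [hu] sideways; after division by N^2 the cell errors leave C (w + H) / N. The two side
   conditions keep the mesh at most 1. *)
suff main : forall n : nat, 1 <= n.+1%:R / w -> 1 <= n.+1%:R / H ->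
    q / H - B / w <= C * (w + H) / n.+1%:R :> R.
  rewrite -subr_le0; apply/ler_addgt0Pr => e e0; rewrite add0r.
  set K := (Num.trunc (C * (w + H) / e) + Num.trunc w + Num.trunc H)%N.
  have trn (z : R) k : (Num.trunc z <= k)%N -> z <= k.+1%:R.
    by move=> zk; apply: (le_trans (ltW (truncnS_gt z))); rewrite ler_nat ltnS.
  have K1 : w <= K.+1%:R by apply: trn; rewrite /K -addnA addnCA leq_addr.
  have K2 : H <= K.+1%:R by apply: trn; rewrite /K leq_addl.
  apply: (le_trans (main K _ _)); rewrite ?ler_pdivlMr ?mul1r//.
  rewrite ler_pdivrMr// [leRHS]mulrC -ler_pdivrMr//; apply: trn.
  by rewrite /K -addnA leq_addr.
move=> n n1 n2; set N := n.+1; have N0 : 0 < N%:R :> R by rewrite ltr0n.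
pose h1 := w / N%:R; pose h2 := H / N%:R.
have h10 : 0 < h1 by rewrite divr_gt0.
have h20 : 0 < h2 by rewrite divr_gt0.
have h11 : h1 <= 1 by rewrite ler_pdivrMr// mul1r -(mul1r w) -ler_pdivlMr.
have h21 : h2 <= 1 by rewrite ler_pdivrMr// mul1r -(mul1r H) -ler_pdivlMr.
pose xi i : R := a + i%:R * h1; pose yj j : R := y0 + j%:R * h2.
have xiS i : xi i.+1 = xi i + h1 by rewrite /xi -natr1; ring.
have yjS j : yj j.+1 = yj j + h2 by rewrite /yj -natr1; ring.
have xN : xi N = a + w by rewrite /xi /h1; field; rewrite gt_eqF.
have yN : yj N = y0 + H by rewrite /yj /h2; field; rewrite gt_eqF.
have x0 : xi 0%N = a by rewrite /xi mul0r addr0.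
have y0E : yj 0%N = y0 by rewrite /yj mul0r addr0.
have xin i : (i <= N)%N -> a <= xi i <= a + w.
  move=> iN; rewrite -xN /xi lerDl lerD2l (mulr_ge0 _ (ltW h10))//=.
  by rewrite ler_pM2r// ler_nat.
have yin j : (j <= N)%N -> y0 <= yj j <= y0 + H.
  move=> jN; rewrite -yN /yj lerDl lerD2l (mulr_ge0 _ (ltW h20))//=.
  by rewrite ler_pM2r// ler_nat.
have xabs i : (i <= N)%N -> `|xi i| <= `|a| + w.
  move=> /xin/andP[h3 h4]; have := ler_norm a; have := ler_norm (- a); rewrite normrN => h5 h6.
  by rewrite ler_norml; apply/andP; split; lra.
have sumcell : \sum_(0 <= i < N) \sum_(0 <= j < N)
    ((hv G (xi i) (yj j.+1) - hv G (xi i) (yj j)) / h2 -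
     (hu G (xi i.+1) (yj j) - hu G (xi i) (yj j)) / h1) <=
    \sum_(0 <= i < N) \sum_(0 <= j < N) C * (h1 + h2).
  rewrite !big_mkord; apply: ler_sum => i _; rewrite !big_mkord; apply: ler_sum => j _.
  rewrite xiS yjS; apply: hC; rewrite ?h10 ?h20//.
  - exact/xabs/ltnW.
  - by rewrite -xiS; exact: xabs.
  - by have /andP[] := yin j (ltnW (ltn_ord j)).
  - by rewrite -yjS; have /andP[] := yin j.+1 (ltn_ord j).
have s1 : \sum_(0 <= i < N) \sum_(0 <= j < N) (hv G (xi i) (yj j.+1) - hv G (xi i) (yj j)) / h2 =
    \sum_(0 <= i < N) (hv G (xi i) (y0 + H) - hv G (xi i) y0) / h2.
  apply: eq_bigr => i _; rewrite -mulr_suml telescope_sumr// yN y0E//.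
have s2 : \sum_(0 <= i < N) \sum_(0 <= j < N) (hu G (xi i.+1) (yj j) - hu G (xi i) (yj j)) / h1 =
    \sum_(0 <= j < N) (hu G (a + w) (yj j) - hu G a (yj j)) / h1.
  rewrite exchange_big/=; apply: eq_bigr => j _.
  by rewrite -mulr_suml (telescope_sumr (fun i => hu G (xi i) (yj j)))// xN x0.
have s3 : \sum_(0 <= i < N) q / h2 <= \sum_(0 <= i < N) (hv G (xi i) (y0 + H) - hv G (xi i) y0) / h2.
  rewrite !big_mkord; apply: ler_sum => i _; rewrite ler_pM2r ?invr_gt0//.
  by apply: hq; exact/xin/ltnW.
have s4 : \sum_(0 <= j < N) (hu G (a + w) (yj j) - hu G a (yj j)) / h1 <= \sum_(0 <= j < N) B / h1.
  rewrite !big_mkord; apply: ler_sum => j _; rewrite ler_pM2r ?invr_gt0//.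
  by apply: hB; exact/yin/ltnW.
move: sumcell.
under eq_bigr do rewrite sumrB.
rewrite sumrB s1 s2 => s5.
have s6 : \sum_(0 <= i < N) q / h2 - \sum_(0 <= j < N) B / h1 <=
   \sum_(0 <= i < N) \sum_(0 <= j < N) C * (h1 + h2) by lra.
have sc (z : R) : \sum_(0 <= i < N) z = N%:R * z.
  by rewrite sumr_const_nat subn0 mulr_natl.
move: s6; rewrite !sc.
have -> : N%:R * (q / h2) - N%:R * (B / h1) = N%:R ^+ 2 * (q / H - B / w).
  by rewrite /h1 /h2; field; rewrite !gt_eqF.
have -> : N%:R * (N%:R * (C * (h1 + h2))) = N%:R ^+ 2 * (C * (w + H) / N%:R).
  by rewrite /h1 /h2; field; rewrite !gt_eqF.
by rewrite ler_pM2l// exprn_gt0.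
Qed.

End discrete_cauchy_riemann.

(** * One-sided oscillation of the envelope *)

Section envelope_oscillation.
Context {R : realType}.
Implicit Types (G : R -> R) (x y s u c C : R).

(** A Dini-type argument. If the envelope were below C on the whole segment, each x would have a
    height with [hv] < C; this holds at all smaller heights by monotonicity and near x by
    continuity, so compactness gives one small height violating the hypothesis. *)
Lemma hW_compact G a b C r : increasing01 G -> L1 G -> 0 < r ->
  (forall y, 0 < y < r -> exists2 x, a <= x <= b & C <= hv G x y) ->
  exists2 x, a <= x <= b & (C%:E <= hW G x)%E.
Proof.
move=> Gi GL1 r0 hr; apply: contrapT => hno.
have hlt x : a <= x <= b -> exists2 y, 0 < y & hv G x y < C.
  move=> xab; apply: hW_lt; rewrite ltNge; apply/negP => h.
  by apply: hno; exists x.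
have cK := (@compact_near_coveringP _ `[a, b]%classic).1 (@segment_compact R a b).
have := cK R (0^'+) (fun y x => hv G x y < C) _.
case.
  move=> x /=; rewrite in_itv/= => xab; have [y0 y00 hy0] := hlt x xab.
  have q0 : 0 < C - hv G x y0 by rewrite subr_gt0.
  have [d d0 hd] := huv_cont x GL1 y00 q0.
  exists (ball x d, [set y | 0 < y <= y0]).
    split; first exact: nbhsx_ballx.
    exists y0 => // z /=; rewrite sub0r normrN => h1 h2.
    by rewrite h2/= ltW// (le_lt_trans (ler_norm _) h1).
  move=> [x' y'] /= [xx' /andP[y'0 yy']].
  have [_] := hd x' y0 xx' ltac:(by rewrite subrr normr0) y00.
  rewrite ltr_norml => /andP[h1 _].
  by apply: le_lt_trans (hv_mono Gi GL1 x' y'0 yy') _; lra.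
move=> d /= d0 hd.
pose y := Num.min (d / 2) (r / 2).
have y0 : 0 < y by rewrite lt_min !divr_gt0.
have yr : y < r by have : y <= r / 2 by [rewrite ge_min lexx orbT|]; lra.
have yd : y < d by have : y <= d / 2 by [rewrite ge_min lexx|]; lra.
have [x xab hx] := hr y ltac:(by rewrite y0).
have /hd : `|0 - y| < d by rewrite sub0r normrN gtr0_norm.
by move=> /(_ y0 x); rewrite /= in_itv/= => /(_ xab); rewrite ltNge hx.
Qed.

Section right_limits.
Variable G : R -> R.
Hypotheses (Gi : increasing01 G) (GL1 : L1 G).

(** Contrapositive of [hW_gap]: a jump of G on one side of u would make [G u + e] or [G u - e] a
    second cut level. *)
Lemma hW_fin_cont u w e : 0 < u < 1 -> hW G (tpar u) = w%:E -> 0 < e ->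
  (exists2 s, u < s < 1 & G s < G u + e) /\ (exists2 s, 0 < s < u & G u - e < G s).
Proof.
move=> u01 hw e0; have /andP[u0 u1] := u01.
have uu := cut_self Gi u01.
split; apply: contrapT => h.
  suff : hW G (tpar u) = -oo%E by rewrite hw.
  apply: (hW_gap Gi GL1 u01 uu (c' := G u + e)); last by rewrite ltrDl.
  move=> s s01; have [h1 h2] := uu s s01; split => su; first by have := h1 su; lra.
  rewrite leNgt; apply/negP => h3; apply: h; exists s => //.
  by rewrite su; case/andP: s01.
suff : hW G (tpar u) = -oo%E by rewrite hw.
apply: (hW_gap Gi GL1 u01 (c := G u - e) _ uu); last by rewrite gtrBl.
move=> s s01; have [h1 h2] := uu s s01; split => su; last by have := h2 su; lra.
rewrite leNgt; apply/negP => h3; apply: h; exists s => //.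
by rewrite su andbT; case/andP: s01.
Qed.

(** A finite envelope makes G continuous at u; [hu_le] and [hu_ge], applied at parameters on either
    side of u where G is within e / 2 of [G u], squeeze [hu]. *)
Lemma hu_near u w e : 0 < u < 1 -> hW G (tpar u) = w%:E -> 0 < e ->
  exists2 r, 0 < r & forall x y, `|x - tpar u| <= r -> 0 < y <= r -> `|hu G x y - G u| <= e.
Proof.
move=> u01 hw e0; have e2 : 0 < e / 2 by rewrite divr_gt0.
have [[s1 /andP[us1 s11] g1] [s2 /andP[s20 s2u] g2]] := hW_fin_cont u01 hw e2.
have /andP[u0 u1] := u01; set t0 := tpar u.
have t1 : t0 < tpar s1 by exact: tpar_lt.
have t2 : tpar s2 < t0 by exact: tpar_lt.
have s101 : 0 < s1 < 1 by rewrite s11 (lt_trans u0).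
have s201 : 0 < s2 < 1 by rewrite s20 (lt_trans s2u).
pose d1 := (tpar s1 - t0) / 2; pose d2 := (t0 - tpar s2) / 2.
have d10 : 0 < d1 by rewrite divr_gt0// subr_gt0.
have d20 : 0 < d2 by rewrite divr_gt0// subr_gt0.
have [C1 hC1] := hu_le Gi GL1 (`|t0| + 1) s101 d10.
have [C2 hC2] := hu_ge Gi GL1 (`|t0| + 1) s201 d20.
pose e1 := (e / 2) / (`|C1| + 1); pose e3 := (e / 2) / (`|C2| + 1).
have e10 : 0 < e1 by rewrite divr_gt0// ltr_wpDl.
have e30 : 0 < e3 by rewrite divr_gt0// ltr_wpDl.
pose r := Num.min 1 (Num.min (Num.min d1 d2) (Num.min e1 e3)).
have r0 : 0 < r by rewrite !lt_min ltr01 d10 d20 e10 e30.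
have [r1 rd1 rd2 re1 re3] : [/\ r <= 1, r <= d1, r <= d2, r <= e1 & r <= e3].
  by split; rewrite /r !ge_min lexx ?orbT.
exists r => // x y xr /andP[y0 yr].
have cb C e' : e' = (e / 2) / (`|C| + 1) -> y <= e' -> C * y <= e / 2.
  move=> -> ye; apply: (@le_trans _ _ (`|C| * y)).
    by rewrite ler_wpM2r ?ler_norm// ltW.
  apply: (@le_trans _ _ (`|C| * ((e / 2) / (`|C| + 1)))); first by rewrite ler_wpM2l.
  by rewrite mulrCA ger_pMr// ler_pdivrMr ?mul1r ?lerDl// ltr_wpDl.
have b1 := cb C1 e1 erefl (le_trans yr re1); have b3 := cb C2 e3 erefl (le_trans yr re3).
have xX : `|x| <= `|t0| + 1.
  by have := ler_normD (x - t0) t0; rewrite subrK; lra.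
move: xr; rewrite ler_norml => /andP[x1 x2].
have xd1 : x <= tpar s1 - d1 by rewrite /d1 in rd1 *; lra.
have xd2 : tpar s2 + d2 <= x by rewrite /d2 in rd2 *; lra.
have := hC1 x y xd1 xX y0; have := hC2 x y xd2 xX y0.
by move=> h1 h2; rewrite ler_norml; apply/andP; split; lra.
Qed.

(* On the squares [t0 + r, t0 + 2 r] x [y, y + r] hu is nearly constant and, by [hW_lt_hv],
   hv is almost w on the top side; so [rectangle] keeps hv from being below w - e all
   along the bottom side, however small y is. *)
Lemma hW_right u w e d : 0 < u < 1 -> hW G (tpar u) = w%:E -> 0 < e -> 0 < d ->
  exists s, [/\ u < s, s < u + d, s < 1 & ((w - e)%:E <= hW G (tpar s))%E].
Proof.
move=> u01 hw e0 d0; have /andP[u0 u1] := u01; set t0 := tpar u in hw.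
(* The slope (x - t0) / (y0 + r) is at most 2, so the top side loses at most 2 e / 5 and [hv] would
   rise by at least 3 e / 5, while [hu] varies by at most 2 e / 5 across the square. *)
have e5 : 0 < e / 5 by rewrite divr_gt0.
have [r1 r10 hr1] := hu_near u01 hw e5.
pose u' := Num.min (u + d) ((u + 1) / 2).
have uu' : u < u' by rewrite lt_min ltrDl d0/=; lra.
have u'1 : u' < 1 by have : u' <= (u + 1) / 2 by [rewrite ge_min lexx orbT|]; lra.
have u'd : u' <= u + d by rewrite ge_min lexx.
have tt' : t0 < tpar u' by exact: tpar_lt.
pose r := Num.min (r1 / 2) ((tpar u' - t0) / 4).
have r0 : 0 < r by rewrite lt_min !divr_gt0// subr_gt0.
have rr1 : 2 * r <= r1 by have : r <= r1 / 2 by [rewrite ge_min lexx|]; lra.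
have rt : 2 * r < tpar u' - t0.
  have : r <= (tpar u' - t0) / 4 by rewrite ge_min lexx orbT.
  lra.
have [x /andP[x1 x2] hx] : exists2 x, t0 + r <= x <= t0 + 2 * r & ((w - e)%:E <= hW G x)%E.
  apply: (hW_compact Gi GL1 r0) => y0 /andP[y00 y0r]; apply: contrapT => hno.
  have hlt x : t0 + r <= x <= t0 + 2 * r -> hv G x y0 < w - e.
    by move=> hx; rewrite ltNge; apply/negP => h; apply: hno; exists x.
  have top x : t0 + r <= x <= t0 + 2 * r -> w - 2 * (e / 5) <= hv G x (y0 + r).
    move=> /andP[xl xu]; have y1 : 0 < y0 + r by rewrite addr_gt0.
    have := hW_lt_hv Gi GL1 u01 (cut_self Gi u01) x y1; rewrite -/t0 hw lte_fin.
    have k1 : (x - t0) / (y0 + r) <= 2 by rewrite ler_pdivrMr//; lra.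
    have k0 : 0 <= (x - t0) / (y0 + r) by apply: divr_ge0; lra.
    have hn : `|hu G x (y0 + r) - G u| <= e / 5.
      apply: hr1; last by rewrite y1/=; lra.
      by rewrite -/t0 ger0_norm; lra.
    have : (x - t0) / (y0 + r) * (hu G x (y0 + r) - G u) <= 2 * (e / 5).
      apply: (le_trans (ler_norm _)); rewrite normrM (ger0_norm k0).
      by apply: ler_pM.
    lra.
  have := @rectangle R G (t0 + r) r y0 r (3 * (e / 5)) (2 * (e / 5)) GL1 y00 r0 r0.
  rewrite (_ : t0 + r + r = t0 + 2 * r); last by ring.
  have h1 x : t0 + r <= x <= t0 + 2 * r -> 3 * (e / 5) <= hv G x (y0 + r) - hv G x y0.
    by move=> hx; have := hlt x hx; have := top x hx; lra.
  have h2 y : y0 <= y <= y0 + r -> hu G (t0 + 2 * r) y - hu G (t0 + r) y <= 2 * (e / 5).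
    move=> /andP[yl yu].
    have yy : 0 < y <= r1 by apply/andP; split; lra.
    have n1 : `|t0 + 2 * r - t0| <= r1 by rewrite addrC addKr gtr0_norm; lra.
    have n2 : `|t0 + r - t0| <= r1 by rewrite addrC addKr gtr0_norm; lra.
    have := hr1 _ y n1 yy; have := hr1 _ y n2 yy.
    by rewrite !ler_norml => /andP[? ?] /andP[? ?]; lra.
  move=> /(_ h1 h2); rewrite ler_pM2r ?invr_gt0//; lra.
have /andP[i0 i1] := tinv_itv x.
have ux : u < tinv x by rewrite -(tparK u01); apply: tinv_lt; rewrite -/t0; lra.
have xu' : tinv x < u'.
  have u'01 : 0 < u' < 1 by rewrite u'1 (lt_trans u0).
  by rewrite -(tparK u'01); apply: tinv_lt; lra.
by exists (tinv x); rewrite tinvK; split => //; exact: lt_le_trans u'd.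
Qed.

(** A Harnack-type comparison. Parameters up to 1/2 contribute at most [G 2^-1 - m], the mass being
    1. For the others t = [tpar s] is nonnegative, and (2 L + t)^2 + y2^2 <= 5 (L + t)^2 compares
    the two kernels. *)
Lemma hu_harnack m L y1 y2 : (forall s, 0 < s < 1 -> m <= G s) -> 1 <= L ->
  0 < y1 -> y1 <= y2 -> y2 <= L ->
  hu G (- L) y1 - m <= G 2^-1 - m + 5 * (hu G (- (2 * L)) y2 - m).
Proof.
move=> Gm L1' y10 y12 y2L; have y20 : 0 < y2 by exact: lt_le_trans y12.
have h01 : 0 < (2^-1 : R) < 1 by apply/andP; split; lra.
set c := G 2^-1; have c0 : 0 <= c - m by rewrite subr_ge0 Gm.
have l1 := L1_kerP (- L) (L1_subc m GL1) y10.
have l2 := L1_kerP (- (2 * L)) (L1_subc m GL1) y20.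
have l3 := L1_kerP (- L) (L1_cst (1 : R)) y10.
rewrite (hu_subc m _ GL1 y10) (hu_subc m _ GL1 y20).
have e1 : I01 (fun s => kerP (- L) y1 s * 1) = 1.
  by rewrite -[RHS](I01_kerP (- L) y10); apply: I01_eq => s _; rewrite mulr1.
have -> : c - m + 5 * I01 (fun s => kerP (- (2 * L)) y2 s * (G s - m)) =
    I01 (fun s => (c - m) * (kerP (- L) y1 s * 1) + 5 * (kerP (- (2 * L)) y2 s * (G s - m))).
  by rewrite I01D ?(I01Z _ l3) ?(I01Z _ l2) ?e1 ?mulr1//; exact: L1Z.
apply: I01_le => //; first by apply: L1D; exact: L1Z.
move=> s /unit_itvP s01; have /andP[s0 s1] := s01.
have p1 := kerP_gt0 (- L) s y10; have p2 := kerP_gt0 (- (2 * L)) s y20.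
have Gs := Gm s s01.
have [sh|hs] := leP s 2^-1.
  have Gc : G s <= c.
    by move: sh; rewrite le_eqVlt => /predU1P[->//|sh]; apply/ltW/Gi => //; lra.
  apply: (@le_trans _ _ ((c - m) * (kerP (- L) y1 s * 1))).
    by rewrite mulr1 mulrC; apply: ler_wpM2r; [exact: ltW|lra].
  by rewrite lerDl; apply: mulr_ge0 => //; apply: mulr_ge0; [exact: ltW|lra].
have t0 : 0 <= tpar s.
  have t2 : tpar (2^-1 : R) = 0.
    by rewrite /tpar /cspi [pi * _]mulrC [_ * pi]mulrC cos_pihalf mul0r oppr0.
  by rewrite -t2; apply: tpar_le => //; lra.
apply: (@le_trans _ _ (5 * (kerP (- (2 * L)) y2 s * (G s - m)))); last first.
  by rewrite lerDr; apply: mulr_ge0 => //; rewrite mulr1 ltW.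
rewrite mulrA; apply: ler_wpM2r; first lra.
rewrite !kerPE// [leRHS]mulrCA; apply: ler_wpM2l; first exact/ltW/onesqr_gt0.
have d1 := dist_gt0 (- L) s y10; have d2 := dist_gt0 (- (2 * L)) s y20.
set t := tpar s in t0 d1 d2 *.
have k : (- (2 * L) - t) ^+ 2 + y2 ^+ 2 <= 5 * (- L - t) ^+ 2.
  have a1 : y2 ^+ 2 <= L ^+ 2 by rewrite lerXn2r// nnegrE; lra.
  have a2 : 0 <= L * t by apply: mulr_ge0 => //; lra.
  have a3 := sqr_ge0 t; rewrite -subr_ge0.
  rewrite (_ : _ - _ = 5 * (L ^+ 2 + 2 * (L * t) + t ^+ 2) - (4 * L ^+ 2 + 4 * (L * t) + t ^+ 2) - y2 ^+ 2); last by ring.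
  lra.
rewrite ler_pdivrMr// [leRHS](_ : _ = 5 * y2 * ((- L - t) ^+ 2 + y1 ^+ 2) /
  ((- (2 * L) - t) ^+ 2 + y2 ^+ 2)); last by ring.
rewrite ler_pdivlMr//.
apply: (@le_trans _ _ (y2 * (5 * (- L - t) ^+ 2))).
  by apply: ler_pM => //; exact: ltW.
rewrite (_ : 5 * y2 * _ = y2 * (5 * ((- L - t) ^+ 2 + y1 ^+ 2))); last by ring.
by apply: ler_wpM2l; [exact: ltW|rewrite ler_pM2l// lerDl sqr_ge0].
Qed.

(** Near parameter 0 the boundary point goes to minus infinity, so the rectangle argument is run on
    [-2 L, -L] at scale L. [growth] makes [hv] large on the top side and [hu_harnack] controls the
    variation of [hu] between the vertical sides. *)
Lemma hW_zero m B d : (forall s, 0 < s < 1 -> m <= G s) -> 0 < d ->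
  exists s, [/\ 0 < s, s < d, s < 1 & (B%:E <= hW G (tpar s))%E].
Proof.
move=> Gm d0; have h01 : 0 < (2^-1 : R) < 1 by apply/andP; split; lra.
set c := G 2^-1; have c0 : 0 <= c - m by rewrite subr_ge0 Gm.
(* On the top side x / y1 lies between -8 and -2, which costs at most 8 (c - m). The remaining 4 (c
   - m) + 1 exceeds what the Harnack bound can absorb. *)
have [r0 r00 hr0] := growth Gi GL1 (B + 12 * (c - m) + 1) h01 (cut_self Gi h01).
pose d' := Num.min (d / 2) 2^-1.
have d'01 : 0 < d' < 1.
  by rewrite lt_min divr_gt0//= invr_gt0 ltr0n/=; have : d' <= 2^-1 by [rewrite ge_min lexx orbT|]; lra.
have d'd : d' < d by have : d' <= d / 2 by [rewrite ge_min lexx|]; lra.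
pose L := 1 + r0 + `|tpar d'|.
have nt := normr_ge0 (tpar d').
have L1' : 1 <= L by rewrite /L; lra.
have [x /andP[x1 x2] hx] : exists2 x, - (2 * L) <= x <= - L & (B%:E <= hW G x)%E.
  have L4 : 0 < L / 4 by lra.
  apply: (hW_compact Gi GL1 L4) => y0 /andP[y00 y0r]; apply: contrapT => hno.
  have hlt x : - (2 * L) <= x <= - L -> hv G x y0 < B.
    by move=> hx; rewrite ltNge; apply/negP => h; apply: hno; exists x.
  set y1 := y0 + L / 4; have y10 : 0 < y1 by rewrite addr_gt0.
  have y1u : y1 <= L / 2 by rewrite /y1; lra.
  have y1l : L / 4 <= y1 by rewrite /y1; lra.
  set h2 := hu G (- (2 * L)) y1.
  have hge x y : 0 < y -> m <= hu G x y.
    move=> yp; have [s s01 hs] := hu_gt_some Gi GL1 x yp.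
    exact: le_trans (Gm s s01) (ltW hs).
  have h2m : m <= h2 by exact: hge.
  (* The term 2 (h2 - c) has to be kept: h2 has no a priori upper bound, but it recurs in the
     Harnack bound, where after division by 4 its coefficient is 5/4, smaller than 2. *)
  have top x : - (2 * L) <= x <= - L ->
      B + 12 * (c - m) + 1 - 8 * (c - m) + 2 * (h2 - c) <= hv G x y1.
    move=> /andP[xl xu].
    have xx : r0 ^+ 2 <= x ^+ 2 + y1 ^+ 2.
      have : r0 ^+ 2 <= x ^+ 2.
        have xL : r0 <= - x by rewrite /L in xu; lra.
        by rewrite -(sqrrN x) lerXn2r// nnegrE; lra.
      by have := sqr_ge0 y1; lra.
    have := hr0 x y1 y10 xx; rewrite -/c.
    set k := x / y1; set h := hu G x y1 - c.
    have hm : m - c <= h by rewrite /h lerD2r hge.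
    have hh : h2 - c <= h by rewrite /h lerD2r hu_mono.
    have k1 : k <= -2 by rewrite ler_pdivrMr//; lra.
    have k2 : -8 <= k by rewrite ler_pdivlMr//; lra.
    move=> h3; have : k * h <= 8 * (c - m) - 2 * (h2 - c); last lra.
    have [hp|hn] := leP 0 h.
      have : k * h <= -2 * h by apply: ler_wpM2r.
      lra.
    have : (- k) * (- h) <= 8 * (c - m) by apply: ler_pM; lra.
    rewrite mulrNN; lra.
  have := @rectangle R G (- (2 * L)) L y0 (L / 4) (12 * (c - m) + 1 - 8 * (c - m) + 2 * (h2 - c))
     (c - m + 5 * (h2 - m)) GL1 y00 ltac:(lra) L4.
  rewrite (_ : - (2 * L) + L = - L); last by ring.
  have g1 x : - (2 * L) <= x <= - L ->
      12 * (c - m) + 1 - 8 * (c - m) + 2 * (h2 - c) <= hv G x (y0 + L / 4) - hv G x y0.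
    by move=> hx; have := hlt x hx; have := top x hx; rewrite -/y1; lra.
  have g2 y : y0 <= y <= y0 + L / 4 ->
      hu G (- L) y - hu G (- (2 * L)) y <= c - m + 5 * (h2 - m).
    rewrite -/y1 => /andP[yl yu]; have yp : 0 < y by lra.
    have := hu_harnack Gm L1' yp yu ltac:(lra); rewrite -/c -/h2.
    by have := hge (- (2 * L)) y yp; lra.
  move=> /(_ g1 g2).
  have Lp : 0 < L by lra.
  rewrite ler_pdivrMr// [leRHS](_ : _ = (c - m + 5 * (h2 - m)) / 4); last first.
    by field; rewrite gt_eqF.
  lra.
have /andP[i0 i1] := tinv_itv x.
have xd : tinv x < d'.
  rewrite -(tparK d'01); apply: tinv_lt.
  have := ler_norm (- tpar d'); rewrite normrN => h.
  by rewrite /L in x2; lra.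
by exists (tinv x); rewrite tinvK; split => //; exact: lt_trans d'd.
Qed.

End right_limits.

Section left_limits.
Variable G : R -> R.
Hypotheses (Gi : increasing01 G) (GL1 : L1 G).
Let Gmi := mirror_incr Gi.
Let GmL1 := mirror_L1 GL1.

Lemma hW_left u w e d : 0 < u < 1 -> hW G (tpar u) = w%:E -> 0 < e -> 0 < d ->
  exists s, [/\ u - d < s, s < u, 0 < s & ((w - e)%:E <= hW G (tpar s))%E].
Proof.
move=> u01 hw e0 d0.
have hw' : hW (mirror G) (tpar (1 - u)) = w%:E by rewrite hW_mirror// tpar_mirror opprK.
have [s [h1 h2 h3 h4]] := hW_right Gmi GmL1 (onem_unit_itv u01) hw' e0 d0.
exists (1 - s); split; [lra|lra|lra|].
by rewrite tpar_mirror -hW_mirror.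
Qed.

Lemma hW_one m B d : (forall s, 0 < s < 1 -> G s <= m) -> 0 < d ->
  exists s, [/\ 1 - d < s, s < 1, 0 < s & (B%:E <= hW G (tpar s))%E].
Proof.
move=> Gm d0.
have Gm' s : 0 < s < 1 -> - m <= mirror G s.
  by move=> s01; rewrite /mirror lerN2 Gm// onem_unit_itv.
have [s [h1 h2 h3 h4]] := hW_zero Gmi GmL1 B Gm' d0.
exists (1 - s); split; [lra|lra|lra|].
by rewrite tpar_mirror -hW_mirror.
Qed.

End left_limits.

End envelope_oscillation.

(** * The principal value is the envelope *)

Section principal_value.
Context {R : realType}.
Local Notation leb := (@lebesgue_measure R).
Implicit Types (G f : R -> R) (s u c a b e : R).

Definition periodize G u : R := G (u - (Num.floor u)%:~R).

Lemma periodizeE G s : 0 < s < 1 -> periodize G s = G s.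
Proof.
move=> /andP[s0 s1]; rewrite /periodize (_ : Num.floor s = 0) ?subr0//.
by apply/eqP; rewrite floor_eq// ltW//= add0r.
Qed.

Lemma periodizeD1 G s : periodize G (s + 1) = periodize G s.
Proof.
rewrite /periodize (_ : Num.floor (s + 1) = Num.floor s + 1); last by rewrite floorDrz// floor1.
by rewrite intrD; congr G; ring.
Qed.

Section periodic_integral.
Variable f : R -> R.
Hypotheses (f1 : forall s, f (s + 1) = f s) (fL : leb.-integrable `[0, 1[ (EFin \o f)).

Let preimage_shift a b (r : R) : (fun x : R => 1 * x + r) @^-1` `[a, b[ = `[a - r, b - r[%classic.
Proof.
apply/seteqP; split => x /=; rewrite !in_itv/= mul1r => /andP[h1 h2];
by apply/andP; split; lra.
Qed.

Let shiftP a b : leb.-integrable `[a, b[ (EFin \o f) ->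
  leb.-integrable `[a - 1, b - 1[ (EFin \o f) /\
  \int[leb]_(s in `[a - 1, b - 1[) f s = \int[leb]_(s in `[a, b[) f s.
Proof.
move=> h; have := integrable_affine 1 (oner_neq0 R) (measurable_itv _) h.
have := Rintegral_affine 1 (oner_neq0 R) (measurable_itv _) h.
rewrite preimage_shift normr1 mul1r => e i; split.
  by apply: eq_integrable i => // x _ /=; rewrite mul1r f1.
by rewrite e; apply: eq_Rintegral => x _; rewrite mul1r f1.
Qed.

Let shiftN a b : leb.-integrable `[a, b[ (EFin \o f) ->
  leb.-integrable `[a + 1, b + 1[ (EFin \o f) /\
  \int[leb]_(s in `[a + 1, b + 1[) f s = \int[leb]_(s in `[a, b[) f s.
Proof.
move=> h; have := integrable_affine (-1) (oner_neq0 R) (measurable_itv _) h.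
have := Rintegral_affine (-1) (oner_neq0 R) (measurable_itv _) h.
have fm x : f (1 * x + -1) = f x by rewrite -f1; congr f; ring.
rewrite preimage_shift normr1 mul1r !opprK => e i; split.
  by apply: eq_integrable i => // x _ /=; rewrite fm.
by rewrite e; apply: eq_Rintegral => x _; rewrite fm.
Qed.

Let chasles a b c : a <= b -> b <= c -> leb.-integrable `[a, b[ (EFin \o f) ->
  leb.-integrable `[b, c[ (EFin \o f) ->
  leb.-integrable `[a, c[ (EFin \o f) /\
  \int[leb]_(s in `[a, c[) f s = \int[leb]_(s in `[a, b[) f s + \int[leb]_(s in `[b, c[) f s.
Proof.
move=> ab bc h1 h2.
have e : `[a, c[%classic = `[a, b[%classic `|` `[b, c[%classic.
  by rewrite -itv_bndbnd_setU// bnd_simp.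
have h : leb.-integrable (`[a, b[%classic `|` `[b, c[%classic) (EFin \o f).
  move/integrableP : h1 => [m1 i1]; move/integrableP : h2 => [m2 i2].
  have m12 : measurable_fun (`[a, b[%classic `|` `[b, c[%classic) (EFin \o f).
    by apply/measurable_funU.
  apply/integrableP; split => //; rewrite ge0_integral_setU//; first exact: lte_add_pinfty.
    by apply: measurableT_comp m12.
  apply/disj_setPS => x [/=]; rewrite !in_itv/= => /andP[_ h3] /andP[h4 _].
  by move: h3; rewrite ltNge h4.
rewrite e; split => //; rewrite Rintegral_setU//.
apply/disj_setPS => x [/=]; rewrite !in_itv/= => /andP[_ h3] /andP[h4 _].
by move: h3; rewrite ltNge h4.
Qed.

Let subitv a b c d : a <= b -> d <= c -> leb.-integrable `[a, c[ (EFin \o f) ->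
  leb.-integrable `[b, d[ (EFin \o f).
Proof.
move=> ab dc; apply: integrableS => // x /=; rewrite !in_itv/= => /andP[h1 h2].
by rewrite (le_trans ab h1) (lt_le_trans h2 dc).
Qed.

Lemma periodic_integral a : -1 < a < 1 ->
  leb.-integrable `[a, a + 1[ (EFin \o f) /\
  \int[leb]_(s in `[a, a + 1[) f s = \int[leb]_(s in `[0, 1[) f s.
Proof.
move=> /andP[al au]; have [a0|a0] := leP a 0.
  have a1 : 0 <= a + 1 by lra.
  have a2 : a + 1 <= 1 by lra.
  have i1 : leb.-integrable `[0, a + 1[ (EFin \o f) by apply: subitv fL.
  have i2 : leb.-integrable `[a + 1, 1[ (EFin \o f) by apply: subitv fL.
  have [i3 e3] := shiftP i2; rewrite addrK subrr in i3 e3.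
  have [i4 e4] := chasles a0 a1 i3 i1.
  have [_ e5] := chasles a1 a2 i1 i2.
  by split => //; rewrite e4 e3 e5 addrC.
have i1 : leb.-integrable `[0, a[ (EFin \o f) by apply: subitv fL => //; exact: ltW.
have i2 : leb.-integrable `[a, 1[ (EFin \o f) by apply: subitv fL => //; exact: ltW.
have a1 : 1 <= a + 1 by lra.
have [i3 e3] := shiftN i1; rewrite add0r in i3 e3.
have [i4 e4] := chasles (ltW au) a1 i2 i3.
have [_ e5] := chasles (ltW a0) (ltW au) i1 i2.
by split => //; rewrite e4 e3 e5 addrC.
Qed.

End periodic_integral.

(** Indicator of the parameters at circle distance at least e from u, for e below 1/2. Comparing
    sines makes it 1-periodic in s without any wrap-around cases. *)
Definition far u e s : R := if `|sin (pi * e)| <= `|snpi (u - s)| then 1 else 0.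

Definition cotk u e s : R := far u e s * cot (pi * (u - s)).

Lemma mfun_snpi_sub u : measurable_fun [set: R] (fun s => snpi (u - s)).
Proof. by apply: (measurableT_comp mfun_snpi); exact: measurable_funB. Qed.

Lemma mfun_far u e : measurable_fun [set: R] (far u e).
Proof.
have mb : measurable_fun [set: R] (fun s => `|sin (pi * e)| <= `|snpi (u - s)|).
  apply: measurable_fun_ler => //; apply: measurableT_comp => //.
  exact: mfun_snpi_sub.
by apply: measurable_fun_ifT.
Qed.

Lemma mfun_cotk u e : measurable_fun [set: R] (cotk u e).
Proof.
apply: measurable_funM; first exact: mfun_far.
apply: measurable_funM; last by apply: mfun_inv; exact: mfun_snpi_sub.
by apply: (measurableT_comp mfun_cspi); exact: measurable_funB.
Qed.

Lemma far_le1 u e s : `|far u e s| <= 1.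
Proof. by rewrite /far; case: ifP => _; rewrite ?normr1 ?normr0 ?ler01. Qed.

Lemma cotk_bound u e s : 0 < e < 1 -> `|cotk u e s| <= (sin (pi * e))^-1.
Proof.
move=> /snpi_gt0 e0; rewrite /cotk /far; case: ifP => [h|_]; last first.
  by rewrite mul0r normr0 invr_ge0 ltW.
rewrite mul1r /cot normrM normfV -[leRHS]mul1r; apply: ler_pM => //; first exact: cos_max.
rewrite lef_pV2 ?posrE//; last by apply: lt_le_trans h; rewrite normr_gt0 gt_eqF.
by move: h; rewrite gtr0_norm.
Qed.

Lemma cotkD1 u e s : cotk u e (s + 1) = cotk u e s.
Proof.
have e1 : pi * (u - (s + 1)) = pi * (u - s) - pi by ring.
have ss : sin (pi * (u - s) - pi) = - sin (pi * (u - s)).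
  by rewrite sinB cospi sinpi mulr0 subr0 mulrN1.
have cc : cos (pi * (u - s) - pi) = - cos (pi * (u - s)).
  by rewrite cosB cospi sinpi mulr0 addr0 mulrN1.
by rewrite /cotk /far /cot /snpi e1 ss cc normrN invrN mulrNN.
Qed.

Lemma sin_pi_le (x y : R) : 0 <= x -> x <= 2^-1 -> 0 <= y -> y <= 2^-1 ->
  (sin (pi * x) <= sin (pi * y)) = (x <= y).
Proof.
have p0 := pi_gt0 R.
have itv (z : R) : 0 <= z -> z <= 2^-1 -> pi * z \in `[(- (pi / 2)), (pi / 2)].
  move=> z0 z1; rewrite in_itv/= ler_pM2l// z1 andbT.
  by apply: (@le_trans _ _ 0); [lra|apply: mulr_ge0 => //; exact: ltW].
move=> x0 x1 y0 y1; rewrite !leNgt; congr (~~ _).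
by rewrite ltr_sin ?itv// ltr_pM2l.
Qed.

(** The substitution s = u - t carries the symmetric window onto one full period around u, and
    periodicity moves that period to the unit interval. The window is half-open so that its image is
    again a half-open interval. *)
Lemma recenter G u e : L1 G -> 0 < u < 1 -> 0 < e < 1 ->
  leb.-integrable `]- 2^-1, 2^-1] (EFin \o (fun t => cotk u e (u - t) * periodize G (u - t))) /\
  \int[leb]_(t in `]- 2^-1, 2^-1]) (cotk u e (u - t) * periodize G (u - t)) =
    I01 (fun s => cotk u e s * G s).
Proof.
move=> GL1 u01 /andP[e0 e1]; have /andP[u0 u1] := u01.
pose f s := cotk u e s * periodize G s.
have f1 s : f (s + 1) = f s by rewrite /f cotkD1 periodizeD1.
have cL : L1 (fun s => cotk u e s * G s).
  apply: (@L1M _ _ _ (sin (pi * e))^-1) GL1.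
    by apply: measurable_funTS; exact: mfun_cotk.
  by move=> s _; apply: cotk_bound; rewrite e0.
have fI : L1 f by apply: (L1_eq _ cL) => s /unit_itvP s01; rewrite /f periodizeE.
have fL : leb.-integrable `[0, 1[ (EFin \o f).
  move/integrableP : (fI) => [mf hf]; apply/integrableP; split.
    by apply/(emeasurable_fun_itv_obnd_cbndP 0 (BLeft 1)).
  have mn : measurable_fun unit_itv (fun s => `|(EFin \o f) s|%E) by exact: measurableT_comp.
  by rewrite (integral_itv_bndoo true true mn).
have ea : -1 < u - 2^-1 < 1 by apply/andP; split; lra.
have [iL iE] := periodic_integral f1 fL ea.
have e01 : I01 (fun s => cotk u e s * G s) = \int[leb]_(s in `[0, 1[) f s.
  rewrite (@I01_eq _ _ f); last by move=> s /unit_itvP s01; rewrite /f periodizeE.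
  by rewrite /I01 Rintegral_itv_obnd_cbnd.
have -> : (fun t => cotk u e (u - t) * periodize G (u - t)) = (fun t => f (-1 * t + u)).
  by apply/funext => t; rewrite mulN1r (addrC (- t)).
have N0 : -1 != 0 :> R by rewrite lt_eqF//; lra.
have pre : (fun x : R => -1 * x + u) @^-1` `[u - 2^-1, u - 2^-1 + 1[ = `]- 2^-1, 2^-1]%classic.
  by apply/seteqP; split => x /=; rewrite !in_itv/= => /andP[h1 h2]; apply/andP; split; lra.
split; first by have := integrable_affine u N0 (measurable_itv _) iL; rewrite pre.
by rewrite e01 -iE (Rintegral_affine u N0 (measurable_itv _) iL) normrN1 mul1r pre.
Qed.

Lemma farE u e t : 0 < e < 2^-1 -> `|t| <= 2^-1 -> far u e (u - t) = if e <= `|t| then 1 else 0.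
Proof.
move=> /andP[e0 e1] t1; rewrite /far /snpi (_ : pi * (u - (u - t)) = pi * t); last by ring.
have pe : 0 < sin (pi * e) by apply: snpi_gt0; apply/andP; split; lra.
have -> : `|sin (pi * t)| = sin (pi * `|t|).
  have -> : sin (pi * `|t|) = `|sin (pi * `|t|)|.
    apply/esym/ger0_norm/sin_ge0_pi; rewrite mulr_ge0 ?pi_ge0//=.
    by rewrite ger_pMr ?pi_gt0//; lra.
  by have [t0|t0] := ger0P t; rewrite // mulrN sinN normrN.
by rewrite (gtr0_norm pe) sin_pi_le// ?ltW.
Qed.

Lemma trunc_integrable G u e : L1 G -> 0 < u < 1 -> 0 < e < 2^-1 ->
  leb.-integrable [set t | e <= `|t| <= 2^-1] (EFin \o (fun t => periodize G (u - t) * cot (pi * t))).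
Proof.
move=> GL1 u01 e012; have /andP[e0 e1] := e012.
have e01 : 0 < e < 1 by apply/andP; split; lra.
pose f (t : R) := cotk u e (u - t) * periodize G (u - t).
have iL : leb.-integrable `]- 2^-1, 2^-1] (EFin \o f) by have [] := recenter GL1 u01 e01.
have iL' : leb.-integrable `[- 2^-1, 2^-1] (EFin \o f).
  move/integrableP : (iL) => [mf hf]; apply/integrableP; split.
    by apply/(emeasurable_fun_itv_obnd_cbndP (- 2^-1) (BRight 2^-1)).
  rewrite -integral_itv_obnd_cbnd//; exact: measurableT_comp.
have mD : measurable ([set t | e <= `|t| <= 2^-1] : set (measurableTypeR R)).
  have := @normr_measurable R setT measurableT _ (measurable_itv `[e, 2^-1]).
  rewrite setTI; congr measurable.
have sub : [set t : R | e <= `|t| <= 2^-1] `<=` `[- 2^-1, 2^-1].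
  by move=> t /= /andP[_ t1]; rewrite in_itv/= -ler_norml.
have : leb.-integrable [set t | e <= `|t| <= 2^-1] (EFin \o f).
  by apply: integrableS iL'; [exact: measurable_itv|exact: mD|exact: sub].
apply: eq_integrable; first exact: mD.
move=> t /=.
move=> /set_mem/= /andP[h1 h2]; rewrite /f /cotk farE// h1 (_ : u - (u - t) = t); last by ring.
by congr (_%:E); ring.
Qed.

Lemma trunc_I01 G u e : L1 G -> 0 < u < 1 -> 0 < e < 2^-1 ->
  hilbert1_trunc (periodize G) u e = I01 (fun s => cotk u e s * G s).
Proof.
move=> GL1 u01 e012; have /andP[e0 e1] := e012.
have e01 : 0 < e < 1 by apply/andP; split; lra.
have [iL <-] := recenter GL1 u01 e01.
rewrite /hilbert1_trunc.
transitivity (\int[leb]_(t in `[- 2^-1, 2^-1]) (far u e (u - t) * (periodize G (u - t) * cot (pi * t)))).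
  rewrite Rintegral_mkcond [RHS]Rintegral_mkcond; apply: eq_Rintegral => t _.
  rewrite !patchE.
  have [tI|tI] := boolP (t \in [set` `[- 2^-1, 2^-1]]); last first.
    rewrite memNset//= => /andP[h1 h2]; move/negP: tI; apply; apply/mem_set.
    by rewrite /= in_itv/= -ler_norml.
  have tI' : `|t| <= 2^-1 by move/set_mem: tI; rewrite /= in_itv/= -ler_norml.
  rewrite farE//; have [h|h] := boolP (e <= `|t|).
    by rewrite mem_set/= ?h ?mul1r.
  by rewrite memNset/= ?(negbTE h) ?mul0r.
rewrite (Rintegral_itv_obnd_cbnd iL); apply: eq_Rintegral => t _.
rewrite /cotk (_ : u - (u - t) = t); last by ring.
by ring.
Qed.

(** The truncated cotangent is odd around u. Its vanishing mean allows G to be recentred in the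
    truncated Hilbert transform too. *)
Lemma I01_cotk u e : 0 < u < 1 -> 0 < e < 1 -> L1 (cotk u e) /\ I01 (cotk u e) = 0.
Proof.
move=> u01 e01; have p1 (s : R) : periodize (fun=> 1) s = 1 by [].
have [iL iE] := recenter (@L1_cst _ 1) u01 e01.
pose g t := cotk u e (u - t).
have gE : (fun t => cotk u e (u - t) * periodize (fun=> 1) (u - t)) = g.
  by apply/funext => t; rewrite p1 mulr1.
rewrite gE in iL iE.
have gN t : g (- t) = - g t.
  rewrite /g /cotk /far /cot /snpi (_ : pi * (u - (u - - t)) = - (pi * t)); last by ring.
  rewrite (_ : pi * (u - (u - t)) = pi * t); last by ring.
  by rewrite sinN cosN normrN invrN mulrN mulrN.
have k1 : (fun s => cotk u e s * 1) = cotk u e by apply/funext => s; rewrite mulr1.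
split.
  rewrite -k1; apply: (@L1M _ _ _ (sin (pi * e))^-1); last exact: L1_cst.
    by apply: measurable_funTS; exact: mfun_cotk.
  by move=> s _; apply: cotk_bound.
have iL' : leb.-integrable `]- 2^-1, 2^-1[ (EFin \o g).
  by apply: integrableS iL => //; apply: subset_itvl; rewrite bnd_simp.
have N0 : -1 != 0 :> R by rewrite lt_eqF//; lra.
have : \int[leb]_(t in `]- 2^-1, 2^-1[) g t = - (\int[leb]_(t in `]- 2^-1, 2^-1[) g t).
  rewrite {1}(Rintegral_affine 0 N0 (measurable_itv _) iL') normrN1 mul1r.
  rewrite (_ : _ @^-1` _ = `]- 2^-1, 2^-1[%classic); last first.
    by apply/seteqP; split => x /=; rewrite !in_itv/= => /andP[h1 h2]; apply/andP; split; lra.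
  have -> : - (\int[leb]_(t in `]- 2^-1, 2^-1[) g t) = \int[leb]_(t in `]- 2^-1, 2^-1[) (-1 * g t).
    by rewrite RintegralZl// mulN1r.
  by apply: eq_Rintegral => t _; rewrite addr0 !mulN1r gN.
rewrite Rintegral_itv_bndo_bndc// iE k1; lra.
Qed.
Lemma far_near1 u s : 0 < u < 1 -> 0 < s < 1 -> s != u ->
  exists2 d, 0 < d & forall e, 0 < e < d -> far u e s = 1.
Proof.
move=> u01 s01 su; have n0 : snpi (u - s) != 0.
  have := tpar_neq u01 s01 su; rewrite tpar_sub// (_ : s - u = - (u - s)); last by ring.
  by rewrite {1}/snpi mulrN sinN mulf_eq0 oppr_eq0 negb_or => /andP[].
exists (`|snpi (u - s)| / pi); first by rewrite divr_gt0 ?normr_gt0 ?pi_gt0.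
move=> e /andP[e0]; rewrite ltr_pdivlMr ?pi_gt0// => ed.
rewrite /far ifT//; apply: (le_trans (abs_sin_le _)).
by rewrite ger0_norm ?mulr_ge0 ?pi_ge0 ?(ltW e0)// mulrC ltW.
Qed.

Lemma far_mono u e e' s : 0 < e' -> e' <= e -> e <= 2^-1 -> far u e s <= far u e' s.
Proof.
move=> e0 ee e1; rewrite /far; case: ifP => h; last by case: ifP.
rewrite ifT//; apply: le_trans h.
have e00 : 0 < e by exact: lt_le_trans ee.
have p (z : R) : 0 < z -> z <= 2^-1 -> 0 < sin (pi * z).
  by move=> z0 z1; apply: snpi_gt0; apply/andP; split => //; lra.
have e2 := le_trans ee e1.
by rewrite !gtr0_norm ?p// sin_pi_le// ltW.
Qed.

Lemma far_diag u e : 0 < e < 1 -> far u e u = 0.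
Proof.
move=> /snpi_gt0; rewrite /far /snpi subrr mulr0 sin0 normr0 => h.
by rewrite ifF//; apply/negbTE; rewrite -ltNge normr_gt0 gt_eqF.
Qed.

Section truncation.
Variables (G : R -> R) (u c : R).
Hypotheses (Gi : increasing01 G) (GL1 : L1 G) (u01 : 0 < u < 1) (uc : cut G u c).
Let t0 := tpar u.
Let Gc : L1 (fun s => G s - c) := L1_subc c GL1.
Let fQ s := kerQ t0 1 s * (G s - c).
Let fP s := kerPsi t0 t0 1 s * (G s - c).

Let farL e f : L1 f -> L1 (fun s => far u e s * f s).
Proof.
apply: (@L1M _ _ _ 1); first by apply: measurable_funTS; exact: mfun_far.
by move=> s _; exact: far_le1.
Qed.

Let fQL : L1 fQ. Proof. exact: L1_kerQ. Qed.

(** [kernel_identity] at height 1 over t0, multiplied by the cutoff. As e decreases the first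
    integral stays bounded, and the second has a nonnegative integrand and increases towards
    [psiJ]. *)
Let trunc_split e : 0 < e < 2^-1 -> L1 (fun s => far u e s * fP s) /\
  hilbert1_trunc (periodize G) u e =
    I01 (fun s => far u e s * fQ s) - I01 (fun s => far u e s * fP s).
Proof.
move=> e012; have /andP[e0 e1] := e012.
have e01 : 0 < e < 1 by apply/andP; split; lra.
have [cL c0] := I01_cotk u01 e01.
have mk : mfun (cotk u e) by apply: measurable_funTS; exact: mfun_cotk.
have kb s : unit_itv s -> `|cotk u e s| <= (sin (pi * e))^-1 by move=> _; exact: cotk_bound.
have kL := L1M mk kb GL1; have kcL := L1M mk kb Gc.
have E s : unit_itv s -> far u e s * fQ s - cotk u e s * (G s - c) = far u e s * fP s.
  move=> /unit_itvP s01; rewrite /cotk /fQ /fP; have [->|su] := eqVneq s u.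
    by rewrite far_diag// !mul0r subrr.
  have := kernel_identity t0 ltr01 u01 s01 su; rewrite subrr mul0r mul0r addr0 => ->.
  by ring.
have PL : L1 (fun s => far u e s * fP s) by apply: (L1_eq E); apply: L1B => //; exact: farL.
split => //; rewrite trunc_I01// -(I01_eq E) I01B//; last exact: farL.
rewrite opprB addrC subrK.
have -> : I01 (fun s => cotk u e s * (G s - c)) = I01 (fun s => cotk u e s * G s - c * cotk u e s).
  by apply: I01_eq => s _; ring.
by rewrite I01B ?I01Z//; [rewrite c0 mulr0 subr0|exact: L1Z].
Qed.

Let trunc_fin w : hW G t0 = w%:E ->
  hilbert1_trunc (periodize G) u e @[e --> 0^'+] --> w.
Proof.
move=> hw; have [fPL] := hW_fin Gi GL1 u01 uc t0 hw ltr01.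
rewrite subrr mul0r mul0r addr0 (hv_subc c t0 GL1 ltr01) -/fQ -/fP => hv1.
have wE : w = I01 (fun s => fQ s - fP s) by rewrite I01B// hv1; ring.
have dL : L1 (fun s => fQ s - fP s) by exact: L1B.
apply/cvg_at_rightP => e [e0 ec].
(* The cutoff vanishes at s = u for every truncation and so does not tend to 1 there; that one point
   is overridden. *)
pose K n s := if s == u then 0 else far u (e n) s - 1.
have mK n : mfun (K n).
  apply: measurable_funTS; apply: measurable_fun_ifT => //.
    by apply: measurable_fun_eqr.
  by apply: measurable_funB => //; exact: mfun_far.
have KC n s : unit_itv s -> `|K n s| <= 1.
  by move=> _; rewrite /K /far; case: ifP => _; [rewrite normr0|case: ifP => _; rewrite ?subrr ?normr0// sub0r normrN1].
have K0 s : unit_itv s -> K n s @[n --> \oo] --> 0.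
  move=> /unit_itvP s01; rewrite /K; case: eqVneq => [_|su]; first exact: cvg_cst.
  have [d d0 hd] := far_near1 u01 s01 su.
  apply: cvg_near_cst; near=> n; apply/eqP; rewrite hd ?subrr//.
  rewrite e0/=; near: n; move/cvgrPdist_lt : ec => /(_ d d0); apply: filterS => n.
  by rewrite sub0r normrN; apply: le_lt_trans; exact: ler_norm.
have := I01_cvg0 mK KC K0 dL.
move=> /(cvgD (cvg_cst w)); rewrite addr0; apply: cvg_trans.
apply: near_eq_cvg; near=> n.
have en : 0 < e n < 2^-1.
  rewrite e0/=; near: n.
  have h2 : 0 < 2^-1 :> R by rewrite invr_gt0.
  move/cvgrPdist_lt : ec => /(_ _ h2); apply: filterS => n.
  by rewrite sub0r normrN; apply: le_lt_trans; exact: ler_norm.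
have [l1 ->] := trunc_split en.
have e01 : 0 < e n < 1 by case/andP: en => h1 h2; apply/andP; split => //; lra.
have KL : L1 (fun s => K n s * (fQ s - fP s)) by apply: L1M dL; [exact: mK|exact: KC].
have eL : L1 (fun s => (fQ s - fP s) + K n s * (fQ s - fP s)) by exact: L1D.
rewrite -I01B//; last exact: farL.
rewrite wE -[LHS]/(_ + I01 (fun s => K n s * (fQ s - fP s))) -I01D//; apply/esym.
have [|_ ->//] := I01_eq1 (g := fun s => far u (e n) s * fQ s - far u (e n) s * fP s) u01 eL.
by move=> s s01 /negbTE su; rewrite /K su; ring.
Unshelve. all: by end_near. Qed.

(** Monotone convergence along one sequence of truncations suffices, since the second integral of
    [trunc_split] is monotone in e while the first never exceeds the integral B of |fQ|. *)
Let trunc_infty : psiJ G u c = +oo%E ->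
  (hilbert1_trunc (periodize G) u e)%:E @[e --> 0^'+] --> -oo%E.
Proof.
(* The shift by 3 keeps every truncation strictly below 1/2. *)
move=> J; pose en n : R := n.+3%:R^-1.
have en0 n : 0 < en n by rewrite invr_gt0.
have en2 n : en n < 2^-1 by rewrite ltf_pV2 ?posrE// ltr_nat.
pose g n s := (far u (en n) s * fP s)%:E.
have gL n : L1 (fun s => far u (en n) s * fP s).
  by have [] := @trunc_split (en n) ltac:(by rewrite en0 en2).
have lim s : unit_itv s -> g n s @[n --> \oo] --> (fP s)%:E.
  move=> /unit_itvP s01; apply: cvg_near_cst.
  have [->|su] := eqVneq s u.
    by apply: nearW => n; rewrite /g /fP /kerPsi !subrr mul0r invr0 !mulr0 mul0r mulr0.
  have [d d0 hd] := far_near1 u01 s01 su.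
  have [N hN] := ltr_add_invr d0; rewrite add0r in hN.
  exists N => // n /= Nn; rewrite /g hd ?mul1r// en0/=; apply: le_lt_trans hN.
  by rewrite lef_pV2 ?posrE// ler_nat; apply: leq_trans (leqnSn _); apply: leq_trans (leqnSn _).
have cvgJ : (I01 (fun s => far u (en n) s * fP s))%:E @[n --> \oo] --> +oo%E.
  rewrite -J; under eq_fun do rewrite EFin_I01//.
  have -> : psiJ G u c = (\int[leb]_(s in unit_itv) limn (g ^~ s))%E.
    by apply: eq_integral => s /set_mem us; apply/esym/cvg_lim => //; exact: lim.
  apply: cvg_monotone_convergence => //.
  - by move=> n; exact: measurable_int (gL n).
  - move=> n s /unit_itvP s01; rewrite lee_fin mulr_ge0 ?kerPsi_cut_ge0//.
    by rewrite /far; case: ifP.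
  - move=> s /unit_itvP s01 m n mn; rewrite lee_fin ler_wpM2r ?kerPsi_cut_ge0//.
    by apply: far_mono => //; [rewrite lef_pV2 ?posrE// ler_nat|exact: ltW].
pose B := I01 (fun s => `|fQ s|).
apply/cvgeNyPle => M.
move/cvgeyPge : cvgJ => /(_ (B - M)) [N _ /(_ N (leqnn N))] /=; rewrite lee_fin => hN.
near=> e.
have e0 : 0 < e by [].
have eN : e <= en N by near: e; exact: nbhs_right_le.
have e2 : 0 < e < 2^-1 by rewrite e0; exact: le_lt_trans (en2 N).
have [l1 ->] := trunc_split e2; rewrite lee_fin.
have h1 : I01 (fun s => far u e s * fQ s) <= B.
  apply: I01_le; [exact: farL|exact: L1_norm|].
  by move=> s _; apply: (le_trans (ler_norm _)); rewrite normrM ler_piMl// far_le1.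
have h2 : I01 (fun s => far u (en N) s * fP s) <= I01 (fun s => far u e s * fP s).
  apply: I01_le; [exact: gL|exact: l1|].
  move=> r /unit_itvP r01; rewrite ler_wpM2r ?kerPsi_cut_ge0//.
  by apply: far_mono => //; exact: ltW.
lra.
Unshelve. all: by end_near. Qed.

Lemma hilbert1_trunc_cvg :
  (hilbert1_trunc (periodize G) u e)%:E @[e --> 0^'+] --> hW G (tpar u).
Proof.
have := hW_psiJ Gi GL1 u01 uc; have := psiJ_ge0 u01 uc.
case J: (psiJ G u c) => [r| |]// _ hw.
  rewrite hw; apply: cvg_EFin; first exact: nearW.
  by apply: trunc_fin; rewrite hw.
by rewrite hw/=; exact: trunc_infty.
Qed.


End truncation.

End principal_value.

(** * Almost everywhere finiteness *)

Section monotone_quotients.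
Context {R : realType}.
Local Notation leb := (@lebesgue_measure R).
Variables (g : R -> R) (M : R).
Hypotheses (gm : {homo g : x y / x <= y}) (g0 : forall x, 0 <= g x) (gM : forall x, g x <= M).

Let mg : measurable_fun [set: R] g.
Proof. exact: nondecreasing_measurable. Qed.

Let M0 : 0 <= M. Proof. exact: le_trans (g0 0) (gM 0). Qed.

Let gint a b : leb.-integrable [set: R] (EFin \o (fun x => \1_`[a, b] x * g x)).
Proof.
have h : leb.-integrable [set: R] (fun x => M%:E * (EFin \o \1_`[a, b]) x)%E.
  by apply: integrableZl => //; exact: integrable_indic_itv.
apply: le_integrable h => //.
  by apply/measurable_EFinP; apply: measurable_funM => //; exact: measurable_indic.
move=> x _ /=; rewrite lee_fin normrM mulrC [leRHS]normrM; apply: ler_pM => //.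
by rewrite !ger0_norm.
Qed.

Let shiftE (a b d : R) : leb.-integrable [set: R] (EFin \o (fun r => \1_`[a, b] r * g (r + d))) /\
  \int[leb]_r (\1_`[a, b] r * g (r + d)) =
  \int[leb]_r (\1_`[a + d, b + d] r * g r).
Proof.
have E : (fun r : R => \1_`[a + d, b + d] (1 * r + d) * g (1 * r + d)) =
    (fun r => \1_`[a, b] r * g (r + d)).
  apply/funext => r; rewrite mul1r; congr (_ * _); rewrite !indicE; congr (nat_of_bool _)%:R.
  by apply/idP/idP => /set_mem; rewrite /= in_itv/= => h; apply/mem_set; rewrite /= in_itv/=; lra.
have i := gint (a + d) (b + d).
have := integrable_affine d (oner_neq0 R) measurableT i.
have := Rintegral_affine d (oner_neq0 R) measurableT i.
by rewrite preimage_setT normr1 mul1r E.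
Qed.

Let Rint_indic (a b : R) : a <= b -> \int[leb]_r (\1_`[a, b] r) = b - a.
Proof.
move=> ab; rewrite /Rintegral (@integral_indic _ _ R leb _ measurableT `[a, b]%classic)//.
have lab : leb `[a, b]%classic = (b - a)%:E.
  rewrite lebesgue_measure_itv/= lte_fin.
  by case: ltrgtP ab => //= -> _; rewrite subrr.
by rewrite setIT [X in fine X]lab.
Qed.

(** The two translates of g cancel on the common part of the shifted windows; what is left lives on
    an interval of length 2 d, where g is at most M. *)
Let gap_le (a b d : R) : 0 <= d ->
  (\int[leb]_r (\1_`[a, b] r * (g (r + d) - g (r - d)))%:E <= (2 * M * d)%:E)%E.
Proof.
move=> d0; have [i1 e1] := shiftE a b d; have [i2 e2] := shiftE a b (- d).
have iB := integrableB measurableT i1 i2.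
rewrite (@eq_integral _ _ _ leb _ (fun r => (\1_`[a, b] r * g (r + d))%:E - (\1_`[a, b] r * g (r - d))%:E)%E); last first.
  by move=> r _; rewrite -EFinB; congr (_%:E); ring.
rewrite integralB// -[X in (X - _)%E]fineK ?integrable_fin_num//.
rewrite -[X in (_ - X)%E]fineK; last by apply: (integrable_fin_num _ i2).
rewrite -EFinB lee_fin -/(Rintegral leb setT _) -/(Rintegral leb setT _) e1 e2.
have im : leb.-integrable [set: R] (EFin \o (fun x => M * \1_`[b - d, b + d] x)).
  have := @integrableZl _ _ _ leb _ measurableT M _ (integrable_indic_itv (b - d) (b + d) true false).
  by apply: eq_integrable.
rewrite -RintegralB//; try exact: gint.
have -> : 2 * M * d = \int[leb]_x (M * \1_`[b - d, b + d] x).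
  rewrite RintegralZl//; last exact: integrable_indic_itv.
  by rewrite Rint_indic; [ring|lra].
apply: le_Rintegral => //.
  have := integrableB measurableT (gint (a + d) (b + d)) (gint (a - d) (b - d)).
  by apply: eq_integrable.
move=> x _; rewrite !indicE !mem_setE !in_itv/=.
have := g0 x; have := gM x.
case: (boolP (a + d <= x <= b + d)) => h1; case: (boolP (a - d <= x <= b - d)) => h2;
case: (boolP (b - d <= x <= b + d)) => h3 /=; try lra.
Qed.

(** For monotone g this dominates the one-sided difference quotients at distance |t| on both sides
    of r. At t = 0 it has the default value 0. *)
Definition sym_quot (r t : R) : R := (g (r + `|t|) - g (r - `|t|)) / `|t|.

Let sym_quot_ge0 (r t : R) : 0 <= sym_quot r t.
Proof. by rewrite divr_ge0// subr_ge0 gm//; have := normr_ge0 t; lra. Qed.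

(** Tonelli: integrating first in r gives at most 2 M for each t by [gap_le], so the double integral
    is finite and almost every inner integral is too. *)
Lemma sym_quot_ae a b e : 0 < e -> {ae leb, forall r, a <= r <= b ->
  (\int[leb]_t (\1_`[- e, e] t * sym_quot r t)%:E < +oo)%E}.
Proof.
move=> e0.
pose F (z : measurableTypeR R * measurableTypeR R) : \bar R :=
  (\1_`[a, b] z.1 * (\1_`[- e, e] z.2 * sym_quot z.1 z.2))%:E.
have mi (c d : R) : measurable_fun [set: R] (\1_`[c, d] : R -> R) by exact: measurable_indic.
have m1 : measurable_fun setT (fun z : measurableTypeR R * measurableTypeR R => z.1) by exact: measurable_fst.
have m2 : measurable_fun setT (fun z : measurableTypeR R * measurableTypeR R => z.2) by exact: measurable_snd.
have mn : measurable_fun setT (fun z : measurableTypeR R * measurableTypeR R => `|z.2|).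
  exact: (measurableT_comp (@normr_measurable R setT) m2).
have mF : measurable_fun setT F.
  apply/measurable_EFinP; apply: measurable_funM; first exact: (measurableT_comp (mi a b) m1).
  apply: measurable_funM; first exact: (measurableT_comp (mi (- e) e) m2).
  apply: measurable_funM; last exact: (measurableT_comp measurable_invr mn).
  apply: measurable_funB; apply: (measurableT_comp mg); first exact: measurable_funD.
  exact: measurable_funB.
have i0 (c d x : R) : 0 <= \1_`[c, d] x :> R by rewrite indicE.
have F0 z : (0 <= F z)%E.
  by rewrite lee_fin; do 2 apply: mulr_ge0 => //.
have tonelli := @fubini_tonelli _ _ _ _ R leb leb F mF F0.
have le1 : (\int[leb]_x \int[leb]_y F (x, y) <= \int[leb]_y (2 * M * \1_`[- e, e] y)%:E)%E.
  rewrite tonelli; apply: ge0_le_integral.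
  - exact: measurableT.
  - by move=> y _; apply: integral_ge0 => x _; exact: F0.
  - exact: (@measurable_fun_fubini_tonelli_G _ _ _ _ _ leb F mF F0).
  - by apply/measurable_EFinP; apply: measurable_funM => //; exact: mi.
  - move=> y _; have [y0|y0] := eqVneq y 0.
      rewrite (@eq_integral _ _ _ leb _ (cst 0%E)); first by rewrite integral0 lee_fin !mulr_ge0.
      by move=> x _; rewrite /F/= /sym_quot y0 normr0 invr0 !mulr0.
    have yn : 0 < `|y| by rewrite normr_gt0.
    have -> : (\int[leb]_x F (x, y) = \int[leb]_x ((\1_`[- e, e] y / `|y|)%:E *
        (\1_`[a, b] x * (g (x + `|y|) - g (x - `|y|)))%:E))%E.
      by apply: eq_integral => x _; rewrite /F /sym_quot -EFinM /=; congr (_%:E); ring.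
    rewrite ge0_integralZl; last 4 first.
    + exact: measurableT.
    + apply/measurable_EFinP/measurable_funM; first exact: mi.
      by apply: measurable_funB; apply: (measurableT_comp mg); [exact: measurable_funD|exact: measurable_funB].
    + move=> x _; rewrite lee_fin; apply: mulr_ge0; first exact: i0.
      by rewrite subr_ge0; apply: gm; rewrite lerBlDr -addrA lerDl addr_ge0.
    + by rewrite lee_fin; apply: divr_ge0; [exact: i0|exact: normr_ge0].
    have -> : (2 * M * \1_`[- e, e] y)%:E = ((\1_`[- e, e] y / `|y|)%:E * (2 * M * `|y|)%:E)%E.
      by rewrite -EFinM; congr (_%:E); field; rewrite gt_eqF.
    by apply: lee_wpmul2l; [rewrite lee_fin divr_ge0|exact: gap_le].
have le2 : (\int[leb]_y (2 * M * \1_`[- e, e] y)%:E < +oo)%E.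
  have i := @integrableZl _ _ _ leb _ measurableT (2 * M) _ (integrable_indic_itv (- e) e true false).
  by rewrite ltey_eq (integrable_fin_num _ i).
have iF : leb.-integrable setT (fun x => \int[leb]_y F (x, y))%E.
  apply/integrableP; split; first exact: (@measurable_fun_fubini_tonelli_F _ _ _ _ _ leb F mF F0).
  apply: le_lt_trans le2; apply: le_trans le1; rewrite le_eqVlt; apply/orP; left; apply/eqP.
  by apply: eq_integral => x _; rewrite gee0_abs// integral_ge0.
have := integrable_ae measurableT iF; apply: filterS => r /(_ I) h rab.
rewrite ltey_eq; apply/orP; left; move: h; congr (_ \is a fin_num).
apply: eq_integral => y _; rewrite /F/= indicE mem_set ?mul1r//=.
Qed.


End monotone_quotients.

Section envelope_ae_finite.
Context {R : realType}.
Local Notation leb := (@lebesgue_measure R).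
Implicit Types (G : R -> R) (r s a b e : R).

Lemma atan_lip (x y : R) : `|atan x - atan y| <= `|x - y|.
Proof.
wlog xy : x y / x <= y => [hw|].
  by have [xy|/ltW xy] := leP x y; [exact: hw|rewrite distrC (distrC x); exact: hw].
have [z _] := @MVT_segment R atan (fun z => (1 + z ^+ 2)^-1) x y xy
  (fun z _ => is_derive1_atan z) (continuous_subspaceT (@continuous_atan R)).
rewrite distrC => ->; rewrite normrM distrC ler_piMl// ger0_norm.
  by rewrite invf_le1 ?onesqr_gt0// lerDl sqr_ge0.
by rewrite invr_ge0 ltW// onesqr_gt0.
Qed.

(** The inverse [tinv] has Lipschitz constant 1 / pi, because the arctangent has constant 1. *)
Lemma tpar_expand r s : 0 < r < 1 -> 0 < s < 1 -> pi * `|s - r| <= `|tpar s - tpar r|.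
Proof.
move=> r01 s01; rewrite -{1}(tparK s01) -{1}(tparK r01) /tinv.
rewrite (_ : _ - _ = (atan (tpar s) - atan (tpar r)) / pi); last by ring.
rewrite normrM normfV (gtr0_norm (pi_gt0 R)) mulrC divfK ?gt_eqF ?pi_gt0//.
exact: atan_lip.
Qed.

Lemma kerPsi_bound r s : 0 < r < 1 -> 0 < s < 1 -> s != r ->
  `|kerPsi (tpar r) (tpar r) 1 s| <= (2 + tpar r ^+ 2) / `|s - r|.
Proof.
move=> r01 s01 sr; have t0 := tpar_neq r01 s01 sr.
have -> : kerPsi (tpar r) (tpar r) 1 s = kerP (tpar r) 1 s / (tpar s - tpar r).
  rewrite kerPE// /kerPsi subrr; have := dist_gt0 (tpar r) s ltr01; move: t0.
  by move: (tpar r) (tpar s) => a b ab; rewrite expr1n => d; field; rewrite ab gt_eqF.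
rewrite normrM normfV; apply: ler_pM => //.
  have := kerP_bound (tpar r) s (@ltr01 R); rewrite divr1 expr1n; lra.
have d0 : 0 < `|s - r| by rewrite normr_gt0 subr_eq0.
have tn : 0 < `|tpar s - tpar r| by rewrite normr_gt0.
rewrite lef_pV2 ?posrE//; apply: le_trans (tpar_expand r01 s01).
by rewrite ler_peMl//; have := pi_ge2 R; lra.
Qed.

(** The kernel of [psiJ] at r is at most a constant over |s - r|, so [psiJ] is finite as soon as the
    difference quotient of G at r is integrable near r. [sym_quot_ae] gives this almost everywhere
    on compact subintervals, countably many of which fill the unit interval. *)
Lemma hW_fin_ae G : increasing01 G -> L1 G ->
  {ae leb, forall r, 0 < r < 1 -> hW G (tpar r) \is a fin_num}.
Proof.
move=> Gi GL1.
have Gn s s' : 0 < s -> s <= s' -> s' < 1 -> G s <= G s'.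
  by rewrite le_eqVlt => s0 /predU1P[->//|ss] s1; exact/ltW/Gi.
suff H a b e : 0 < a - e -> b + e < 1 -> 0 < e -> {ae leb, forall r, a <= r <= b ->
    hW G (tpar r) \is a fin_num}.
  have /ae_foralln : forall n : nat, {ae leb, forall r, n.+3%:R^-1 <= r <= 1 - n.+3%:R^-1 ->
      hW G (tpar r) \is a fin_num}.
    move=> n; have n0 : 0 < n.+3%:R^-1 :> R by rewrite invr_gt0.
    by move: n0; move: (n.+3%:R^-1) => x x0; apply: (H x (1 - x) (x / 2)); lra.
  apply: filterS => r h /andP[r0 r1].
  have [n1 h1] := ltr_add_invr r0; have [n2 h2] := ltr_add_invr r1.
  rewrite add0r in h1.
  apply: (h (maxn n1 n2)).
  have m1 : (maxn n1 n2).+3%:R^-1 <= n1.+1%:R^-1 :> R.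
    by rewrite lef_pV2 ?posrE// ler_nat ltnS (leq_trans (leq_maxl _ n2))// (leq_trans (leqnSn _)).
  have m2 : (maxn n1 n2).+3%:R^-1 <= n2.+1%:R^-1 :> R.
    by rewrite lef_pV2 ?posrE// ler_nat ltnS (leq_trans (leq_maxr n1 _))// (leq_trans (leqnSn _)).
  apply/andP; split; first exact: le_trans m1 (ltW h1).
  by rewrite lerBrDr; apply: (le_trans _ (ltW h2)); rewrite lerD2l.
move=> a0 b1 e0.
have [ab|ba] := leP a b; last first.
  by apply: aeW => r /andP[h1 h2]; lra.
(* Clamping the argument extends G from a compact subinterval to a bounded monotone function on the
   line, as [sym_quot_ae] requires. *)
pose cl x := Num.max (a - e) (Num.min x (b + e)).
have cl_itv x : a - e <= cl x <= b + e.
  by rewrite /cl le_max lexx/= ge_max ge_min lexx orbT andbT; lra.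
have cl_id x : a - e <= x <= b + e -> cl x = x.
  by move=> /andP[h1 h2]; rewrite /cl (min_idPl h2) (max_idPr h1).
have cl_mono : {homo cl : x y / x <= y}.
  move=> x y xy; rewrite /cl ge_max !le_max lexx/=.
  by apply/orP; right; rewrite le_min !ge_min xy lexx !orbT.
pose g x := G (cl x) - G (a - e).
have gm : {homo g : x y / x <= y}.
  move=> x y xy; rewrite lerD2r; have := cl_itv x; have := cl_itv y; have := cl_mono _ _ xy.
  by move=> h /andP[h1 h2] /andP[h3 h4]; apply: Gn => //; lra.
have g0 x : 0 <= g x.
  by rewrite subr_ge0; have /andP[h1 h2] := cl_itv x; apply: Gn => //; lra.
have gM x : g x <= G (b + e) - G (a - e).
  by rewrite lerD2r; have /andP[h1 h2] := cl_itv x; apply: Gn => //; lra.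
have := sym_quot_ae gm g0 gM a b e0.
apply: (@filterS _ _ (ae_filter_ringOfSetsType leb)) => r h rab; have {h} := h rab.
have /andP[ra rb] := rab.
have r01 : 0 < r < 1 by apply/andP; split; lra.
pose q (t : R) := \1_`[- e, e] t * sym_quot g r t; move=> hq.
have q0 t : 0 <= q t.
  by rewrite /q mulr_ge0 ?indicE// /sym_quot divr_ge0// subr_ge0 gm//; have := normr_ge0 t; lra.
have mg : measurable_fun [set: R] g by exact: nondecreasing_measurable.
have mq : measurable_fun [set: R] q.
  apply: measurable_funM; first exact: measurable_indic.
  apply: measurable_funM; last exact: (measurableT_comp measurable_invr (@normr_measurable R setT)).
  have mn := @normr_measurable R setT.
  by apply: measurable_funB; apply: (measurableT_comp mg); [exact: measurable_funD|exact: measurable_funB].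
have qi : leb.-integrable [set: R] (EFin \o q).
  apply/integrableP; split; first exact/measurable_EFinP.
  by move: hq; rewrite (@eq_integral _ _ _ leb _ (fun t => `|(EFin \o q) t|%E))// => t _ /=; rewrite ger0_norm.
have qL : L1 (fun s => q (s - r)).
  have := integrable_affine (- r) (oner_neq0 R) measurableT qi; rewrite preimage_setT => h.
  have : L1 (fun s => q (1 * s - r)) by apply: integrableS h.
  by apply: L1_eq => s _; rewrite mul1r.
pose C := 2 + tpar r ^+ 2.
have C0 : 0 < C by rewrite /C; have := sqr_ge0 (tpar r); lra.
have Gc := L1_subc (G r) GL1.
(* The first term dominates at distance at most e from r, the second farther away. *)
pose h s := C * q (s - r) + C / e * `|G s - G r|.
have hL : L1 h by apply: L1D; apply: L1Z => //; exact: L1_norm.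
have mP : mfun (fun s => kerPsi (tpar r) (tpar r) 1 s * (G s - G r)).
  apply: measurable_funM; last exact: (L1_mfun Gc).
  by apply: measurable_funTS; exact: mfun_kerPsi.
have PL : L1 (fun s => kerPsi (tpar r) (tpar r) 1 s * (G s - G r)).
  apply: (@L1_le _ _ h) => // s /unit_itvP s01; rewrite normrM /h.
  have [->|sr] := eqVneq s r.
    by rewrite !subrr normr0 !mulr0 addr0 mulr_ge0// ltW.
  have d0 : 0 < `|s - r| by rewrite normr_gt0 subr_eq0.
  apply: (@le_trans _ _ (C / `|s - r| * `|G s - G r|)).
    by rewrite ler_wpM2r//; exact: kerPsi_bound.
  have [se|se] := leP `|s - r| e; last first.
    rewrite -[leLHS]add0r; apply: lerD; first by rewrite mulr_ge0// ltW.
    by rewrite ler_wpM2r// ler_wpM2l ?(ltW C0)// lef_pV2 ?posrE// ltW.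
  rewrite -[leLHS]addr0; apply: lerD; last by rewrite mulr_ge0// divr_ge0// ltW.
  rewrite -mulrA ler_wpM2l ?(ltW C0)// /q indicE mem_set/= ?mul1r; last first.
    by rewrite in_itv/= -ler_norml.
  rewrite /sym_quot mulrC ler_wpM2r ?invr_ge0//.
  have i1 : a - e <= r + `|s - r| <= b + e by apply/andP; split; lra.
  have i2 : a - e <= r - `|s - r| <= b + e by apply/andP; split; lra.
  rewrite /g !cl_id//; have [sr'|rs] := leP s r.
    have e1 : r - `|s - r| = s by rewrite ler0_norm; lra.
    have h1 : G s <= G r by apply: Gn; lra.
    have h2 : G r <= G (r + `|s - r|) by apply: Gn; lra.
    by rewrite e1 ler0_norm ?subr_le0//; lra.
  have e1 : r + `|s - r| = s by rewrite gtr0_norm; lra.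
  have h1 : G r <= G s by apply: Gn; lra.
  have h2 : G (r - `|s - r|) <= G r by apply: Gn; lra.
  by rewrite e1 ger0_norm ?subr_ge0//; lra.
have := hW_psiJ Gi GL1 r01 (cut_self Gi r01).
by rewrite /psiJ -(EFin_I01 PL) => ->.
Qed.

End envelope_ae_finite.

(** * The quantile function *)

Section quantile_function.
Context {R : realType} (mu : probability (measurableTypeR R) R).
Local Notation leb := (@lebesgue_measure R).
Implicit Types (x u s : R).
Local Notation F := (dist_fun mu).
Local Notation G := (quantile mu).

Let idTR : measurableTypeR R -> R := idfun.
#[local] HB.instance Definition _ :=
  @isMeasurableFun.Build _ _ _ _ idTR (@measurable_id _ _ setT).

Let FE : F = fine \o cdf (idTR : {RV mu >-> R}).
Proof. by []. Qed.

Lemma dist_fun_EFin x : (F x)%:E = mu `]-oo, x]%classic.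
Proof. by rewrite /dist_fun fineK// fin_num_measure. Qed.

Lemma dist_fun_ge0 x : 0 <= F x.
Proof. by rewrite -lee_fin dist_fun_EFin. Qed.

Lemma dist_fun_le1 x : F x <= 1.
Proof. by rewrite -lee_fin dist_fun_EFin; exact: probability_le1. Qed.

Lemma dist_fun_mono : {homo F : x y / x <= y}.
Proof. by move=> x y xy; rewrite fine_le ?fin_num_measure// (cdf_nondecreasing (idTR : {RV mu >-> R})). Qed.

Lemma measurable_dist_fun : measurable_fun [set: R] F.
Proof. by apply: nondecreasing_measurable => // x y; exact: dist_fun_mono. Qed.

Let F_rc : right_continuous F.
Proof.
move=> a; rewrite FE; apply: fine_cvg => /=.
by rewrite fineK ?fin_num_measure//; exact: (@cdf_right_continuous _ _ _ _ (idTR : {RV mu >-> R})).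
Qed.

Let F_y1 : F x @[x --> +oo] --> (1 : R).
Proof. exact/fine_cvg/(cvg_cdfy1 (idTR : {RV mu >-> R})). Qed.

Let F_Ny0 : F x @[x --> -oo] --> (0 : R).
Proof. exact/fine_cvg/(cvg_cdfNy0 (idTR : {RV mu >-> R})). Qed.

(** Right continuity of the distribution function makes the defining infimum attained; its limits 0
    and 1 make that infimum a genuine one. *)
Lemma quantile_galois u x : 0 < u < 1 -> (u <= F x) = (G u <= x).
Proof.
move=> /andP[u0 u1]; set A := [set y | u <= F y].
have [a Fa] : exists a, u <= F a.
  have /cvgrPdist_lt/(_ (1 - u)) := F_y1; rewrite subr_gt0 => /(_ u1) [M [_ hM]].
  by have := hM (M + 1) (ltac:(lra)); rewrite ger0_norm ?subr_ge0 ?dist_fun_le1// => h; exists (M + 1); lra.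
have [b Fb] : exists b, F b < u.
  have /cvgrPdist_lt/(_ u u0) := F_Ny0 => -[M [_ hM]].
  by have := hM (M - 1) (ltac:(lra)); rewrite sub0r normrN ger0_norm ?dist_fun_ge0// => h; exists (M - 1).
have lbA : lbound A b.
  by move=> y uy; rewrite leNgt; apply/negP => yb; have := dist_fun_mono (ltW yb); rewrite leNgt (lt_le_trans Fb uy).
have hA : has_inf A by split; [exists a|exists b].
apply/idP/idP => [ux|Gx]; first by apply: ge_inf => //; exact: hA.2.
apply: (le_trans _ (dist_fun_mono Gx)).
rewrite leNgt; apply/negP => FG.
have /cvgrPdist_lt/(_ (u - F (G u))) := @F_rc (G u).
rewrite subr_gt0 => /(_ FG) [d /= d0 hd].
have [y uy yd] := inf_adherent d0 hA.
have Gy : G u <= y by apply: ge_inf => //; exact: hA.2.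
move: Gy; rewrite le_eqVlt => /predU1P[e|Gy]; first by move: uy; rewrite /A/= -e leNgt FG.
have := hd y; rewrite /= ltr0_norm; last by rewrite subr_lt0.
rewrite -/(quantile mu u) in yd.
move=> /(_ (ltac:(lra)) Gy); rewrite ler0_norm; last by rewrite subr_le0; exact/dist_fun_mono/ltW.
by move: uy; rewrite /A /=; lra.
Qed.

Lemma quantile_ltE u x : 0 < u < 1 -> (x < G u) = (F x < u).
Proof. by move=> u01; rewrite !ltNge quantile_galois. Qed.

Section atomless.
Hypothesis mu0 : atomless mu.

(** Without an atom at [G u] the value there equals the left limit, and the distribution function is
    below u at every point left of [G u]. *)
Lemma dist_fun_quantile u : 0 < u < 1 -> F (G u) = u.
Proof.
move=> u01; apply/eqP; rewrite eq_le; apply/andP; split; last by rewrite quantile_galois.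
have e : mu `]-oo, G u]%classic = mu `]-oo, G u[%classic.
  rewrite -(@setUitv1 _ _ -oo%O (G u) true)// measureU//=; first by rewrite mu0 adde0.
  by apply/seteqP; split => // x [/=]; rewrite in_itv/= => h xe; move: h; rewrite xe ltxx.
have c : mu `]-oo, G u - n.+1%:R^-1]%classic @[n --> \oo] --> mu `]-oo, G u[%classic.
  have -> : `]-oo, G u[%classic = \bigcup_n `]-oo, G u - n.+1%:R^-1]%classic.
    apply/seteqP; split => [x/=|x [n _]] /=; rewrite !in_itv/=.
      move=> xG; have [n hn] := ltr_add_invr xG.
      by exists n => //=; rewrite in_itv/= lerBrDr ltW.
    by move=> h; apply: le_lt_trans h _; rewrite ltrBlDr ltrDl.
  apply: nondecreasing_cvg_mu => //; first exact: bigcup_measurable.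
  move=> n m nm; apply/subsetPset => x /=; rewrite !in_itv/= => h; apply: le_trans h _.
  by rewrite lerD2l lerN2 lef_pV2 ?posrE// ler_nat.
rewrite -lee_fin dist_fun_EFin e; apply: (cvge_to_le c).
apply: nearW => n; rewrite -dist_fun_EFin lee_fin ltW// -quantile_ltE//.
by rewrite ltrBlDr ltrDl.
Qed.

Lemma quantile_increasing : increasing01 G.
Proof.
move=> s s' s0 ss s1; rewrite quantile_ltE; last by apply/andP; split => //; lra.
by rewrite dist_fun_quantile//; apply/andP; split => //; lra.
Qed.

(** This covers every x, including those in a flat stretch of the distribution function, where x
    differs from [G (F x)]. *)
Lemma quantile_cut x : 0 < F x < 1 -> cut G (F x) x.
Proof.
move=> x01 s s01; split => h; first by rewrite -quantile_galois// ltW.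
by apply: ltW; rewrite quantile_ltE.
Qed.

Lemma quantile_inrange x : inrange G x <-> 0 < F x < 1.
Proof.
split=> [[[s s01 h1] [s' s01' h2]]|/andP[x0 x1]].
  have /andP[s0 _] := s01; have /andP[_ s1] := s01'.
  move: h1 h2 => /ltW; rewrite -quantile_galois// quantile_ltE// => h1 h2.
  by apply/andP; split; lra.
split.
  have s01 : 0 < F x / 2 < 1 by apply/andP; split; lra.
  exists (F x / 2) => //; rewrite lt_neqAle -quantile_galois//; apply/andP; split; last lra.
  by apply/negP => /eqP e; have := dist_fun_quantile s01; rewrite e; lra.
have s01 : 0 < (1 + F x) / 2 < 1 by apply/andP; split; lra.
by exists ((1 + F x) / 2) => //; rewrite quantile_ltE//; lra.
Qed.

Lemma mfun_quantile : mfun G.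
Proof.
apply: (measurability (@RGenOInfty.G R)) => [|/= _ [_] [x] -> <-].
  exact: RGenOInfty.measurableE.
have -> : unit_itv `&` G @^-1` `]x, +oo[ = unit_itv `&` `]F x, +oo[.
  apply/seteqP; split => u [u01 b]; split => //; move: (u01) => /unit_itvP u01' /=;
  by move: b; rewrite /= !in_itv/= !andbT quantile_ltE.
by apply: measurableI; exact: measurable_itv.
Qed.

(** Cut off outside the unit interval to have a function measurable on the whole line, as a
    push-forward requires. *)
Let Gt u := if 0 < u < 1 then G u else 0.

Let mGt : measurable_fun [set: R] Gt.
Proof.
have -> : Gt = G \_ unit_itv.
  apply/funext => u; rewrite patchE /Gt /unit_itv mem_setE in_itv/=.
  by case: ifP.
by apply: (measurable_restrictT _ measurable_unit_itv).1; exact: mfun_quantile.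
Qed.

Let unif_mu : probability (measurableTypeR R) R := uniform_prob (@ltr01 R).

Let unif_integral (f : measurableTypeR R -> \bar R) : measurable_fun setT f -> (forall x, (0 <= f x)%E) ->
  (\int[unif_mu]_x f x = \int[leb]_(x in unit_itv) f x)%E.
Proof.
move=> mf f0; rewrite /unif_mu integral_uniform// subr0 invr1 mul1e integral_itv_bndoo//.
exact: measurable_funTS.
Qed.

Let unifE (B : set (measurableTypeR R)) : measurable B -> unif_mu B = leb (unit_itv `&` B).
Proof.
move=> mB; rewrite -[in LHS](setIT B) -(@integral_indic _ _ R unif_mu _ measurableT B mB).
rewrite unif_integral//; first by rewrite integral_indic// setIC.
by apply/measurable_EFinP; exact: measurable_indic.
Qed.

Let nu : {measure set (measurableTypeR R) -> \bar R}.
Proof.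
refine (pushforward unif_mu (Gt : measurableTypeR R -> measurableTypeR R)
  : {measure set (measurableTypeR R) -> \bar R}); exact: mGt.
Defined.

Let nuE (B : set (measurableTypeR R)) : measurable B -> nu B = leb (unit_itv `&` G @^-1` B).
Proof.
move=> mB; rewrite [LHS]unifE; last by rewrite -[_ @^-1` _]setTI; exact: mGt.
congr (leb _); apply/seteqP; split => u [u01 h]; split => //;
by move: h; rewrite /= /Gt (unit_itvP _).1.
Qed.

(** The law of G under the uniform distribution is mu: the two measures agree on right half-lines, a
    generating family stable under intersection. *)
Let nu_mu (B : set (measurableTypeR R)) : measurable B -> mu B = nu B.
Proof.
move: B; apply: (@measure_unique _ R (measurableTypeR R) (@RGenOInfty.G R)
  (fun n => `](- n%:R), +oo[%classic) _ _ _ _ mu nu).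
- exact: RGenOInfty.measurableE.
- move=> _ _ [a ->] [b ->]; exists (Num.max a b).
  by apply/seteqP; split => x /=; rewrite !in_itv/= !andbT gt_max => /andP.
- by move=> n; eexists.
- apply/seteqP; split => // x _; exists (Num.truncn (- x)).+1 => //=.
  by rewrite in_itv/= andbT ltrNl truncnS_gt.
- move=> _ [x ->]; rewrite nuE//.
  have -> : unit_itv `&` G @^-1` `]x, +oo[ = `]F x, 1[%classic.
    apply/seteqP; split => [u [/unit_itvP u01]|u] /=; rewrite !in_itv/= ?andbT.
      by rewrite quantile_ltE// => ->; case/andP: u01.
    move=> /andP[Fu u1]; have u01 : 0 < u < 1 by rewrite u1 (le_lt_trans (dist_fun_ge0 x)).
    by split; [exact/unit_itvP|rewrite quantile_ltE].
  rewrite lebesgue_measure_itv/= lte_fin.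
  have -> : mu `]x, +oo[%classic = (1 - F x)%:E.
    rewrite -setCitvl probability_setC//.
    by rewrite EFinB dist_fun_EFin.
  have [//|F1] := ltP (F x) 1.
  by congr (_%:E); apply/eqP; rewrite subr_eq0 eq_le F1 dist_fun_le1.
- by move=> n; rewrite (le_lt_trans (probability_le1 _ _)) ?ltry.
Qed.

Lemma quantile_measure (B : set (measurableTypeR R)) : measurable B ->
  mu B = leb (unit_itv `&` G @^-1` B).
Proof. by move=> mB; rewrite nu_mu// nuE. Qed.

Lemma quantile_integral (f : measurableTypeR R -> \bar R) : measurable_fun setT f -> (forall x, (0 <= f x)%E) ->
  (\int[mu]_x f x = \int[leb]_(u in unit_itv) f (G u))%E.
Proof.
move=> mf f0; rewrite (@eq_measure_integral _ _ _ _ nu); last by move=> A mA _; exact: nu_mu.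
rewrite [LHS](@ge0_integral_pushforward _ _ (measurableTypeR R) (measurableTypeR R) R Gt mGt unif_mu setT f)//.
have mc : measurable_fun setT (f \o Gt) by exact: (measurableT_comp mf mGt).
rewrite preimage_setT (unif_integral mc); last by move=> x; exact: f0.
apply: eq_integral => u /set_mem/unit_itvP u01; rewrite /= /Gt u01//.
Qed.

(** The probability integral transform: under mu the distribution function is uniformly
    distributed. *)
Lemma dist_fun_measure (B : set (measurableTypeR R)) : measurable B ->
  mu (F @^-1` B) = leb (unit_itv `&` B).
Proof.
move=> mB; rewrite quantile_measure; last by rewrite -[_ @^-1` _]setTI; exact: measurable_dist_fun.
congr (leb _); apply/seteqP; split => u [u01 h]; split => //; move: h;
by rewrite /= dist_fun_quantile//; exact/unit_itvP.
Qed.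

(** Null sets of parameters pull back to mu-null sets of abscissas, the distribution function being
    uniform under mu. *)
Lemma ae_dist_fun (P : R -> Prop) : {ae leb, forall r, 0 < r < 1 -> P r} ->
  {ae mu, forall x : R, 0 < F x < 1 /\ P (F x)}.
Proof.
move=> [N [mN N0 PN]].
have mB : measurable (N `|` ~` (unit_itv : set (measurableTypeR R))).
  by apply: measurableU; [exact: mN|apply: measurableC; exact: measurable_itv].
exists (F @^-1` (N `|` ~` unit_itv)); split.
- by rewrite -[_ @^-1` _]setTI; exact: measurable_dist_fun.
- apply/eqP; rewrite eq_le measure_ge0 andbT [leLHS]dist_fun_measure//.
  rewrite -[leRHS]N0 setIUr setICr setU0; apply: le_measure; rewrite ?inE//.
  by apply: measurableI => //; exact: measurable_itv.
- move=> x /= nx; have [x01|x01] := boolP (0 < F x < 1); last first.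
    by right => /unit_itvP; exact/negP.
  by left; apply: PN => /= h; apply: nx; split => //; exact: h.
Qed.

Lemma L1_quantile p : 1 < p -> finite_abs_moment mu p -> L1 G.
Proof.
move=> p1 fp; apply/integrableP; split; first by apply/measurable_EFinP; exact: mfun_quantile.
have mn : measurable_fun [set: measurableTypeR R] (fun x : R => `|x|).
  exact: (@normr_measurable R setT).
have mp : measurable_fun [set: measurableTypeR R] (fun x : R => `|x| `^ p).
  exact: (measurableT_comp (measurable_powR p) mn).
have -> : (\int[leb]_(x in unit_itv) `|(EFin \o G) x| = \int[mu]_x `|x|%:E)%E.
  rewrite quantile_integral//; first exact/measurable_EFinP.
have i1 : mu.-integrable [set: measurableTypeR R] (EFin \o cst 1).
  exact: finite_measure_integrable_cst.
have i2 : mu.-integrable [set: measurableTypeR R] (EFin \o (fun x : R => `|x| `^ p)).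
  apply/integrableP; split; first exact/measurable_EFinP.
  move: fp; rewrite /finite_abs_moment; congr (_ < _)%E; apply: eq_integral => x _.
  by rewrite gee0_abs// lee_fin powR_ge0.
have i3 := integrableD measurableT i1 i2.
have : mu.-integrable [set: measurableTypeR R] (EFin \o (fun x : R => `|x|)).
  apply: le_integrable i3 => //; first exact/measurable_EFinP.
  move=> x _ /=; have h0 : 0 <= 1 + `|x : R| `^ p by rewrite addr_ge0// powR_ge0.
  rewrite lee_fin normr_id (ger0_norm h0).
  have [x1|x1] := leP `|x : R| 1; first by rewrite (le_trans x1)// lerDl powR_ge0.
  by rewrite -[leLHS]powRr1// -[leLHS]add0r lerD// ler_powR ?ltW.
move=> /integrableP[_]; apply: le_lt_trans; rewrite le_eqVlt; apply/orP; left; apply/eqP.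
by apply: eq_integral => x _ /=; rewrite normr_id.
Qed.

Lemma I01_quantile : L1 G -> zero_mean mu -> I01 G = 0.
Proof.
move=> GL1 zm; rewrite /I01 /Rintegral.
have -> : (\int[leb]_(x in unit_itv) (G x)%:E = \int[mu]_x (x : R)%:E)%E.
  have m : measurable_fun [set: measurableTypeR R] (EFin : R -> \bar R).
    by apply/measurable_EFinP; exact: measurable_id.
  rewrite [LHS]integralE [RHS]integralE !quantile_integral//.
  - by congr (_ - _)%E; apply: eq_integral => u _; rewrite ?funeposE ?funenegE.
  - exact: measurable_funeneg.
  - exact: measurable_funepos.
by rewrite zm.
Qed.

End atomless.
End quantile_function.

(** * The conformal map *)

Section rescaling.
Context {R : realType} (mu : probability (measurableTypeR R) R).
Local Notation leb := (@lebesgue_measure R).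
Local Notation F := (dist_fun mu).
Local Notation G := (quantile mu).
Hypothesis GL1 : L1 G.
Implicit Types (x u eta : R).

Let tpi : R := 2 * pi.
Let tpi0 : 0 < tpi. Proof. by rewrite mulr_gt0 ?pi_gt0. Qed.
Let itpi0 : tpi^-1 != 0. Proof. by rewrite invr_eq0 gt_eqF. Qed.

Lemma phi_rangeE x : phi_range mu x <-> exists2 u, 0 < u < 1 & x = G u.
Proof.
split=> [[t /=]|[u /andP[u0 u1] ->]].
  rewrite in_itv/= => /andP[t0 t1] <-; exists (t / tpi).
    by rewrite divr_gt0//= ltr_pdivrMr// mul1r.
  rewrite /phi -[quantile_per mu]/(periodize G) periodizeE//.
  by rewrite divr_gt0//= ltr_pdivrMr// mul1r.
exists (tpi * u); first by rewrite /= in_itv/= mulr_gt0//= gtr_pMr.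
rewrite /phi -[quantile_per mu]/(periodize G) -/tpi mulrC mulKf ?gt_eqF//.
by rewrite periodizeE// u0.
Qed.

Lemma hilbert2pi_truncE u eta : 0 < u < 1 -> 0 < eta < pi ->
  hilbert2pi_trunc (phi mu) (2 * pi * u) eta = hilbert1_trunc (quantile_per mu) u (eta / (2 * pi)).
Proof.
move=> u01 /andP[eta0 eta1]; rewrite -/tpi; set e := eta / tpi.
have e12 : 0 < e < 2^-1.
  rewrite divr_gt0//= ltr_pdivrMr// /tpi mulrA mulVf ?mul1r//.
have iL := trunc_integrable GL1 u01 e12.
have mD : measurable ([set t | e <= `|t| <= 2^-1] : set (measurableTypeR R)).
  have := @normr_measurable R setT measurableT _ (measurable_itv `[e, 2^-1]).
  by rewrite setTI; congr measurable.
rewrite /hilbert1_trunc -[quantile_per mu]/(periodize G) (Rintegral_affine 0 itpi0 mD iL).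
rewrite /hilbert2pi_trunc -/tpi gtr0_norm ?invr_gt0//; congr (_ * _).
have -> : (fun x : R => tpi^-1 * x + 0) @^-1` [set t | e <= `|t| <= 2^-1] = [set t | eta <= `|t| <= pi].
  have e2 : 2^-1 = tpi^-1 * pi :> R by rewrite /tpi invfM -mulrA mulVf ?mulr1// gt_eqF ?pi_gt0.
  have e1 : e = tpi^-1 * eta by rewrite mulrC.
  apply/seteqP; split => t /=;
  by rewrite addr0 normrM (gtr0_norm (_ : 0 < tpi^-1)) ?invr_gt0// e1 e2 !ler_pM2l ?invr_gt0.
apply: eq_Rintegral => t _; rewrite addr0 /phi.
have -> : (tpi * u - t) / tpi = u - tpi^-1 * t by field; rewrite gt_eqF.
congr (_ * cot _); rewrite /tpi; have := pi_gt0 R; move: (pi : R) => q q0.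
by field; rewrite gt_eqF.
Qed.

Lemma hilbert1_cvg u c : increasing01 G -> 0 < u < 1 -> cut G u c ->
  (hilbert1_trunc (quantile_per mu) u eta)%:E @[eta --> 0^'+] --> hW G (tpar u).
Proof. by move=> Gi u01 uc; exact: (hilbert1_trunc_cvg Gi GL1 u01 uc). Qed.

Lemma hilbert2pi_cvg u c : increasing01 G -> 0 < u < 1 -> cut G u c ->
  (hilbert2pi_trunc (phi mu) (2 * pi * u) eta)%:E @[eta --> 0^'+] --> hW G (tpar u).
Proof.
move=> Gi u01 uc.
have c1 : eta / tpi @[eta --> 0^'+] --> (0 : R)^'+.
  move=> A [d /= d0 hd]; exists (d * tpi) => /=; first exact: mulr_gt0.
  move=> t /= td t0; apply: hd => /=; last exact: divr_gt0.
  move: td; rewrite !sub0r !normrN normrM (gtr0_norm (_ : 0 < tpi^-1)) ?invr_gt0//.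
  by rewrite ltr_pdivrMr.
have := cvg_comp _ _ c1 (hilbert1_cvg Gi u01 uc); apply: cvg_trans.
apply: near_eq_cvg; near=> eta => /=; rewrite hilbert2pi_truncE//.
apply/andP; split; first by [].
by near: eta; exact: nbhs_right_lt (pi_gt0 R).
Unshelve. all: by end_near. Qed.


Let coef (k : R -> R) : measurable_fun [set: R] k -> (forall t, `|k t| <= 1) ->
  pi^-1 * \int[leb]_(t in `[0, 2 * pi]) (phi mu t * k t) =
  2 * I01 (fun s => k (2 * (pi * s)) * G s).
Proof.
move=> mk k1.
have hL : L1 (fun s => k (2 * (pi * s)) * G s).
  apply: (@L1M _ _ _ 1) => //; apply: measurable_funTS.
  by apply: (measurableT_comp mk); do 2 apply: measurable_funM => //.
have := integrable_affine 0 itpi0 (@measurable_unit_itv R) hL.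
rewrite /I01 (Rintegral_affine 0 itpi0 (@measurable_unit_itv R) hL).
have -> : (fun x : R => tpi^-1 * x + 0) @^-1` unit_itv = `]0, 2 * pi[%classic.
  apply/seteqP; split => t /=; rewrite /unit_itv/= !in_itv/= addr0 -/tpi;
  by rewrite mulrC pmulr_lgt0 ?invr_gt0// ltr_pdivrMr// mul1r.
set f := fun t : R => phi mu t * k t.
have E (t : R) : `]0, 2 * pi[%classic t -> k (2 * (pi * (tpi^-1 * t + 0))) * G (tpi^-1 * t + 0) = f t.
  rewrite /= in_itv/= -/tpi => /andP[t0 t1]; rewrite addr0 /f /phi -/tpi.
  rewrite -[quantile_per mu]/(periodize G) periodizeE; last first.
    by rewrite divr_gt0//= ltr_pdivrMr// mul1r.
  by rewrite (mulrA 2) -/tpi mulVKf ?gt_eqF// mulrC (mulrC t).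
move=> i.
have fi : leb.-integrable `]0, 2 * pi[ (EFin \o f).
  apply: eq_integrable i; first exact: measurable_itv.
  by move=> t /set_mem/E e /=; rewrite e.
have -> : \int[leb]_(t in `[0, 2 * pi]) f t = \int[leb]_(t in `]0, 2 * pi[) f t.
  by rewrite /Rintegral integral_itv_bndoo//; exact: measurable_int fi.
rewrite (@eq_Rintegral _ _ _ leb _ f); last by move=> t /set_mem/E.
rewrite mulrA gtr0_norm ?invr_gt0// -/tpi; congr (_ * _).
by rewrite /tpi invfM mulrA divff ?mul1r.
Qed.

Lemma cosine_coefE n : cosine_coef mu n = 2 * four_cos G n.
Proof.
rewrite /cosine_coef /four_cos (coef (k := fun t => cos (n%:R * t)))//.
  apply: continuous_measurable_fun => t; apply: continuous_comp; last exact: continuous_cos.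
  by apply: cvgM; [exact: cvg_cst|exact: cvg_id].
by move=> t; exact: cos_max.
Qed.

Lemma sine_coefE n : sine_coef mu n = 2 * four_sin G n.
Proof.
rewrite /sine_coef /four_sin (coef (k := fun t => sin (n%:R * t)))//.
  apply: continuous_measurable_fun => t; apply: continuous_comp; last exact: continuous_sin.
  by apply: cvgM; [exact: cvg_cst|exact: cvg_id].
by move=> t; exact: sin_max.
Qed.

End rescaling.

(** * Neighbourhoods and limits in the plane, in coordinates *)

Section plane_topology.
Context {R : realType}.
Local Open Scope complex_scope.
Implicit Types (z w : plane R) (A : set (plane R)).

Lemma planeB z w : z - w = (complex.Re z - complex.Re w) +i* (complex.Im z - complex.Im w).
Proof. by case: z; case: w. Qed.

Lemma plane_nbhsP w A : nbhs w A <-> exists2 e : R, 0 < e & forall z : plane R,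
  `|complex.Re z - complex.Re w| < e -> `|complex.Im z - complex.Im w| < e -> A z.
Proof.
split=> [/nbhs_ballP[[e e'] /= e0 hA]|[e e0 hA]].
  (* Radii of balls are complex numbers here; positivity forces the imaginary part to be 0. *)
  move: e0; rewrite ltcE/= => /andP[/eqP e'0 e0]; rewrite e'0 in hA.
  have e2 : 0 < e / 2 by rewrite divr_gt0.
  exists (e / 2) => // z h1 h2; apply: hA; rewrite -ball_normE /= distrC planeB.
  move: h1 h2; set p := _ - _; set q := _ - _ => h1 h2.
  rewrite normc_def /= ltcR -[ltRHS](ger0_norm (ltW e0)) -sqrtr_sqr ltr_sqrt ?exprn_gt0//.
  move: h1 h2; rewrite !ltr_norml => /andP[p1 p2] /andP[q1 q2].
  have : 0 < (e / 2 - p) * (e / 2 + p) by apply: mulr_gt0; lra.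
  have : 0 < (e / 2 - q) * (e / 2 + q) by apply: mulr_gt0; lra.
  have : 0 < e * e by exact: mulr_gt0.
  rewrite !expr2; lra.
apply/nbhs_ballP; exists (e%:C); first by rewrite /= ltcR.
move=> z; rewrite -ball_normE /= => h; apply: hA.
  have := le_lt_trans (normc_ge_Re (w - z)) h; rewrite ltcR distrC.
  by case: w h; case: z.
move: h; rewrite planeB normc_def /= ltcR; apply: le_lt_trans.
by rewrite distrC -sqrtr_sqr ler_sqrt ?lerDr ?sqr_ge0// addr_ge0 ?sqr_ge0.
Qed.

Lemma Re_continuous : continuous (fun z : plane R => complex.Re z).
Proof.
move=> w A /nbhs_ballP[e e0 hA]; apply/plane_nbhsP; exists e => // z h _.
by apply: hA; rewrite -ball_normE /= distrC.
Qed.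

Lemma Im_continuous : continuous (fun z : plane R => complex.Im z).
Proof.
move=> w A /nbhs_ballP[e e0 hA]; apply/plane_nbhsP; exists e => // z _ h.
by apply: hA; rewrite -ball_normE /= distrC.
Qed.

Lemma vertical_continuous x : continuous (fun t : R => x +i* t : plane R).
Proof.
move=> t A /plane_nbhsP[e e0 hA]; apply/nbhs_ballP; exists e => // s.
rewrite -ball_normE /= distrC => h; apply: hA => //=.
by rewrite subrr normr0.
Qed.

Lemma plane_cvg (S : nat -> plane R) (l : plane R) :
  complex.Re (S n) @[n --> \oo] --> complex.Re l ->
  complex.Im (S n) @[n --> \oo] --> complex.Im l -> S n @[n --> \oo] --> l.
Proof.
move=> /cvgrPdist_lt hr /cvgrPdist_lt hi A /plane_nbhsP[e e0 hA].
near=> n; apply: hA; rewrite distrC; near: n; [exact: hr|exact: hi].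
Unshelve. all: by end_near. Qed.

End plane_topology.

Section conformal_map.
Context {R : realType}.
Local Open Scope complex_scope.

Lemma disc_ptP (z : plane R) : `|z| < 1 <-> exists2 y, 0 < y & exists x, z = disc_pt x y.
Proof.
split=> [|[y y0 [x ->]]]; last first.
  by have := disc_pt_lt1 x y0; rewrite -ltcR; case: (disc_pt x y) => p q; rewrite normc_def.
case: z => a b; rewrite normc_def /= => h.
have ab : a ^+ 2 + b ^+ 2 < 1.
  move: h; rewrite -[1]/(1%:C) ltcR => h.
  by rewrite -(@sqr_sqrtr _ (a ^+ 2 + b ^+ 2)) ?addr_ge0 ?sqr_ge0// expr_lt1// sqrtr_ge0.
have a1 : a < 1.
  have b2 := sqr_ge0 b; rewrite ltNge; apply/negP => a1.
  have : 1 <= a ^+ 2 by rewrite expr_ge1//; lra.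
  lra.
have d0 : 0 < (1 - a) ^+ 2 + b ^+ 2.
  by rewrite ltr_pwDl ?sqr_ge0// exprn_gt0// subr_gt0.
set d := _ + _ in d0.
have y0 : 0 < (1 - a ^+ 2 - b ^+ 2) / d by rewrite divr_gt0//; lra.
(* Imaginary and real parts of i (1 + z) / (1 - z), the inverse Cayley map. *)
exists ((1 - a ^+ 2 - b ^+ 2) / d) => //; exists (- 2 * b / d).
set y := _ / d in y0 *; set x := - 2 * b / d.
have n0 : x +i* (y + 1) != 0 by rewrite eq_complex /= negb_and (gt_eqF (_ : 0 < y + 1)) ?orbT// ltr_wpDr.
rewrite /disc_pt; apply: (canRL (mulfK n0)); apply/eqP; rewrite eq_complex /=.
have dn : d != 0 by rewrite gt_eqF.
apply/andP; split; apply/eqP; rewrite /x /y /d; field; exact: dn.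
Qed.

End conformal_map.

(** * The domain as an epigraph of the envelope *)

Section domain.
Context {R : realType} (mu : probability (measurableTypeR R) R).
Local Notation F := (dist_fun mu).
Local Notation G := (quantile mu).
Hypotheses (mu0 : atomless mu) (GL1 : L1 G) (G0 : I01 G = 0).
Local Open Scope complex_scope.
Implicit Types (x y u c : R).
Let Gi : increasing01 G := quantile_increasing mu0.

(** [powser_cvg] with a = 1 and a = -i gives the two coordinates; the mean of G, which that limit
    subtracts, is 0. *)
Lemma phi_tilde_disc x y : 0 < y -> phi_tilde mu (disc_pt x y) = hu G x y +i* hv G x y.
Proof.
move=> y0; rewrite /phi_tilde; apply: cvg_lim; first exact: norm_hausdorff.
have E N : \sum_(1 <= n < N) (cosine_coef mu n -i* sine_coef mu n) * disc_pt x y ^+ n =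
    \sum_(1 <= n < N) (2 * four_cos G n -i* (2 * four_sin G n)) * disc_pt x y ^+ n.
  by apply: eq_bigr => n _; rewrite cosine_coefE// sine_coefE.
under eq_fun do rewrite E.
apply: plane_cvg => /=.
  have := @powser_cvg _ G x y 1 GL1 y0; rewrite G0 mulr0 subr0.
  under eq_fun do rewrite mul1r.
  by rewrite /hu (@I01_eq _ _ (fun s => kerP x y s * G s)) // => s _; rewrite mul1r.
have := @powser_cvg _ G x y (0 -i* 1) GL1 y0; rewrite G0 mulr0 subr0.
have iE (z : R[i]) : complex.Re ((0 -i* 1) * z) = complex.Im z.
  by case: z => a b /=; ring.
under eq_fun do rewrite iE.
by rewrite /hv (@I01_eq _ _ (fun s => kerQ x y s * G s)) // => s _; rewrite iE.
Qed.

(** Each image point lies on its own level curve, above the envelope by [hW_lt_hv]; conversely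
    [upper_region] reaches every point above it. *)
Lemma mu_domainE : mu_domain mu =
  [set w : plane R | 0 < F (complex.Re w) < 1 /\
    (hW G (tpar (F (complex.Re w))) < (complex.Im w)%:E)%E].
Proof.
apply/seteqP; split => [_ [z /= /disc_ptP[y y0 [x ->]] <-]|[c v] /= [c01 hw]].
  rewrite phi_tilde_disc//=.
  have c01 : 0 < F (hu G x y) < 1.
    apply/quantile_inrange => //; split.
      exact: hu_gt_some.
    exact: hu_lt_some.
  split => //; have := hW_lt_hv Gi GL1 c01 (quantile_cut c01) x y0.
  by rewrite subrr mulr0 addr0.
have [|x [y [y0 <- <-]]] := upper_region Gi GL1 c01 (quantile_cut c01) _ hw.
  by apply/quantile_inrange.
exists (disc_pt x y); first by apply/disc_ptP; exists y => //; exists x.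
exact: phi_tilde_disc.
Qed.

Lemma gammaE x : 0 < F x < 1 -> gamma mu x = hW G (tpar (F x)).
Proof.
move=> x01; apply: cvg_lim; first exact: ereal_hausdorff.
exact: (hilbert2pi_cvg GL1 Gi x01 (quantile_cut x01)).
Qed.

(** When [G (F x)] differs from x, both are cut levels at the parameter [F x], so G jumps there. *)
Lemma gamma_gap x : 0 < F x < 1 -> G (F x) != x -> gamma mu x = -oo%E.
Proof.
move=> x01 ne; rewrite gammaE//.
have c1 := cut_self Gi x01; have c2 := quantile_cut x01.
have [h|h|e] := ltgtP (G (F x)) x; [exact: (hW_gap Gi GL1 x01 c1 c2)|exact: (hW_gap Gi GL1 x01 c2 c1)|].
by rewrite e eqxx in ne.
Qed.

End domain.

(** * Boundaries of epigraphs *)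

Section level_sets.
Context {R : realType}.
Implicit Types (I : set R) (h : R -> \bar R) (x y L : R).

(** The point m is the leftmost one in [x1, x'] with h at least L. Upper semicontinuity puts m
    itself in that set; a value above L would give, by the absence of a left-hand drop, another such
    point left of m. The point x may lie outside I, which covers finite endpoints. *)
Lemma level_left I h : (forall x L, I x -> (h x < L%:E)%E ->
    exists2 d, 0 < d & forall x', `|x' - x| < d -> I x' /\ (h x' < L%:E)%E) ->
  (forall x x1 L, I x1 -> x1 < x -> (I x -> (L%:E < h x)%E) ->
    exists x', [/\ x1 < x', x' < x, I x' & (L%:E <= h x')%E]) ->
  (forall x y z, I x -> I z -> x <= y <= z -> I y) ->
  forall x x1 L, I x1 -> x1 < x -> (h x1 < L%:E)%E -> (I x -> (L%:E < h x)%E) ->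
  exists m, [/\ x1 < m, m < x, I m & h m = L%:E].
Proof.
move=> usc osc_left convexI x x1 L Ix1 x1x hx1 hx.
have [x' [x1x' x'x Ix' hx']] := osc_left _ _ _ Ix1 x1x hx.
pose T := [set t | x1 <= t <= x' /\ (L%:E <= h t)%E].
have Tx' : T x' by split => //; rewrite lexx ltW.
have hT : has_inf T by split; [exists x'|exists x1 => t [/andP[]]].
pose m := inf T.
have x1m : x1 <= m by apply: lb_le_inf; [exists x'|move=> t [/andP[]]].
have mx' : m <= x' by apply: ge_inf; [exact: hT.2|].
have Im : I m by apply: (convexI _ _ _ Ix1 Ix'); rewrite x1m.
have hm : (L%:E <= h m)%E.
  rewrite leNgt; apply/negP => /(usc _ _ Im)[d d0 hd].
  have [t [tx hLt] td] := inf_adherent d0 hT.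
  have mt : m <= t by apply: ge_inf; [exact: hT.2|].
  have [_] := hd t (ltac:(rewrite ger0_norm ?subr_ge0//; rewrite -/m in td; lra)).
  by rewrite ltNge hLt.
have x1m' : x1 < m.
  rewrite lt_neqAle x1m andbT; apply/negP => /eqP e.
  by move: hx1; rewrite e ltNge hm.
exists m; split => //; first exact: le_lt_trans mx' x'x.
apply/eqP; rewrite eq_le hm andbT leNgt; apply/negP => hLm.
have [t [t1 t2 It ht]] := osc_left _ _ _ Ix1 x1m' (fun _ => hLm).
have : m <= t.
  by apply: ge_inf; [exact: hT.2|split => //; rewrite ltW//= (le_trans (ltW t2))].
by rewrite leNgt t2.
Qed.


Lemma level_right I h : (forall x L, I x -> (h x < L%:E)%E ->
    exists2 d, 0 < d & forall x', `|x' - x| < d -> I x' /\ (h x' < L%:E)%E) ->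
  (forall x x1 L, I x1 -> x < x1 -> (I x -> (L%:E < h x)%E) ->
    exists x', [/\ x < x', x' < x1, I x' & (L%:E <= h x')%E]) ->
  (forall x y z, I x -> I z -> x <= y <= z -> I y) ->
  forall x x1 L, I x1 -> x < x1 -> (h x1 < L%:E)%E -> (I x -> (L%:E < h x)%E) ->
  exists m, [/\ x < m, m < x1, I m & h m = L%:E].
Proof.
move=> usc osc convexI x x1 L Ix1 xx1 hx1 hx.
have usc' t l : I (- t) -> (h (- t)%R < l%:E)%E ->
    exists2 d, 0 < d & forall t', `|t' - t| < d -> I (- t') /\ (h (- t')%R < l%:E)%E.
  move=> It hl; have [d d0 hd] := usc _ _ It hl; exists d => // t' td; apply: hd.
  by rewrite -opprD normrN.
have osc' t t1 l : I (- t1) -> t1 < t -> (I (- t) -> (l%:E < h (- t)%R)%E) ->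
    exists t', [/\ t1 < t', t' < t, I (- t') & (l%:E <= h (- t')%R)%E].
  move=> It1 tt hl.
  have [|t' [h1 h2 h3 h4]] := osc (- t) (- t1) l It1 _ hl; first by rewrite ltrN2.
  by exists (- t'); rewrite opprK ltrNr ltrNl.
have conv' t t' t'' : I (- t) -> I (- t'') -> t <= t' <= t'' -> I (- t').
  by move=> It It'' /andP[h1 h2]; apply: (convexI (- t'') _ (- t)) => //; rewrite !lerN2 h1 h2.
have xx : - x1 < - x by rewrite ltrN2.
have := @level_left [set t | I (- t)] (fun t => h (- t)) usc' osc' conv' (- x) (- x1) L.
rewrite /= !opprK => /(_ Ix1 xx hx1 hx)[m [m1 m2 Im hm]].
by exists (- m); split => //; [rewrite ltrNr|rewrite ltrNl].
Qed.

End level_sets.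

Section epigraph.
Context {R : realType}.
Local Open Scope complex_scope.
Variables (I : set R) (h : R -> \bar R).
Implicit Types (x y L : R).

Definition epigraph : set (plane R) :=
  [set w | I (complex.Re w) /\ (h (complex.Re w) < (complex.Im w)%:E)%E].

Definition graph : set (plane R) :=
  [set w | I (complex.Re w) /\ (complex.Im w)%:E = h (complex.Re w)].

Hypothesis usc : forall x L, I x -> (h x < L%:E)%E ->
  exists2 d, 0 < d & forall x', `|x' - x| < d -> I x' /\ (h x' < L%:E)%E.
Hypothesis osc_left : forall x x1 L, I x1 -> x1 < x -> (I x -> (L%:E < h x)%E) ->
  exists x', [/\ x1 < x', x' < x, I x' & (L%:E <= h x')%E].
Hypothesis osc_right : forall x x1 L, I x1 -> x < x1 -> (I x -> (L%:E < h x)%E) ->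
  exists x', [/\ x < x', x' < x1, I x' & (L%:E <= h x')%E].
Hypothesis convexI : forall x y z, I x -> I z -> x <= y <= z -> I y.

Lemma epigraph_open : open epigraph.
Proof.
rewrite openE => -[x y] [/= Ix hxy].
have [L hL Ly] : exists2 L : R, (h x < L%:E)%E & L < y.
  move: hxy; case: (h x) => [r| |]//; rewrite ?lte_fin => ry.
    by exists ((r + y) / 2); rewrite ?lte_fin; lra.
  by exists (y - 1); rewrite ?ltNyr//; lra.
have [d d0 hd] := usc Ix hL.
apply/plane_nbhsP; exists (Num.min d (y - L)); first by rewrite lt_min d0 subr_gt0.
move=> [x' y'] /=; rewrite !lt_min => /andP[h1 _] /andP[_ h2].
have [Ix' hx'] := hd _ h1; split => //=; apply: (lt_trans hx').
by rewrite lte_fin; move: h2; rewrite ltr_norml; lra.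
Qed.

Let level_near x x1 L : I x1 -> x1 != x -> (h x1 < L%:E)%E -> (I x -> (L%:E < h x)%E) ->
  exists m, [/\ `|m - x| < `|x1 - x|, I m & h m = L%:E].
Proof.
move=> Ix1 ne hx1 hx; have [lt|gt|e] := ltgtP x1 x; last by rewrite e eqxx in ne.
  have [m [m1 m2 Im hm]] := level_left usc osc_left convexI Ix1 lt hx1 hx.
  by exists m; split => //; rewrite !ltr0_norm ?subr_lt0//; lra.
have [m [m1 m2 Im hm]] := level_right usc osc_right convexI Ix1 gt hx1 hx.
by exists m; split => //; rewrite !gtr0_norm ?subr_gt0//; lra.
Qed.

Let boundaryE : boundary epigraph = closure epigraph `\` epigraph.
Proof. by rewrite /boundary (interior_id _).1//; exact: epigraph_open. Qed.

(* Off the graph, the height over a point of the closure stays below h by a margin. *)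
Let margin (w : plane R) e : ~ epigraph w -> ~ graph w -> 0 < e ->
  exists2 d, 0 < d <= e & I (complex.Re w) -> ((complex.Im w + d)%:E < h (complex.Re w))%E.
Proof.
case: w => x y nU nG e0 /=.
have [Ix|nI] := pselect (I x); last by exists e; rewrite ?e0 ?lexx.
have : (y%:E < h x)%E.
  rewrite lt_neqAle; apply/andP; split.
    by apply/eqP => hxy; apply: nG; split.
  by rewrite leNgt; apply/negP => hxy; apply: nU; split.
case: (h x) => [r| |]//; rewrite ?lte_fin => yr; last by exists e; rewrite ?e0 ?lexx ?ltry.
exists (Num.min e ((r - y) / 2)); first by rewrite lt_min e0 ge_min lexx divr_gt0 ?subr_gt0.
move=> _; rewrite lte_fin; have : Num.min e ((r - y) / 2) <= (r - y) / 2 by rewrite ge_min lexx orbT.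
lra.
Qed.

Lemma graph_sub_boundary : graph `<=` boundary epigraph.
Proof.
rewrite boundaryE => -[x y] [/= Ix hxy]; split; last by case=> /= _; rewrite hxy ltxx.
move=> A /plane_nbhsP[e e0 hA]; exists (x +i* (y + e / 2)); split.
  by split => //=; rewrite -hxy lte_fin; lra.
by apply: hA => /=; rewrite ?subrr ?normr0// addrAC subrr add0r ger0_norm; lra.
Qed.

(** Take a boundary point w off the graph and a nearby point of the epigraph at height y1. There h
    is below y1, whereas over the abscissa of w, if that lies in I, it is above y1; so h equals y1
    in between, which gives a graph point close to w. *)
Lemma boundary_epigraph : boundary epigraph = closure graph.
Proof.
apply/seteqP; split; last first.
  have -> : boundary epigraph = closure (boundary epigraph).
    rewrite boundaryE; apply/closure_id; apply: closedI; first exact: closed_closure.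
    exact/open_closedC/epigraph_open.
  exact/closure_subset/graph_sub_boundary.
rewrite boundaryE => w [cw nU].
have [Gw|nG] := pselect (graph w); first exact: subset_closure.
move=> A /plane_nbhsP[e e0 hA].
have [d /andP[d0 de] hd] := margin nU nG e0.
have : nbhs w [set z : plane R | `|complex.Re z - complex.Re w| < d /\ `|complex.Im z - complex.Im w| < d].
  by apply/plane_nbhsP; exists d.
move=> /cw[[x1 y1] [[/= Ix1 hx1] [/= d1 d2]]].
have y1d : y1 < complex.Im w + d by move: d2; rewrite ltr_norml; lra.
have ne : x1 != complex.Re w.
  apply/eqP => e1; rewrite e1 in Ix1 hx1; have := lt_trans (hd Ix1) hx1.
  by rewrite lte_fin; lra.
have [|m [m1 Im hm]] := level_near Ix1 ne hx1.
  by move=> /hd; apply: lt_trans; rewrite lte_fin.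
exists (m +i* y1); split; first by split.
apply: hA => /=; first by apply: (lt_trans m1); exact: lt_le_trans de.
exact: lt_le_trans de.
Qed.

(** Suppose an arc ends at w off the graph. Close to its end its height stays below that of w plus
    d. Its abscissa must cross, before the end, some x' where h is at least this value, as the
    absence of one-sided drops provides; there the arc would be under the graph. *)
Lemma accessible_boundary_epigraph : accessible_boundary R epigraph = graph.
Proof.
apply/seteqP; split=> [w [bw [sigma [cs hs s1]]]|w gw]; last first.
  split; first exact: graph_sub_boundary.
  (* Vertical segment descending to the graph point. *)
  exists (fun t => complex.Re w +i* (complex.Im w + (1 - t))); split.
  - apply: continuous_subspaceT => t.
    have ct : (fun t : R => complex.Im w + (1 - t)) t' @[t' --> t] --> complex.Im w + (1 - t).
      by apply: cvgD; [exact: cvg_cst|apply: cvgB; [exact: cvg_cst|exact: cvg_id]].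
    exact: (cvg_comp _ _ ct (@vertical_continuous _ _ _)).
  - move=> t /andP[t0 t1]; case: gw => Iw hw; split => //=; rewrite -hw lte_fin; lra.
  - by rewrite subrr addr0; case: (w).
have [cw nU] : closure epigraph w /\ ~ epigraph w by move: bw; rewrite boundaryE.
apply: contrapT => nG; have [d /andP[d0 _] hd] := margin nU nG ltr01.
have cI : {within `[0, 1], continuous (fun t => complex.Im (sigma t))}.
  by move=> t; apply: continuous_comp; [exact: cs|exact: Im_continuous].
have cR : {within `[0, 1], continuous (fun t => complex.Re (sigma t))}.
  by move=> t; apply: continuous_comp; [exact: cs|exact: Re_continuous].
have [t0 [t00 t01] ht0] : exists2 t0, 0 <= t0 /\ t0 < 1 & forall t, t0 <= t <= 1 ->
    complex.Im (sigma t) < complex.Im w + d.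
  move/subspace_continuousP : cI => /(_ 1); rewrite /= in_itv/= lexx ler01 => /(_ isT).
  rewrite /from_subspace s1 => /cvgrPdist_lt/(_ d d0)[r /= r0 hr].
  exists (Num.max 0 (1 - r / 2)); first by split; [rewrite le_max lexx|rewrite gt_max; apply/andP; split; lra].
  move=> t /andP[]; rewrite ge_max => /andP[h0 h1] h2.
  have := hr t; rewrite /= in_itv/= h0 h2 ger0_norm ?subr_ge0// => /(_ _ isT).
  by rewrite ltr_norml => h3; have := h3 ltac:(lra); lra.
set x1 := complex.Re (sigma t0).
have [Ix1 hx1] := hs t0 (ltac:(by rewrite t00)).
have hit x' : I x' -> ((complex.Im w + d)%:E <= h x')%E -> forall t, t0 <= t < 1 -> complex.Re (sigma t) <> x'.
  move=> Ix' hx' t /andP[h1 h2] e.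
  have [_] := hs t (ltac:(by rewrite h2 (le_trans t00))); rewrite e => h3.
  by have := ht0 t (ltac:(by rewrite h1 ltW)); rewrite -lte_fin => /(lt_trans h3); rewrite ltNge hx'.
have ne : x1 != complex.Re w.
  apply/eqP => e; have := hd; rewrite -e => /(_ Ix1) h1; have := lt_trans h1 hx1.
  by rewrite lte_fin; have := ht0 t0 (ltac:(by rewrite lexx ltW)); lra.
have cR0 : {within `[t0, 1], continuous (fun t => complex.Re (sigma t))}.
  apply: continuous_subspaceW cR => t /=; rewrite !in_itv/= => /andP[h1 ->].
  by rewrite (le_trans t00).
have [x' [Ix' hx' bx']] : exists x', [/\ I x', ((complex.Im w + d)%:E <= h x')%E &
    Num.min x1 (complex.Re w) <= x' <= Num.max x1 (complex.Re w) /\ x' != complex.Re w].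
  have [lt|gt|e] := ltgtP x1 (complex.Re w); last by rewrite e eqxx in ne.
    by have [x' [h1 h2 h3 h4]] := osc_left Ix1 lt hd; exists x'; split => //; rewrite (ltW h1) (ltW h2) lt_eqF.
  by have [x' [h1 h2 h3 h4]] := osc_right Ix1 gt hd; exists x'; split => //; rewrite (ltW h1) (ltW h2) gt_eqF.
have := IVT (ltW t01) cR0; rewrite s1 -/x1 => /(_ x' bx'.1)[t].
rewrite in_itv/= => /andP[h1 h2] e.
have t1 : t < 1.
  rewrite lt_neqAle h2 andbT; apply/eqP => t1; move: bx'.2; rewrite -e t1 s1 eqxx//.
exact: (hit x' Ix' hx' t (ltac:(by rewrite h1)) e).
Qed.

End epigraph.

(** * The boundary of the domain *)

Section boundary_of_domain.
Context {R : realType} (mu : probability (measurableTypeR R) R).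
Local Notation F := (dist_fun mu).
Local Notation G := (quantile mu).
Hypotheses (mu0 : atomless mu) (GL1 : L1 G).
Implicit Types (x y u c e L : R).
Let Gi : increasing01 G := quantile_increasing mu0.

Let I : set R := [set x | 0 < F x < 1].
Let h x : \bar R := hW G (tpar (F x)).

Lemma quantile_lt u x : 0 < u < 1 -> u < F x -> G u < x.
Proof.
move=> u01 ux; rewrite lt_neqAle -quantile_galois// (ltW ux) andbT.
by apply/eqP => e; move: ux; rewrite -e dist_fun_quantile// ltxx.
Qed.

(** Parameters u1 < [F x] < u2 close to [F x] have quantiles strictly on either side of x, and the
    Galois connection confines [F x'] between u1 and u2. *)
Lemma dist_fun_cont x e : 0 < F x < 1 -> 0 < e ->
  exists2 d, 0 < d & forall x', `|x' - x| < d -> `|F x' - F x| <= e.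
Proof.
move=> /andP[x0 x1] e0; set u := F x in x0 x1 *.
pose u1 := Num.max (u - e) (u / 2); pose u2 := Num.min (u + e) ((1 + u) / 2).
have u1u : u1 < u by rewrite gt_max; apply/andP; split; lra.
have u10 : 0 < u1 by rewrite lt_max; apply/orP; right; lra.
have uu2 : u < u2 by rewrite lt_min; apply/andP; split; lra.
have u21 : u2 < 1 by rewrite gt_min; apply/orP; right; lra.
have u1e : u - e <= u1 by rewrite le_max lexx.
have u2e : u2 <= u + e by rewrite ge_min lexx.
have u101 : 0 < u1 < 1 by apply/andP; split; lra.
have u201 : 0 < u2 < 1 by apply/andP; split; lra.
have g1 : G u1 < x by exact: quantile_lt.
have g2 : x < G u2 by rewrite quantile_ltE.
exists (Num.min (x - G u1) (G u2 - x)); first by rewrite lt_min !subr_gt0 g1.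
move=> x'; rewrite lt_min !ltr_norml => /andP[/andP[h1 _] /andP[_ h2]].
have f1 : u1 <= F x' by rewrite quantile_galois//; lra.
have f2 : F x' < u2 by rewrite -quantile_ltE//; lra.
by rewrite ler_norml; apply/andP; split; lra.
Qed.

(** [hW] is an infimum of functions continuous in the boundary point, and [tpar] after the
    distribution function is continuous. *)
Let usc x L : I x -> (h x < L%:E)%E ->
  exists2 d, 0 < d & forall x', `|x' - x| < d -> I x' /\ (h x' < L%:E)%E.
Proof.
move=> Ix /hW_lt[y y0 hy].
have e0 : 0 < L - hv G (tpar (F x)) y by rewrite subr_gt0.
have [d d0 hd] := huv_cont (tpar (F x)) GL1 y0 e0.
have [d1 d10 [C C0 hC]] := tpar_lip Ix.
have r0 : 0 < Num.min d1 (d / (2 * C)) by rewrite lt_min d10 divr_gt0// mulr_gt0.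
have [r r00 hr] := dist_fun_cont Ix r0.
exists r => // x' /hr; rewrite le_min => /andP[h1 h2].
have [Ix' h3] := hC _ h1; split => //.
have h4 : `|tpar (F x) - tpar (F x')| < d.
  rewrite distrC; apply: (le_lt_trans h3).
  move: h2; rewrite ler_pdivlMr ?mulr_gt0// => h2.
  rewrite (_ : _ * (2 * C) = C * `|F x' - F x| * 2) in h2; [lra|ring].
have [_ h5] := hd (tpar (F x')) y h4 (ltac:(by rewrite subrr normr0)) y0.
apply: (le_lt_trans (hW_le G (tpar (F x')) y0)); rewrite lte_fin.
by move: h5; rewrite ltr_norml; lra.
Qed.

(** Where h exceeds some real number it is finite, so G has no jump there and x is a quantile; the
    one-sided results for a finite envelope then apply. *)
Let on_curve x L : I x -> (L%:E < h x)%E -> G (F x) = x /\ exists2 w, h x = w%:E & L < w.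
Proof.
move=> Ix hx; split.
  apply/eqP; apply: contraTT hx => ne.
  by rewrite /h -gammaE// gamma_gap// -leNgt leNye.
move: hx (hW_lty G (tpar (F x))); rewrite -/(h x).
by case: (h x) => [w| |]//; rewrite lte_fin => Lw _; exists w.
Qed.

Let hG s : 0 < s < 1 -> I (G s) /\ h (G s) = hW G (tpar s).
Proof. by move=> s01; rewrite /I /h /= dist_fun_quantile. Qed.

(** Over a point of I this is [hW_left]. Otherwise x is at or beyond the right end of I, so G is
    bounded above by x and [hW_one] supplies arbitrarily large values near parameter 1. *)
Let osc_left x x1 L : I x1 -> x1 < x -> (I x -> (L%:E < h x)%E) ->
  exists x', [/\ x1 < x', x' < x, I x' & (L%:E <= h x')%E].
Proof.
move=> Ix1 x1x hx; have /andP[f0 f1] := Ix1.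
have [Ix|nI] := pselect (I x).
  have [Gx [w hw Lw]] := on_curve Ix (hx Ix).
  have f2 : F x1 < F x by rewrite -quantile_ltE// Gx.
  have e0 : 0 < w - L by rewrite subr_gt0.
  have d0 : 0 < F x - F x1 by rewrite subr_gt0.
  have [s [s1 s2 s3 hs]] := hW_left Gi GL1 Ix hw e0 d0.
  have s01 : 0 < s < 1 by rewrite s3 (lt_trans s2)//; case/andP: Ix.
  have [Is es] := hG s01; exists (G s); split => //.
  - by rewrite quantile_ltE//; lra.
  - exact: quantile_lt.
  - by rewrite es; apply: le_trans hs; rewrite lee_fin; lra.
have F1 : 1 <= F x.
  by rewrite leNgt; apply/negP => F1; apply: nI; rewrite /I/= F1 (lt_le_trans f0)// dist_fun_mono// ltW.
have Gm s : 0 < s < 1 -> G s < x.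
  by move=> s01; apply: quantile_lt => //; case/andP: s01 => _ s1; exact: lt_le_trans F1.
have d0 : 0 < 1 - F x1 by rewrite subr_gt0.
have [s [s1 s2 s3 hs]] := hW_one Gi GL1 L (fun s s01 => ltW (Gm s s01)) d0.
have s01 : 0 < s < 1 by rewrite s2 s3.
have [Is es] := hG s01; exists (G s); split => //; [|exact: Gm|by rewrite es].
by rewrite quantile_ltE//; lra.
Qed.

Let osc_right x x1 L : I x1 -> x < x1 -> (I x -> (L%:E < h x)%E) ->
  exists x', [/\ x < x', x' < x1, I x' & (L%:E <= h x')%E].
Proof.
move=> Ix1 x1x hx; have /andP[f0 f1] := Ix1.
have [Ix|nI] := pselect (I x).
  have [Gx [w hw Lw]] := on_curve Ix (hx Ix).
  (* If equal, x1 would lie in a flat stretch starting at x, where h is -oo, contradicting the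
     finite value shared with x. *)
  have f2 : F x < F x1.
    rewrite lt_neqAle dist_fun_mono ?ltW// andbT; apply/eqP => e.
    have : h x1 = -oo%E by rewrite /h -gammaE// gamma_gap// -e Gx lt_eqF.
    by rewrite /h -e -/(h x) hw.
  have e0 : 0 < w - L by rewrite subr_gt0.
  have d0 : 0 < F x1 - F x by rewrite subr_gt0.
  have [s [s1 s2 s3 hs]] := hW_right Gi GL1 Ix hw e0 d0.
  have s01 : 0 < s < 1 by rewrite s3 andbT; case/andP: Ix => h1 _; exact: lt_trans s1.
  have [Is es] := hG s01; exists (G s); split => //.
  - by rewrite quantile_ltE.
  - by apply: quantile_lt => //; lra.
  - by rewrite es; apply: le_trans hs; rewrite lee_fin; lra.
have F0 : F x <= 0.
  by rewrite leNgt; apply/negP => F0; apply: nI; rewrite /I/= F0 (le_lt_trans _ f1)// dist_fun_mono// ltW.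
have Gm s : 0 < s < 1 -> x < G s.
  by move=> s01; rewrite quantile_ltE//; case/andP: s01 => s0 _; exact: le_lt_trans F0 _.
have [s [s1 s2 s3 hs]] := hW_zero Gi GL1 L (fun s s01 => ltW (Gm s s01)) f0.
have s01 : 0 < s < 1 by rewrite s1 s3.
have [Is es] := hG s01; exists (G s); split => //; [exact: Gm|exact: quantile_lt|by rewrite es].
Qed.

Let convexI x y z : I x -> I z -> x <= y <= z -> I y.
Proof.
move=> /andP[x0 _] /andP[_ z1] /andP[xy yz]; apply/andP; split.
  by apply: (lt_le_trans x0); exact: dist_fun_mono.
by apply: le_lt_trans z1; exact: dist_fun_mono.
Qed.

Let gamma_curveE : gamma_curve mu = graph I h.
Proof.
apply/seteqP; split => [[x y] [/= /phi_rangeE[u u01 xu] hy]|[x y] [/= Ix hy]].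
  have [Ix _] := hG u01; rewrite -xu in Ix.
  by split => //=; rewrite hy gammaE.
have gx := gammaE mu0 GL1 Ix; split => /=; last by rewrite gx.
(* A finite height rules out a jump, so x is the quantile of [F x] and lies in the range of phi. *)
apply/phi_rangeE; exists (F x) => //; apply/esym/eqP; apply: contraT => ne.
by have := gamma_gap mu0 GL1 Ix ne; rewrite gx -/(h x) -hy.
Qed.

Hypothesis G0 : I01 G = 0.

Let mu_domain_epigraph : mu_domain mu = epigraph I h.
Proof. exact: mu_domainE. Qed.

Lemma mu_domain_accessible_boundary : accessible_boundary R (mu_domain mu) = gamma_curve mu.
Proof.
by rewrite mu_domain_epigraph gamma_curveE (accessible_boundary_epigraph usc osc_left osc_right).
Qed.

Lemma mu_domain_boundary : boundary (mu_domain mu) = closure (gamma_curve mu).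
Proof.
by rewrite mu_domain_epigraph gamma_curveE (boundary_epigraph usc osc_left osc_right convexI).
Qed.

End boundary_of_domain.

Theorem theorem19 (R : realType) (p : R)
    (mu : probability (measurableTypeR R) R)
    (p_gt1 : 1 < p)
    (mu_nondeg : not_dirac0 mu)
    (mu_mean : zero_mean mu)
    (mu_moment : finite_abs_moment mu p)
    (mu_atomless : atomless mu) :
  [/\ forall x : R, phi_range mu x ->
        [/\ cvg ((hilbert2pi_trunc (phi mu) (phi_inv mu x) eta)%:E
                   @[eta --> 0^'+]),
            cvg ((hilbert1_trunc (quantile_per mu) (dist_fun mu x) eta)%:E
                   @[eta --> 0^'+]) &
            gamma mu x = hilbert1 (quantile_per mu) (dist_fun mu x)],
      {ae mu, forall x : R, gamma mu x \is a fin_num},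
      accessible_boundary R (mu_domain mu) = gamma_curve mu &
      boundary (mu_domain mu) = closure (gamma_curve mu)].
Proof.
have GL1 := L1_quantile p_gt1 mu_moment.
have G0 := I01_quantile GL1 mu_mean.
have Gi := quantile_increasing mu_atomless.
split; last 2 first.
- exact: mu_domain_accessible_boundary.
- exact: mu_domain_boundary.
- move=> x /phi_rangeE[u u01 ->].
  have x01 : 0 < dist_fun mu (quantile mu u) < 1 by rewrite dist_fun_quantile.
  have c := quantile_cut x01.
  have c1 := hilbert1_cvg GL1 Gi x01 c; have c2 := hilbert2pi_cvg GL1 Gi x01 c.
  split.
  + by apply/cvg_ex; exists (hW (quantile mu) (tpar (dist_fun mu (quantile mu u)))).
  + by apply/cvg_ex; exists (hW (quantile mu) (tpar (dist_fun mu (quantile mu u)))).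
  + by rewrite gammaE//; apply/esym/cvg_lim => //; exact: ereal_hausdorff.
- have := ae_dist_fun mu_atomless (hW_fin_ae Gi GL1).
  apply: (@filterS _ _ (ae_filter_ringOfSetsType mu)) => x [x01 hx].
  by rewrite gammaE//; exact: hx.
Qed.
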